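(* Assume: $\langle\nu,e^{\alpha\phi}\rangle<\infty$ for every $\alpha>0$; $\mathcal{I}$ is lower semi-continuous on $\mathcal{P}_\phi(E)$; for every $s\in\mathcal{S}$, $\zeta_s$ is continuous and $|\zeta_s|\le C_s^\zeta[1+\phi]$ for some $C_s^\zeta\in[0,\infty)$; for every $t\in\mathcal{T}$, $\Psi_t$ is lower semi-continuous on $\mathcal{P}_\phi(E)$; the functions $\mathcal{F}$ and $\Psi_t$, $t\in\mathcal{T}$, are convex on $\mathcal{P}_\phi(E)$; $\mathcal{F}$ is bounded from below on $\mathcal{P}_\phi(E)$; and for any $\mu\in\mathcal{A}^\zeta$ the function $t\mapsto\Psi_t(\mu)$ is measurable. Assume there is $\varepsilon_*>0$ such that at every $\overline\mu\in\mathcal{D}_{\mathcal{I}}\cap\mathcal{A}^\zeta_{\Psi,\varepsilon_*}$: (a) $\mathcal{D}_{\mathcal{I}}$ is convex and $\mathcal{F}$ is differentiable at $\overline\mu$ w.r.t. the set of directions $\mathcal{D}_{\mathcal{I}}$; (b) $t\mapsto\Psi_t(\overline\mu)$ is continuous; for each $t$, $\Psi_t$ is differentiable at $\overline\mu$ w.r.t. the set of directions $\mathcal{P}_\phi(E)$, and for every $\mu\in\mathcal{P}_\phi(E)$, $\lim_{\varepsilon\to0^+}\sup_{t\in\mathcal{T}}\big|\varepsilon^{-1}[\Psi_t((1-\varepsilon)\overline\mu+\varepsilon\mu)-\Psi_t(\overline\mu)]-\langle\mu-\overline\mu,\frac{\delta\Psi_t}{\delta\mu}(\overline\mu)\rangle\big|=0$;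 for every $x\in E$, $t\mapsto\frac{\delta\Psi_t}{\delta\mu}(\overline\mu,x)$ is continuous; and there is $D^\Psi\in[0,\infty)$ (possibly depending on $\overline\mu$) with $\sup_{t}|\frac{\delta\Psi_t}{\delta\mu}(\overline\mu,x)|\le D^\Psi[1+\phi(x)]$ for all $x\in E$. Assume moreover that there exists $\tilde\mu\in\mathcal{D}_{\mathcal{I}}\cap\mathcal{A}^\zeta$ with $\Psi_t(\tilde\mu)<0$ for all $t\in\mathcal{T}$, and that every probability measure on $E$ with a bounded density w.r.t. $\tilde\mu$, or w.r.t. some $\overline\mu\in\mathcal{D}_{\mathcal{I}}\cap\mathcal{A}^\zeta_{\Psi,\varepsilon_*}$, belongs to $\mathcal{D}_{\mathcal{I}}$. For $\varepsilon\ge0$ let $\overline{\mathcal{I}}^\zeta_{\Psi,\varepsilon}:=\inf_{\mu\in\mathcal{D}_{\mathcal{I}}\cap\mathcal{A}^\zeta_{\Psi,\varepsilon}}\mathcal{I}(\mu)$. Then: 1. For every $\varepsilon\in[0,\varepsilon_*]$ this problem has a unique minimiser $\overline\mu_\varepsilon$. Every $\mu\in\mathcal{D}_{\mathcal{I}}\cap\mathcal{A}^\zeta$ is absolutely continuous w.r.t. $\overline\mu_\varepsilon$, and there exist $(\overline\zeta_\varepsilon,\overline\lambda_\varepsilon)\in L^1(E,d\overline\mu_\varepsilon)\times\mathcal{M}_+(\mathcal{T})$ and a measurable $\overline S_\varepsilon\subset E$ such that $\overline\mu_\varepsilon(\overline S_\varepsilon)=1$, $$\frac{d\overline\mu_\varepsilon}{d\nu}(x)=\frac1{\overline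 Z_\varepsilon}\mathbf{1}_{\overline S_\varepsilon}(x)\exp\Big[-\frac{\delta\mathcal{F}}{\delta\mu}(\overline\mu_\varepsilon,x)-\overline\zeta_\varepsilon(x)-\int_{\mathcal{T}}\frac{\delta\Psi_t}{\delta\mu}(\overline\mu_\varepsilon,x)\overline\lambda_\varepsilon(dt)\Big]$$ with normalising constant $\overline Z_\varepsilon\in(0,\infty)$, $\overline\zeta_\varepsilon$ belongs to the $L^1(E,d\overline\mu_\varepsilon)$-closure of $\mathrm{Span}(\zeta_s,s\in\mathcal{S})$ (hence $\int\overline\zeta_\varepsilon d\overline\mu_\varepsilon=0$), and $\Psi_t(\overline\mu_\varepsilon)=\varepsilon$ for $\overline\lambda_\varepsilon$-a.e. $t\in\mathcal{T}$. 2. Assume in addition that for any $\varepsilon\in[0,\varepsilon_*]$, $\nu(\overline S_\varepsilon)=1$, and for any $\mu\in\mathcal{A}^\zeta$, $\overline\zeta_\varepsilon\in L^1(E,d\mu)$ with $\langle\mu,\overline\zeta_\varepsilon\rangle=0$. Then the function $\varepsilon\mapsto\overline{\mathcal{I}}^\zeta_{\Psi,\varepsilon}$ is absolutely continuous on $[0,\varepsilon_*]$, $$\frac{d}{d\varepsilon}\overline{\mathcal{I}}^\zeta_{\Psi,\varepsilon}=-\overline\lambda_\varepsilon(\mathcal{T})\quad\text{for Lebesgue-a.e. }\varepsilon,$$ and there exists $C_{\mathrm{stab}}\in[0,\infty)$ such that for any $\varepsilon\in[0,\varepsilon_*]$, $0\le\overline{\mathcal{I}}^\zeta_{\Psi,0}-\overline{\mathcal{I}}^\zeta_{\Psi,\varepsilon}\le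 C_{\mathrm{stab}}\,\varepsilon$.
   Context: $E$ is a complete separable metric space with its Borel $\sigma$-algebra, $\mathcal{P}(E)$ the set of Borel probability measures on $E$, and $\langle\mu,f\rangle:=\int_E f\,d\mu$. Fix a continuous $\phi:E\to[0,\infty)$ and $\nu\in\mathcal{P}(E)$. Set $\mathcal{P}_\phi(E):=\{\mu\in\mathcal{P}(E):\langle\mu,\phi\rangle<\infty\}$, with the (metrizable) topology in which $\mu_k\to\mu$ iff $\langle\mu_k,\phi\rangle\to\langle\mu,\phi\rangle$ and $\langle\mu_k,f\rangle\to\langle\mu,f\rangle$ for every bounded continuous $f$. $H(\mu|\nu):=\int_E\log\frac{d\mu}{d\nu}d\mu$ if $\mu\ll\nu$, $+\infty$ otherwise. $\mathcal{F}:\mathcal{P}_\phi(E)\to(-\infty,+\infty]$ is measurable, $\mathcal{I}:=H(\cdot|\nu)+\mathcal{F}$ on $\mathcal{P}_\phi(E)$, and $\mathcal{D}_{\mathcal{I}}:=\{\mu\in\mathcal{P}_\phi(E):H(\mu|\nu)<+\infty,\ \mathcal{F}(\mu)<+\infty\}$. $\mathcal{S}$ is an arbitrary set, $(\zeta_s)_{s\in\mathcal{S}}$ a family of functions $E\to\mathbb{R}$; $\mathcal{T}$ is a compact metric space, $(\Psi_t)_{t\in\mathcal{T}}$ a family of functions $\mathcal{P}_\phi(E)\to\mathbb{R}$. Set $\mathcal{A}^\zeta:=\{\mu\in\mathcal{P}_\phi(E):\forall s\in\mathcal{S},\langle\mu,\zeta_s\rangle=0\}$ and, for $\varepsilon\ge0$,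 $\mathcal{A}_{\Psi,\varepsilon}:=\{\mu\in\mathcal{P}_\phi(E):\forall t\in\mathcal{T},\Psi_t(\mu)\le\varepsilon\}$ and $\mathcal{A}^\zeta_{\Psi,\varepsilon}:=\mathcal{A}^\zeta\cap\mathcal{A}_{\Psi,\varepsilon}$. $\mathcal{M}_+(\mathcal{T})$ is the cone of (finite) positive Radon measures on $\mathcal{T}$. Linear functional derivative: for a convex set $\mathcal{C}\subset\mathcal{P}(E)$ and $\mu\in\mathcal{C}$, a map $F:\mathcal{C}\to\mathbb{R}$ is differentiable at $\mu$ w.r.t. the set of directions $\mathcal{C}$ if there is a measurable $\frac{\delta F}{\delta\mu}(\mu):E\to\mathbb{R}$, $x\mapsto\frac{\delta F}{\delta\mu}(\mu,x)$, such that for every $\mu'\in\mathcal{C}$ it is $\mu'$-integrable and $\varepsilon^{-1}[F((1-\varepsilon)\mu+\varepsilon\mu')-F(\mu)]\to\langle\mu'-\mu,\frac{\delta F}{\delta\mu}(\mu)\rangle$ as $\varepsilon\to0^+$. It is normalised by $\langle\mu,\frac{\delta F}{\delta\mu}(\mu)\rangle=0$. *)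

(* Defs.v *)
From HB Require Import structures.
From mathcomp Require Import all_boot all_order all_algebra.
From mathcomp Require Import all_classical all_reals all_analysis.
From mathcomp Require Import measurable_realfun.

Set Implicit Arguments.
Unset Strict Implicit.
Unset Printing Implicit Defensive.

Import Order.TTheory GRing.Theory Num.Theory.
Import numFieldNormedType.Exports.

Local Open Scope classical_set_scope.
Local Open Scope ring_scope.
Local Open Scope charge_scope.

(* [measurableType] extends [pointedType], so spaces carrying a Borel
   sigma-algebra are pointed, hence nonempty. *)
#[short(type="pointedMetricType")]
HB.structure Definition PointedMetric (K : numDomainType) :=
  { M of Metric K M & isPointed M }.

#[short(type="completeMetricType")]
HB.structure Definition CompleteMetric (K : numDomainType) :=
  { M of Metric K M & Complete M }.

Definition separable_space (X : topologicalType) :=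
  exists2 D : set X, countable D & dense D.

Notation Borel X := (g_sigma_algebraType (@open X)).


Lemma continuous_Borel_measurable (R : realType) (X : ptopologicalType)
    (f : X -> R) :
  continuous f -> measurable_fun [set: Borel X] (f : Borel X -> R).
Proof.
move=> /continuousP cf.
apply: (measurability _ (RGenOInfty.measurableE R)) => _ [_ [a ->] <-].
rewrite setTI; apply: sub_sigma_algebra; apply: cf.
by rewrite set_itvE; exact: open_gt.
Qed.

Lemma cvg_initial (X : choiceType) (Y : topologicalType) (f : X -> Y)
    (G : set_system X) (x : X) :
  Filter G -> f @ G --> f x -> G --> (x : initial_topology f).
Proof.
move=> FG fG A; rewrite nbhsE => -[_ [[B oB <-] Bx] BA].
by apply: filterS BA _; apply: fG; exact: open_nbhs_nbhs.
Qed.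

(* The probability [(1 - a) mu + a mu'] for [a] in [0, 1]; other values of [a],
   never used, are truncated so that the mixture is total in [a]. *)
Section mixture.
Context d (X : measurableType d) (R : realType).

Definition unit_clamp (a : R) : R := Order.max 0 (Order.min a 1).

Lemma unit_clamp_ge0 (a : R) : 0 <= unit_clamp a.
Proof. by rewrite /unit_clamp le_max lexx. Qed.

Lemma unit_clamp_onem_ge0 (a : R) : 0 <= 1 - unit_clamp a.
Proof. by rewrite subr_ge0 /unit_clamp ge_max ler01 ge_min lexx orbT. Qed.

Lemma unit_clamp_id (a : R) : 0 <= a <= 1 -> unit_clamp a = a.
Proof.
by move=> /andP[a0 a1]; rewrite /unit_clamp (min_idPl a1) (max_idPr a0).
Qed.

Definition mixture (a : R) (mu mu' : probability X R) : set X -> \bar R :=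
  measure_add (mscale (NngNum (unit_clamp_onem_ge0 a)) mu)
              (mscale (NngNum (unit_clamp_ge0 a)) mu').

HB.instance Definition _ a mu mu' := Measure.on (mixture a mu mu').

Lemma mixture_setT a mu mu' : mixture a mu mu' setT = 1%E.
Proof.
rewrite /mixture measure_addE.
rewrite -[LHS]/((1 - unit_clamp a)%:E * mu setT + (unit_clamp a)%:E * mu' setT)%E.
by rewrite !probability_setT !mule1 -EFinD subrK.
Qed.

HB.instance Definition _ a mu mu' :=
  Measure_isProbability.Build _ _ _ (mixture a mu mu') (mixture_setT a mu mu').

Lemma mixtureE a mu mu' A : 0 <= a <= 1 ->
  mixture a mu mu' A = ((1 - a)%:E * mu A + a%:E * mu' A)%E.
Proof.
move=> a01; rewrite /mixture measure_addE.
rewrite -[LHS]/((1 - unit_clamp a)%:E * mu A + (unit_clamp a)%:E * mu' A)%E.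
by rewrite unit_clamp_id.
Qed.

End mixture.

Section entropy.
Context d (X : measurableType d) (R : realType).
Implicit Types mu nu : probability X R.
Local Open Scope ereal_scope.

Definition entropy mu nu : \bar R :=
  if `[< mu `<< nu >] then
    \int[mu]_x lne (('d (charge_of_finite_measure mu) '/d nu) x)
  else +oo.

Definition bounded_density mu mu0 := exists (f : X -> R) (M : R),
  [/\ measurable_fun setT f,
      (forall x, (0 <= f x <= M)%R) &
      forall A, measurable A -> mu A = \int[mu0]_(x in A) (f x)%:E].

End entropy.

Record moment_fun (R : realType) (E : completeMetricType R) := MomentFun {
  moment :> E -> R ;
  moment_continuous : continuous moment ;
  moment_ge0 : forall x, 0 <= moment x }.

Section moment_probability.
Context (R : realType) (E : completeMetricType R) (phi : moment_fun E).

Definition Pphi : Type :=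
  {mu : probability (Borel E) R | (\int[mu]_x (phi x)%:E < +oo)%E}.

Definition Pphi_val (mu : Pphi) : probability (Borel E) R := sval mu.
Coercion Pphi_val : Pphi >-> probability.

Lemma Pphi_dirac : (\int[\d_(point : Borel E)]_x (phi x)%:E < +oo :> \bar R)%E.
Proof.
rewrite integral_dirac//; first by rewrite diracT mul1e ltry.
apply/measurable_EFinP; apply: continuous_Borel_measurable.
exact: moment_continuous.
Qed.

HB.instance Definition _ := gen_eqMixin Pphi.
HB.instance Definition _ := gen_choiceMixin Pphi.
HB.instance Definition _ := isPointed.Build Pphi
  (exist _ (\d_(point : Borel E) : probability (Borel E) R) Pphi_dirac).

(* The topology on [Pphi] is the coarsest one making [mu |-> <mu, phi>] and
   [mu |-> <mu, f>], for [f] bounded continuous, continuous (see [Pphi_cvgP]).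
   [probability] consists of functions on all sets, whose values on
   non-measurable sets are irrelevant: elements of [Pphi] that agree on
   measurable sets are topologically indistinguishable, so lower semicontinuous
   and Borel functionals take the same value on them. *)
Definition test_fun : Type :=
  {f : E -> R | f = phi \/ (continuous f /\ bounded_fun f)}.

Definition pairing (mu : Pphi) : {ptws test_fun -> R} :=
  fun f => \int[mu]_x (sval f x).

HB.instance Definition _ := Topological.copy Pphi (initial_topology pairing).

Lemma pairing_cvg (G : set_system Pphi) (mu : Pphi) : Filter G ->
  G --> mu <-> forall f : test_fun, pairing ^~ f @ G --> pairing mu f.
Proof.
move=> FG; split=> [Gmu f|Gmu].
  pose ev (g : {ptws test_fun -> R}) : R := g f.
  have cev (g : {ptws test_fun -> R}) : ev h @[h --> g] --> ev g.
    have /cvg_sup/(_ f) h : nbhs g --> g by exact: cvg_id.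
    move=> A nA; apply: h.
    exact: (@initial_continuous _ _ (fun k : {ptws test_fun -> R} => k f) g).
  move=> A nA; apply: Gmu.
  exact: (@initial_continuous _ _ pairing mu _ (cev _ _ nA)).
apply: cvg_initial; apply/cvg_sup => f.
have FpG : Filter (pairing @ G) by exact: fmap_filter.
apply: (@cvg_initial _ _ (fun g : {ptws test_fun -> R} => (g : test_fun -> R) f) _ _ FpG).
exact: Gmu.
Qed.

Lemma Pphi_cvgP (mu_ : nat -> Pphi) (mu : Pphi) :
  mu_ @ \oo --> mu <->
  (\int[mu_ n]_x phi x) @[n --> \oo] --> \int[mu]_x phi x /\
  forall f : E -> R, continuous f -> bounded_fun f ->
    (\int[mu_ n]_x f x) @[n --> \oo] --> \int[mu]_x f x.
Proof.
split=> [/pairing_cvg cmu|[cphi cf]].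
  split=> [|f cf bf].
    exact: (cmu (exist _ (phi : E -> R) (or_introl erefl))).
  exact: (cmu (exist _ f (or_intror (conj cf bf)))).
apply/pairing_cvg => -[f [e|[c b]]]; last exact: cf.
by rewrite /pairing/= e.
Qed.

Lemma Pphi_mixture (a : R) (mu mu' : Pphi) :
  (\int[mixture a mu mu']_x (phi x)%:E < +oo)%E.
Proof.
have mphi : measurable_fun [set: Borel E] (fun x => (phi x)%:E).
  apply/measurable_EFinP; apply: continuous_Borel_measurable.
  exact: moment_continuous.
have phi0 (x : Borel E) : [set: Borel E] x -> (0 <= (phi x)%:E)%E.
  by move=> _; rewrite lee_fin; exact: moment_ge0.
rewrite ge0_integral_measure_add// !ge0_integral_mscale//=.
have fin (nu : Pphi) : (\int[nu]_x (phi x)%:E)%E \is a fin_num.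
  by rewrite ge0_fin_numE; [exact: (svalP nu)|exact: integral_ge0].
by rewrite ltey_eq fin_numD !fin_numM.
Qed.

Definition pmix (a : R) (mu mu' : Pphi) : Pphi :=
  exist _ (mixture a mu mu' : probability (Borel E) R) (Pphi_mixture a mu mu').

Definition convex_subset (C : set Pphi) := forall mu mu' (a : R),
  C mu -> C mu' -> 0 <= a <= 1 -> C (pmix a mu mu').

Definition convex_functional (G : Pphi -> \bar R) := forall mu mu' (a : R),
  0 <= a <= 1 -> (G (pmix a mu mu') <= (1 - a)%:E * G mu + a%:E * G mu')%E.

(* [g] is the normalised linear functional derivative of [G] at [mu] w.r.t. the
   set of directions [C]. *)
Definition is_lfderiv (C : set Pphi) (G : Pphi -> R) (mu : Pphi) (g : E -> R) :=
  [/\ convex_subset C, C mu,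
      measurable_fun [set: Borel E] g,
      forall mu', C mu' ->
        mu'.-integrable [set: Borel E] (EFin \o g) /\
        e^-1 * (G (pmix e mu mu') - G mu) @[e --> 0^'+] -->
          (\int[mu']_x g x) - (\int[mu]_x g x) &
      (\int[mu]_x g x) = 0].

Section problem.
Context (nu : probability (Borel E) R) (F : Pphi -> \bar R).
Context (S : Type) (zeta : S -> E -> R).
Context (T : pointedMetricType R) (Psi : T -> Pphi -> R).

Definition rate (mu : Pphi) : \bar R := (entropy mu nu + F mu)%E.

Definition rate_dom : set Pphi :=
  [set mu : Pphi | (entropy mu nu < +oo)%E /\ (F mu < +oo)%E].

Definition Azeta : set Pphi :=
  [set mu : Pphi | forall s, (\int[mu]_x (zeta s x)%:E = 0)%E].

Definition APsi (eps : R) : set Pphi := [set mu : Pphi | forall t, Psi t mu <= eps].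

Definition feasible (eps : R) : set Pphi :=
  rate_dom `&` (Azeta `&` APsi eps).

Definition value (eps : R) : \bar R :=
  ereal_inf [set rate mu | mu in feasible eps].

Definition is_minimiser (eps : R) (mu : Pphi) :=
  feasible eps mu /\ rate mu = value eps.

Definition span_zeta : set (E -> R) :=
  [set f | exists l : seq (R * S), f = \sum_(p <- l) p.1 *: zeta p.2].

Definition in_L1_closure (mu : Pphi) (A : set (E -> R)) (z : E -> R) :=
  mu.-integrable [set: Borel E] (EFin \o z) /\
  forall e : R, 0 < e -> exists2 f, A f &
    ('N[mu]_1[(fun x : Borel E => (z x - f x)%:E)] < e%:E)%E.

Context (dF : Pphi -> E -> R) (dPsi : T -> Pphi -> E -> R).

Definition gibbs_weight (mu : Pphi) (z : E -> R)
    (lam : {finite_measure set (Borel T) -> \bar R}) (x : E) : R :=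
  expR (- dF mu x - z x - (\int[lam]_t dPsi t mu x)).

(* [z], [lam] and [A] stand for zeta-bar, lambda-bar and S-bar at [mu]. *)
Definition gibbs_form (eps : R) (mu : Pphi) (z : E -> R)
    (lam : {finite_measure set (Borel T) -> \bar R}) (A : set (Borel E)) :=
  [/\ measurable A /\ mu A = 1%E,
      mu `<< nu /\
      (exists Z : R,
        [/\ 0 < Z,
            Z%:E = (\int[nu]_x (\1_A x * gibbs_weight mu z lam x)%:E)%E &
            {ae nu, forall x, ('d (charge_of_finite_measure mu) '/d nu) x =
              (Z^-1 * (\1_A x * gibbs_weight mu z lam x))%:E}]),
      in_L1_closure mu span_zeta z,
      (\int[mu]_x (z x)%:E = 0)%E &
      {ae lam, forall t, Psi t mu = eps}].

End problem.

End moment_probability.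

(* Absolute continuity on [[a, b]]; [trivIset] expresses that the intervals are
   pairwise disjoint. *)
Definition absolutely_continuous_on (R : realType) (a b : R) (f : R -> R) :=
  forall e : R, 0 < e -> exists2 d : R, 0 < d &
    forall (n : nat) (u v : 'I_n -> R),
      (forall i, [/\ a <= u i, u i <= v i & v i <= b]) ->
      trivIset setT (fun i => `]u i, v i[%classic) ->
      \sum_(i < n) (v i - u i) < d ->
      \sum_(i < n) `|f (v i) - f (u i)| < e.

(* Main.v *)
Require Import Defs.
From HB Require Import structures.
From mathcomp Require Import all_boot all_order all_algebra.
From mathcomp Require Import all_classical all_reals all_analysis.
From mathcomp Require Import measurable_realfun.
From mathcomp Require Import ring lra.

Set Implicit Arguments.
Unset Strict Implicit.
Unset Printing Implicit Defensive.

Import Order.TTheory GRing.Theory Num.Theory.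
Import numFieldNormedType.Exports.

Local Open Scope classical_set_scope.
Local Open Scope ring_scope.

(* Existence: along a minimising sequence the densities are Cauchy in L1(nu), by
   strict convexity of the entropy at midpoints and convexity of F; exponential
   moments of phi and bounded entropy give uniform integrability of phi, hence
   convergence in P_phi, and lower semicontinuity applies.

   Gibbs form: let f be the density of the minimiser and
   g = log f + dF - <mubar, log f>. First-order optimality says <w, g> >= 0 for
   every w in the domain satisfying the equality constraints and
   <w, dPsi_t> <= 0 for each active t. A duality argument in L1 then
   approximates g by combinations v - sum_i l_i dPsi_(t_i), with v in the span
   of the zeta_s, l_i >= 0 and t_i active; the Slater point bounds sum_i l_i,
   and compactness of T yields the measure lambda.

   Sensitivity: when f > 0 nu-a.e., convexity turns the Gibbs form into the
   subgradient inequality I(e') >= I(e) - lambda_e(T) (e' - e). So lambda_e(T) is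
   nonincreasing in e, the value is Lipschitz, and it is differentiable wherever
   lambda_e(T) is continuous, that is, off a countable set. *)

(** * The relative entropy integrand and densities *)

(** A perturbation of the minimiser must be a probability in the domain, and besides mixtures the
    supply of these is bounded densities with respect to [mubar] or the Slater point. The duality
    therefore runs in L1 of one reference measure, of density [a * r] with [r = f + dens mut] and
    [a = 1 + (|g0| + phi)]: a bounded dual function [h] reweights both measures at once, and
    dividing by [a] makes [g0], the [zeta s] and the [dPsi t] bounded. All bounded nonnegative
    functions are added to the cone, which forces [h] to be nonnegative; the auxiliary term they
    leave in the approximation is shown to be small at [mubar].

    The function [z] is defined by solving the Gibbs identity, so the exponent is exact at every
    point and only membership of [z] in the L1-closure of the span needs a limit.

    The entropy is treated through [ent x = x ln x - x + 1], which has the same integral at a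
    density but is nonnegative, so Fatou applies before any integrability of [f ln f] is known.
    Integrals over [T] are limits of finite sums, which yields measurability and Fubini from
    continuity in [t] alone. *)

Section relative_entropy_integrand.
Context {R : realType}.
Implicit Types x y a b s t : R.

(** Subtracting [x - 1], of [nu]-integral 0 at a probability density, keeps the entropy and makes
    the integrand nonnegative. Since [ln] is 0 at 0, [ent 0 = 1]. *)
Definition ent x := x * ln x - x + 1.

Lemma ln_le_sub1 x : 0 < x -> ln x <= x - 1.
Proof.
move=> x0; rewrite -[X in ln X](subrK 1) addrC; apply: le_ln1Dx.
by rewrite ltrBrDl subrr.
Qed.

(** Nonnegativity of the Bregman divergence [x ln (x / y) - x + y], from [ln u <= u - 1] at
    [u = y / x]. *)
Lemma ent_tangent x y : 0 <= x -> 0 < y -> ent y + (x - y) * ln y <= ent x.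
Proof.
move=> x0 y0; rewrite /ent.
have [->|xn0] := eqVneq x 0; first by rewrite mul0r; lra.
have {xn0}xp : 0 < x by rewrite lt_neqAle eq_sym xn0.
have : ln (y / x) <= y / x - 1 by exact/ln_le_sub1/divr_gt0.
rewrite ln_div ?posrE// => h.
have : x * (ln y - ln x) <= x * (y / x - 1) by rewrite ler_wpM2l.
rewrite (_ : x * (y / x - 1) = y - x); first by nra.
by field; rewrite gt_eqF.
Qed.

Lemma ent_ge0 x : 0 <= x -> 0 <= ent x.
Proof. by move=> /ent_tangent -/(_ 1 ltr01); rewrite /ent ln1; lra. Qed.

Lemma ent_convex t a b : 0 <= t <= 1 -> 0 <= a -> 0 <= b ->
  ent ((1 - t) * a + t * b) <= (1 - t) * ent a + t * ent b.
Proof.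
move=> /andP[t0 t1] a0 b0; set m := _ * a + _.
have m0 : 0 <= m by rewrite addr_ge0// mulr_ge0// subr_ge0.
have [mz|mn0] := eqVneq m 0.
  have /eqP : (1 - t) * a + t * b = 0 by [].
  rewrite paddr_eq0 ?mulr_ge0 ?subr_ge0// !mulf_eq0 => /andP[].
  move=> /orP[/eqP t1e|/eqP ->] /orP[/eqP te|/eqP ->].
  - by exfalso; lra.
  - have -> : t = 1 by lra.
    by rewrite mz subrr mul0r add0r mul1r.
  - by rewrite mz te subr0 mul1r mul0r addr0.
  - by rewrite mz -mulrDl subrK mul1r.
have mp : 0 < m by rewrite lt_neqAle eq_sym mn0.
have ha := ent_tangent a0 mp; have hb := ent_tangent b0 mp.
have : (1 - t) * (ent m + (a - m) * ln m) + t * (ent m + (b - m) * ln m) = ent m.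
  by rewrite /m; ring.
move=> <-; apply: lerD; rewrite ler_wpM2l// subr_ge0//.
Qed.

(** Fenchel-Young: the conjugate of [ent] is [expR a - 1], read off the tangent at [expR a]. With
    [a] a multiple of [phi] it trades exponential moments under [nu] for moments under a density of
    finite entropy. *)
Lemma ent_young a b : 0 <= b -> a * b <= ent b + expR a - 1.
Proof.
move=> b0; have := ent_tangent b0 (expR_gt0 a).
by rewrite /ent expRK; nra.
Qed.

(** Quantitative strict convexity: the midpoint gap dominates [(sqrt a - sqrt b)^2 / 2], while [|a -
    b| = |sqrt a - sqrt b| (sqrt a + sqrt b)]. The free weight [s] makes the bound linear in the
    gap, so that it integrates directly. *)
Lemma ent_gap s a b : 0 < s -> 0 <= a -> 0 <= b ->
  `|a - b| <= (ent a + ent b - 2 * ent ((a + b) / 2)) / s + s * (a + b).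
Proof.
move=> s0 a0 b0; set m := (a + b) / 2.
have m0 : 0 <= m by rewrite divr_ge0 ?addr_ge0.
(* Hellinger: with [m] the mean, [ln (m / x) <= 2 (sqrt (m / x) - 1)] *)
have key x : 0 <= x -> 0 < m ->
    2 * x - 2 * (Num.sqrt x * Num.sqrt m) <= x * (ln x - ln m).
  move=> x0 mp; have [->|xn0] := eqVneq x 0; first by rewrite sqrtr0; lra.
  have xp : 0 < x by rewrite lt_neqAle eq_sym xn0.
  have sxp : 0 < Num.sqrt x by rewrite sqrtr_gt0.
  have smp : 0 < Num.sqrt m by rewrite sqrtr_gt0.
  have e y : 0 < y -> ln y = 2 * ln (Num.sqrt y).
    move=> y0; rewrite -{1}(sqr_sqrtr (ltW y0)) expr2 lnM ?posrE ?sqrtr_gt0//.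
    by ring.
  rewrite (e _ xp) (e _ mp).
  have : ln (Num.sqrt m / Num.sqrt x) <= Num.sqrt m / Num.sqrt x - 1.
    exact/ln_le_sub1/divr_gt0.
  rewrite ln_div ?posrE// => h.
  have := ler_wpM2l x0 h.
  rewrite [X in _ <= X](_ : _ = Num.sqrt x * Num.sqrt m - x); first by nra.
  rewrite -{1 4}(sqr_sqrtr x0); field; exact: lt0r_neq0.
have gap : `|a - b| * s <=
    (ent a + ent b - 2 * ent m) + s * s * (a + b).
  have [mz|mn0] := eqVneq m 0.
    have ab : a + b = 0 by move: mz; rewrite /m; lra.
    have -> : a = 0 by lra.
    have -> : b = 0 by lra.
    rewrite mz /ent ln0// subrr normr0; lra.
  have mp : 0 < m by rewrite lt_neqAle eq_sym mn0.
  have ka := key _ a0 mp; have kb := key _ b0 mp.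
  have e : ent a + ent b - 2 * ent m =
      a * (ln a - ln m) + b * (ln b - ln m) by rewrite /ent /m; field.
  rewrite e.
  set p := Num.sqrt a in ka; set q := Num.sqrt b in kb; set r := Num.sqrt m in ka kb.
  have pa : a = p ^+ 2 by rewrite sqr_sqrtr.
  have qb : b = q ^+ 2 by rewrite sqr_sqrtr.
  have rm : a + b = 2 * r ^+ 2 by rewrite /r sqr_sqrtr// /m; field.
  have p0 : 0 <= p := sqrtr_ge0 _; have q0 : 0 <= q := sqrtr_ge0 _.
  have hel : (p - q) ^+ 2 / 2 <= a * (ln a - ln m) + b * (ln b - ln m).
    apply: le_trans (lerD ka kb).
    (* The surplus is an exact square because [a + b = 2 * r ^+ 2]. *)
    rewrite -subr_ge0 (_ : _ - _ = ((p + q) - 2 * r) ^+ 2 / 2).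
      by rewrite divr_ge0 ?sqr_ge0.
    have -> : 2 * a - 2 * (p * r) + (2 * b - 2 * (q * r)) =
      (a + b) + (2 * r ^+ 2) - 2 * (p + q) * r by rewrite -rm; ring.
    by rewrite pa qb; move: rm; rewrite pa qb => rm; nra.
  rewrite (_ : a - b = (p - q) * (p + q)); last by rewrite pa qb; ring.
  rewrite normrM (ger0_norm (addr_ge0 p0 q0)).
  (* AM-GM: [2 s |p - q| (p + q) <= (p - q)^2 + s^2 (p + q)^2]. *)
  have := sqr_ge0 (`|p - q| - s * (p + q)).
  rewrite sqrrB -normrX (ger0_norm (sqr_ge0 (p - q))) => h.
  have : (p + q) ^+ 2 <= 2 * (a + b) by rewrite pa qb; have := sqr_ge0 (p - q); nra.
  have s20 := mulr_gt0 s0 s0.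
  by nra.
rewrite -(ler_pM2r s0); apply: (le_trans gap).
rewrite [X in _ <= X]mulrDl divfK ?gt_eqF//; lra.
Qed.

Lemma measurable_ent : measurable_fun [set: R] ent.
Proof.
apply: measurable_funD => //; apply: measurable_funB => //.
by apply: measurable_funM => //; exact: measurable_ln.
Qed.

End relative_entropy_integrand.

(** Sends an error proportional to [s] to zero without a limit: a positive [a] is refuted at
    [s = min 1 (a / (2 C))]. *)
Lemma le0_of_small (R : realFieldType) (a C : R) :
  (forall s, 0 < s -> s <= 1 -> a <= s * C) -> a <= 0.
Proof.
move=> h; rewrite leNgt; apply/negP => a0.
have C0 : 0 < C by have := h 1 ltr01 (lexx 1); rewrite mul1r; exact: lt_le_trans.
pose s := Num.min 1 (a / (2 * C)).
have s0 : 0 < s by rewrite lt_min ltr01 divr_gt0// mulr_gt0.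
have := h s s0; rewrite ge_min lexx => /(_ isT); apply/negP; rewrite -ltNge.
apply: (@le_lt_trans _ _ (a / (2 * C) * C)).
  by rewrite ler_pM2r// ge_min lexx orbT.
rewrite (_ : _ * C = a / 2); last by field; rewrite gt_eqF.
by lra.
Qed.

Lemma small_mul (R : realFieldType) (e M : R) : 0 < e -> 0 <= M ->
  exists2 t, 0 < t & t * M <= e.
Proof.
move=> e0 M0; exists (e / (M + 1)); first by rewrite divr_gt0// ltr_wpDl.
by rewrite mulrAC ler_pdivrMr ?ltr_wpDl//; nra.
Qed.

Lemma norm_le_sqr (R : realFieldType) (t D : R) : 0 < t ->
  `|D| <= t + t^-1 * (D ^+ 2 / 4).
Proof.
move=> t0; rewrite -(ger0_norm (sqr_ge0 D)) normrX.
rewrite -subr_ge0 (_ : _ - _ = t^-1 * (`|D| / 2 - t) ^+ 2).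
  by rewrite mulr_ge0 ?sqr_ge0// invr_ge0 ltW.
by field; rewrite gt_eqF.
Qed.

(** * Integrals of real-valued functions *)

Section real_integrals.
Context d (X : measurableType d) (R : realType).
Variable mu : {measure set X -> \bar R}.
Implicit Types f g : X -> R.

Definition rint f := mu.-integrable setT (EFin \o f).

Lemma rint_measurable f : rint f -> measurable_fun setT f.
Proof. by move=> /measurable_int/measurable_EFinP. Qed.

Lemma rintD f g : rint f -> rint g -> rint (fun x => f x + g x).
Proof. by move=> hf hg; exact: (integrableD measurableT hf hg). Qed.

Lemma rintB f g : rint f -> rint g -> rint (fun x => f x - g x).
Proof. by move=> hf hg; exact: (integrableB measurableT hf hg). Qed.

Lemma rintZ k f : rint f -> rint (fun x => k * f x).
Proof. by move=> hf; exact: (integrableZl measurableT k hf). Qed.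

Lemma rintN f : rint f -> rint (fun x => - f x).
Proof.
by move=> /(rintZ (-1)); rewrite /rint; under eq_fun do rewrite mulN1r.
Qed.

Lemma rint_abs f : rint f -> rint (fun x => `|f x|).
Proof.
move=> hf; have := integrable_abse hf.
by rewrite /rint; congr integrable; apply/funext => x.
Qed.

Lemma rint_le f g : measurable_fun setT f -> (forall x, `|f x| <= g x) ->
  rint g -> rint f.
Proof.
move=> mf fg ig; apply: (le_integrable measurableT _ _ ig).
  exact/measurable_EFinP.
by move=> x _ /=; rewrite lee_fin (le_trans (fg x))// ler_norm.
Qed.

Lemma rint_ge0 f : measurable_fun setT f -> (forall x, 0 <= f x) ->
  (\int[mu]_x (f x)%:E < +oo)%E -> rint f.
Proof.
move=> mf f0 lt; apply/integrableP; split; first exact/measurable_EFinP.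
by under eq_integral do rewrite /= ger0_norm//.
Qed.

Lemma rintegralE f : rint f -> (\int[mu]_x (f x)%:E)%E = (\int[mu]_x f x)%:E.
Proof. by move=> hf; rewrite fineK//; exact: integrable_fin_num. Qed.

Lemma rint_lty f : rint f -> (\int[mu]_x (f x)%:E < +oo)%E.
Proof. by move=> hf; rewrite rintegralE// ltry. Qed.

Lemma rint_sum (I : Type) (s : seq I) (F : I -> X -> R) :
  (forall i, rint (F i)) -> rint (fun x => \sum_(i <- s) F i x).
Proof.
move=> iF; elim: s => [|i s ih].
  rewrite (_ : (fun x => _) = cst 0); first exact: integrable0.
  by apply/funext => x; rewrite big_nil.
rewrite (_ : (fun x => _) = (fun x => F i x + \sum_(j <- s) F j x)).
  exact: rintD.
by apply/funext => x; rewrite big_cons.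
Qed.

Lemma Rintegral_sum (I : Type) (s : seq I) (F : I -> X -> R) :
  (forall i, rint (F i)) ->
  \int[mu]_x (\sum_(i <- s) F i x) = \sum_(i <- s) \int[mu]_x F i x.
Proof.
move=> iF; elim: s => [|i s ih].
  by under eq_Rintegral do rewrite big_nil; rewrite big_nil /Rintegral integral0.
rewrite big_cons -ih -RintegralD//; [|exact: iF|exact: rint_sum].
by apply: eq_Rintegral => x _; rewrite big_cons.
Qed.

Lemma le_rint f g : rint f -> rint g -> (forall x, f x <= g x) ->
  \int[mu]_x f x <= \int[mu]_x g x.
Proof. by move=> hf hg fg; exact: le_Rintegral. Qed.

Lemma ae_eq_Rintegral f g : measurable_fun setT f -> measurable_fun setT g ->
  {ae mu, forall x, f x = g x} -> \int[mu]_x f x = \int[mu]_x g x.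
Proof.
move=> mf mg fg; congr fine; apply: ae_eq_integral => //.
- exact/measurable_EFinP.
- exact/measurable_EFinP.
- by apply: filterS fg => x /= ->.
Qed.

Lemma ae_eq_integrable (f g : X -> \bar R) : measurable_fun setT g ->
  ae_eq mu setT f g -> mu.-integrable setT f -> mu.-integrable setT g.
Proof.
move=> mg fg /integrableP[mf lt]; apply/integrableP; split => //.
apply: le_lt_trans lt; rewrite le_eqVlt; apply/orP; left; apply/eqP.
apply: ae_eq_integral => //; try exact: measurableT_comp.
by apply: filterS fg => x /= h _; rewrite h.
Qed.

Lemma ae_rint f g : measurable_fun setT g -> {ae mu, forall x, f x = g x} ->
  rint f -> rint g.
Proof.
move=> mg fg; apply: ae_eq_integrable; first exact/measurable_EFinP.
by apply: filterS fg => x /= ->.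
Qed.

Lemma Rdominated_convergence (f_ : nat -> X -> R) f g :
  (forall n, measurable_fun setT (f_ n)) -> measurable_fun setT f ->
  rint g -> (forall n x, `|f_ n x| <= g x) ->
  {ae mu, forall x, f_ n x @[n --> \oo] --> f x} ->
  [/\ rint f, \int[mu]_x `|f_ n x - f x| @[n --> \oo] --> (0 : R) &
      \int[mu]_x f_ n x @[n --> \oo] --> \int[mu]_x f x].
Proof.
move=> mf_ mf ig fg cf.
have [] := @dominated_convergence _ _ _ mu setT measurableT
  (fun n => EFin \o f_ n) (EFin \o f) (EFin \o g).
- by move=> n; exact/measurable_EFinP.
- exact/measurable_EFinP.
- apply: filterS cf => x cx _; apply: cvg_EFin => //; exact: nearW.
- exact: ig.
- by apply: aeW => x n _; rewrite /= lee_fin.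
move=> fi c0 cI; split=> //; first by apply: fine_cvg; exact: c0.
by apply: fine_cvg; rewrite rintegralE in cI *.
Qed.

End real_integrals.

Section finite_real_integrals.
Context d (X : measurableType d) (R : realType).
Variable mu : {finite_measure set X -> \bar R}.
Implicit Types f g : X -> R.

Lemma rint_cst (c : R) : rint mu (fun=> c).
Proof. exact: finite_measure_integrable_cst. Qed.

Lemma rint_bounded f (M : R) : measurable_fun setT f ->
  (forall x, `|f x| <= M) -> rint mu f.
Proof. by move=> mf fM; apply: (rint_le mf fM); exact: rint_cst. Qed.

End finite_real_integrals.

Lemma integral_prob_cst d (X : measurableType d) (R : realType)
  (P : probability X R) (c : R) : (\int[P]_x c%:E = c%:E)%E.
Proof.
rewrite integral_cst// (_ : _ setT = 1%E) ?mule1//.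
exact: probability_setT.
Qed.

Lemma Rintegral_prob_cst d (X : measurableType d) (R : realType)
  (P : probability X R) (c : R) : \int[P]_x c = c.
Proof. by rewrite /Rintegral integral_prob_cst. Qed.

Section Rintegral_rint.
Context d (X : measurableType d) (R : realType).
Variable mu : {measure set X -> \bar R}.
Implicit Types f g : X -> R.

Lemma RintD f g : rint mu f -> rint mu g ->
  \int[mu]_x (f x + g x) = \int[mu]_x f x + \int[mu]_x g x.
Proof. by move=> hf hg; rewrite RintegralD. Qed.

Lemma RintB f g : rint mu f -> rint mu g ->
  \int[mu]_x (f x - g x) = \int[mu]_x f x - \int[mu]_x g x.
Proof. by move=> hf hg; rewrite RintegralB. Qed.

Lemma RintZ k f : rint mu f -> \int[mu]_x (k * f x) = k * \int[mu]_x f x.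
Proof. by move=> hf; rewrite RintegralZl. Qed.

End Rintegral_rint.

(** * Densities, change of measure and entropy *)

Section densities.
Context d (X : measurableType d) (R : realType).
Local Open Scope ereal_scope.

(** The density is real and nonnegative at every point, so pointwise inequalities on [ent] apply
    without exceptional sets. *)
Definition has_density (mu nu : set X -> \bar R) (f : X -> R) :=
  [/\ measurable_fun setT f, (forall x, (0 <= f x)%R) &
      forall A, measurable A -> mu A = \int[nu]_(x in A) (f x)%:E].

(** The two proofs are arguments so that the measure structure, which depends on them, can be
    attached to the set function itself. *)
Definition density_measure (nu : {measure set X -> \bar R}) (f : X -> R)
  & measurable_fun setT f & (forall x, (0 <= f x)%R) : set X -> \bar R :=
  fun A => \int[nu]_(x in A) (f x)%:E.

Section instance.
Variables (nu : {measure set X -> \bar R}) (f : X -> R).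
Hypotheses (mf : measurable_fun setT f) (f0 : forall x, (0 <= f x)%R).

Let density0 : density_measure nu mf f0 set0 = 0.
Proof. by rewrite /density_measure integral_set0. Qed.

Let density_ge0 A : 0 <= density_measure nu mf f0 A.
Proof. by apply: integral_ge0 => x _; rewrite lee_fin. Qed.

Let density_sigma_additive : semi_sigma_additive (density_measure nu mf f0).
Proof.
move=> A mA tA mUA; rewrite /density_measure.
rewrite ge0_integral_bigcup//; last by move=> x _; rewrite lee_fin.
  apply: is_cvg_ereal_nneg_natsum_cond => n _ _.
  by apply: integral_ge0 => x _; rewrite lee_fin.
by apply/measurable_EFinP; exact: measurable_funTS.
Qed.

HB.instance Definition _ := isMeasure.Build _ _ _ (density_measure nu mf f0)
  density0 density_ge0 density_sigma_additive.

End instance.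

Lemma probability_of_density (nu : {measure set X -> \bar R}) (f : X -> R) :
  measurable_fun setT f -> (forall x, (0 <= f x)%R) ->
  \int[nu]_x (f x)%:E = 1 ->
  exists P : probability X R, has_density P nu f.
Proof.
move=> mf f0 f1.
pose P : probability X R := HB.pack (density_measure nu mf f0)
  (Measure_isProbability.Build _ _ _ (density_measure nu mf f0) f1).
by exists P.
Qed.

Lemma finite_measure_of_density (nu : {measure set X -> \bar R}) (f : X -> R) :
  measurable_fun setT f -> (forall x, (0 <= f x)%R) ->
  \int[nu]_x (f x)%:E < +oo ->
  exists P : {finite_measure set X -> \bar R}, has_density P nu f.
Proof.
move=> mf f0 f1.
have fin : fin_num_fun (density_measure nu mf f0).
  by apply: lty_fin_num_fun.
pose P : {finite_measure set X -> \bar R} := HB.pack (density_measure nu mf f0)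
  (Measure_isFinite.Build _ _ _ (density_measure nu mf f0) fin).
by exists P.
Qed.

Lemma has_density_dominates (mu : {finite_measure set X -> \bar R}) (nu : {measure set X -> \bar R}) f :
  has_density mu nu f -> mu `<< nu.
Proof.
move=> [mf f0 fE]; apply/null_content_dominatesP => A mA nA.
rewrite fE//; apply: null_set_integral => //.
by apply/measurable_EFinP; exact: measurable_funTS.
Qed.

Lemma exists_density (mu : {finite_measure set X -> \bar R}) (nu : {finite_measure set X -> \bar R}) :
  mu `<< nu -> exists f, has_density mu nu f.
Proof.
move=> munu; set g := Radon_Nikodym_SigmaFinite.f mu nu.
have gfin x : g x \is a fin_num by exact: Radon_Nikodym_SigmaFinite.f_fin_num.
exists (fine \o g); split.
- apply/measurable_EFinP; rewrite (_ : EFin \o _ = g).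
    exact: measurable_int (Radon_Nikodym_SigmaFinite.f_integrable munu).
  by apply/funext => x /=; rewrite fineK.
- by move=> x; rewrite fine_ge0// Radon_Nikodym_SigmaFinite.f_ge0.
- move=> A mA; rewrite (Radon_Nikodym_SigmaFinite.f_integral munu)//.
  by apply: eq_integral => x _; rewrite /= fineK.
Qed.

Section with_density.
Variables (mu nu : {finite_measure set X -> \bar R}) (f : X -> R).
Hypothesis fE : has_density mu nu f.

Lemma density_integrable : nu.-integrable setT (EFin \o f).
Proof.
have [mf f0 h] := fE; apply/integrableP; split; first exact/measurable_EFinP.
rewrite (_ : (fun x => _) = EFin \o f); last first.
  by apply/funext => x /=; rewrite ger0_norm.
rewrite -h// ltey_eq fin_num_measure//.
Qed.

Lemma density_RN : ae_eq nu setT (EFin \o f) (Radon_Nikodym_SigmaFinite.f mu nu).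
Proof.
have [mf f0 h] := fE; have munu := has_density_dominates fE.
apply: integral_ae_eq => //.
- exact: density_integrable.
- exact: measurable_int (Radon_Nikodym_SigmaFinite.f_integrable munu).
- by move=> A _ mA; rewrite -h// (Radon_Nikodym_SigmaFinite.f_integral munu).
Qed.

Lemma ge0_integral_density (u : X -> \bar R) :
  measurable_fun setT u -> (forall x, 0 <= u x) ->
  \int[mu]_x u x = \int[nu]_x (u x * (f x)%:E).
Proof.
have [mf f0 h] := fE; have munu := has_density_dominates fE.
move=> mu_ u0.
rewrite -(Radon_Nikodym_SigmaFinite.change_of_variables munu u0 measurableT mu_).
apply: ae_eq_integral => //.
- apply: emeasurable_funM => //.
  exact: measurable_int (Radon_Nikodym_SigmaFinite.f_integrable munu).
- by apply: emeasurable_funM => //; exact/measurable_EFinP.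
- by apply: ae_eqe_mul2l; apply: ae_eq_sym; exact: density_RN.
Qed.

Lemma integrable_density (u : X -> R) : measurable_fun setT u ->
  mu.-integrable setT (EFin \o u) <->
  nu.-integrable setT (EFin \o (fun x => (u x * f x)%R)).
Proof.
have [mf f0 h] := fE => mu_.
have e : \int[mu]_x `|(EFin \o u) x| = \int[nu]_x `|(EFin \o (fun x => (u x * f x)%R)) x|.
  rewrite ge0_integral_density//.
    by apply: eq_integral => x _ /=; rewrite normrM EFinM (ger0_norm (f0 x)).
  by apply/measurable_EFinP; exact: measurableT_comp.
split=> /integrableP[_ lt]; apply/integrableP; split.
- by apply/measurable_EFinP; exact: measurable_funM.
- by rewrite -e.
- exact/measurable_EFinP.
- by rewrite e.
Qed.

Lemma integral_density (u : X -> R) : measurable_fun setT u ->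
  \int[mu]_x (u x)%:E = \int[nu]_x (u x * f x)%:E.
Proof.
have [mf f0 h] := fE => mu_; rewrite integralE [RHS]integralE.
have muE : measurable_fun setT (EFin \o u) by exact/measurable_EFinP.
rewrite !ge0_integral_density//; last 2 first.
- exact: measurable_funeneg.
- exact: measurable_funepos.
congr (_ - _); apply: eq_integral => x _.
- by rewrite !funeposE/= EFinM maxe_pMl ?lee_fin// mul0e.
- by rewrite !funenegE/= -mulNr EFinM maxe_pMl ?lee_fin// mul0e.
Qed.

Lemma Rintegral_density (u : X -> R) : measurable_fun setT u ->
  (\int[mu]_x u x = \int[nu]_x (u x * f x))%R.
Proof. by move=> mu_; rewrite /Rintegral integral_density. Qed.

Lemma density_neq0 : mu [set x | f x = 0%R] = 0.
Proof.
have [mf f0 h] := fE.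
have mA : measurable [set x | f x = 0%R].
  by have := mf measurableT _ (measurable_set1 0%R); rewrite setTI.
rewrite h//; apply: integral0_eq => x -> //.
Qed.

End with_density.

Section probability_density.
Variables (mu nu : probability X R) (f : X -> R).
Hypothesis fE : has_density mu nu f.

Lemma density_charge_RN :
  ae_eq nu setT (Radon_Nikodym (charge_of_finite_measure mu) nu) (EFin \o f).
Proof.
have munu := has_density_dominates fE.
apply: ae_eq_trans (ae_eq_sym (density_RN fE)); apply: ae_eq_sym.
exact: ae_eq_Radon_Nikodym_SigmaFinite.
Qed.

Lemma integral_density1 : \int[nu]_x (f x)%:E = 1.
Proof. by have [_ _ h] := fE; rewrite -h// probability_setT. Qed.

Lemma Rintegral_density1 : (\int[nu]_x f x = 1)%R.
Proof. by rewrite /Rintegral integral_density1. Qed.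

Lemma rint_ent_density : rint nu (fun x => ent (f x)) <->
  rint nu (fun x => (ln (f x) * f x)%R).
Proof.
have [mf f0 h] := fE.
have iF1 := rintB (density_integrable fE) (rint_cst nu 1).
split=> ih.
- have := rintD ih iF1; congr (rint nu _).
  by apply/funext => x; rewrite /ent; ring.
- have := rintB ih iF1; congr (rint nu _).
  by apply/funext => x; rewrite /ent; ring.
Qed.

(** Infinite entropy is covered too. Under [mu] the logarithm of the Radon-Nikodym derivative may be
    replaced by [ln (f x)], since [{f = 0}] is [mu]-null; the correction [f - 1] has [nu]-integral
    0. *)
Lemma entropyE : entropy mu nu = \int[nu]_x (ent (f x))%:E.
Proof.
have [mf f0 h] := fE.
have munu := has_density_dominates fE.
rewrite /entropy asboolT//.
have mlf : measurable_fun setT (fun x => ln (f x)).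
  exact: measurableT_comp.
set g := Radon_Nikodym _ _.
have mg : measurable_fun setT g by exact: measurable_int (Radon_Nikodym_integrable _).
have gfin x : g x \is a fin_num by exact: Radon_Nikodym_fin_num.
transitivity (\int[mu]_x (ln (f x))%:E).
  apply: ae_eq_integral => //.
  - have -> : (fun x => lne (g x)) =
        fun x => if (fine (g x) <= 0)%R then -oo else (ln (fine (g x)))%:E.
      by apply/funext => x; rewrite -(fineK (gfin x)).
    apply: measurable_fun_ifT => //.
    + apply: measurable_fun_ler => //.
      exact: measurableT_comp.
    + by apply/measurable_EFinP; do 2 apply: measurableT_comp => //.
  - exact/measurable_EFinP.
  - have f_neq0 : {ae mu, forall x, f x != 0%R}.
      exists [set x | f x = 0%R]; split.
      + by have := mf measurableT _ (measurable_set1 0%R); rewrite setTI.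
      + exact: (density_neq0 fE).
      + by move=> x /= /negP; rewrite negbK => /eqP.
    have gf := null_dominates_ae_eq measurableT munu density_charge_RN.
    apply: filterS2 f_neq0 gf => x fx gx _; rewrite /g gx//= leNgt.
    by rewrite lt_neqAle eq_sym fx f0.
rewrite (integral_density fE)//.
have e x : ent (f x) = (ln (f x) * f x - (f x - 1))%R by rewrite /ent; ring.
have iF := density_integrable fE.
have iF1 := rintB iF (rint_cst nu 1).
have [ih|nih] := pselect (rint nu (fun x => (ln (f x) * f x)%R)).
  rewrite [LHS]rintegralE// [RHS]rintegralE//; last exact/rint_ent_density.
  congr EFin; under [RHS]eq_Rintegral do rewrite e.
  rewrite [RHS]RintegralB// RintegralB//; last exact: rint_cst.
  by rewrite Rintegral_prob_cst Rintegral_density1 subrr subr0.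
have -> : \int[nu]_x (ent (f x))%:E = +oo.
  apply/eqP; rewrite -leye_eq leNgt; apply/negP => lt; apply: nih.
  apply/rint_ent_density/integrableP; split.
    by apply/measurable_EFinP; apply: measurableT_comp => //; exact: measurable_ent.
  by under eq_integral do rewrite /= ger0_norm ?ent_ge0//.
(* If [f ln f] is not integrable, its negative part still is, being at most 1 by [f ln f >= f - 1];
   hence both sides are [+oo]. *)
set k := fun x => (ln (f x) * f x)%:E.
have mk : measurable_fun setT k by apply/measurable_EFinP; exact: measurable_funM.
have neg : \int[nu]_x k^\- x \is a fin_num.
  rewrite ge0_fin_numE ?integral_ge0//.
  apply: (@le_lt_trans _ _ (\int[nu]_x 1%:E)); last first.
    by rewrite integral_prob_cst ltry.
  apply: ge0_le_integral => //; first exact: measurable_funeneg.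
  move=> x _; rewrite funenegE ge_max lee01 andbT /k -EFinN lee_fin.
  by have := ent_ge0 (f0 x); have := f0 x; rewrite /ent; lra.
rewrite integralE -/k.
suff -> : \int[nu]_x k^\+ x = +oo.
  by move: neg; set i := \int[nu]_x k^\- x; case: i.
apply/eqP; rewrite -leye_eq leNgt; apply/negP => lt; apply: nih.
apply/integrableP; split => //.
rewrite (_ : (fun x => _) = k^\+ \+ k^\-); last first.
  by rewrite -fune_abse.
rewrite ge0_integralD//; last 2 first.
- exact: measurable_funepos.
- exact: measurable_funeneg.
by rewrite lte_add_pinfty// -ge0_fin_numE// integral_ge0.
Qed.

End probability_density.
End densities.

Lemma has_density_trans d (X : measurableType d) (R : realType)
    (P mu : {finite_measure set X -> \bar R})
    (nu0 : {finite_measure set X -> \bar R}) (g k : X -> R) :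
  has_density P mu g -> has_density mu nu0 k -> has_density P nu0 (fun x => g x * k x).
Proof.
move=> [mg g0 gE] dk; have [mk k0 kE] := dk; split; first exact: measurable_funM.
  by move=> x; rewrite mulr_ge0.
move=> A mA; rewrite gE// integral_mkcond [RHS]integral_mkcond.
rewrite (ge0_integral_density dk).
- by apply: eq_integral => x _; rewrite !patchE; case: ifPn => _; rewrite ?EFinM ?mul0e.
- apply/(measurable_restrictT _ _).1 => //.
  by apply/measurable_EFinP; exact: measurable_funTS.
- by move=> x; rewrite patchE; case: ifPn => _; rewrite ?lee_fin.
Qed.

(** * Fatou bounds and completeness of L1 *)

Section fatou_bound.
Context d (X : measurableType d) (R : realType).
Variable mu : {measure set X -> \bar R}.

Lemma limn_einf_le_near (v : nat -> \bar R) (B : \bar R) :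
  (\forall n \near \oo, (v n <= B)%E) -> (limn_einf v <= B)%E.
Proof.
move=> [N _ NB]; rewrite limn_einf_lim; apply: lime_le.
  exact: is_cvg_einfs.
apply: nearW => n; apply: (@le_trans _ _ (v (maxn n N))).
  by apply: ereal_inf_lbound; exists (maxn n N) => //=; rewrite leq_maxl.
by apply: NB; rewrite /= leq_maxr.
Qed.

(** [U] may be infinite, which serves to detect where a slope diverges; the bound need only hold
    eventually, which serves for Cauchy tails. *)
Lemma fatou_le (u_ : nat -> X -> R) (U : X -> \bar R) (B : \bar R) :
  (forall n, measurable_fun setT (u_ n)) -> measurable_fun setT U ->
  (forall n x, 0 <= u_ n x) ->
  {ae mu, forall x, (u_ n x)%:E @[n --> \oo] --> U x} ->
  (\forall n \near \oo, (\int[mu]_x (u_ n x)%:E <= B)%E) ->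
  (\int[mu]_x U x <= B)%E.
Proof.
move=> mu_ mU u0 cu uB.
have mE n : measurable_fun setT (fun x => (u_ n x)%:E) by exact/measurable_EFinP.
rewrite (ae_eq_integral (fun x => limn_einf (fun n => (u_ n x)%:E)))//.
- apply: (@le_trans _ _ (limn_einf (fun n => (\int[mu]_x (u_ n x)%:E)%E))).
    by apply: fatou => // n x _; rewrite lee_fin.
  exact: limn_einf_le_near.
- rewrite /limn_einf; apply: measurableT_comp => //.
  apply: (@measurable_fun_limn_esup _ _ _ _ (fun n x => - (u_ n x)%:E)%E) => n.
  exact: measurableT_comp.
- by apply: filterS cu => x /cvg_limn_einf_sup[-> _].
Qed.

End fatou_bound.

Section L1_cauchy.
Context d (X : measurableType d) (R : realType).
Variable mu : {measure set X -> \bar R}.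

(** Riesz-Fischer, recording the almost everywhere convergence as well. For [s], the property
    [n <= s n] is enough to transfer eventual statements. *)
Lemma L1_cauchy_subsequence (f_ : nat -> X -> R) :
  (forall n, measurable_fun setT (f_ n)) ->
  (forall e : R, 0 < e -> exists N : nat, forall n m, (N <= n)%N -> (N <= m)%N ->
    (\int[mu]_x `|f_ n x - f_ m x|%:E <= e%:E)%E) ->
  exists (s : nat -> nat) (f : X -> R), [/\ forall n, (n <= s n)%N,
    measurable_fun setT f,
    {ae mu, forall x, f_ (s n) x @[n --> \oo] --> f x} &
    forall e : R, 0 < e -> \forall n \near \oo,
      (\int[mu]_x `|f_ (s n) x - f x|%:E <= e%:E)%E].
Proof.
move=> mf cf.
(* Given almost everywhere convergence, L1 convergence is Fatou applied in [p] to
   [|f_ (s n) - f_ (s p)|]. *)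
suff [s [f [sn mf' cvf]]] : exists (s : nat -> nat) (f : X -> R), [/\ forall n, (n <= s n)%N,
    measurable_fun setT f & {ae mu, forall x, f_ (s n) x @[n --> \oo] --> f x}].
  exists s, f; split => // e e0; have [N hN] := cf _ e0.
  exists N => // n /= Nn.
  apply: (@fatou_le _ _ _ _ (fun p x => `|f_ (s n) x - f_ (s p) x|)) => //.
  - by move=> p; apply: measurableT_comp => //; exact: measurable_funB.
  - by apply/measurable_EFinP; apply: measurableT_comp => //; exact: measurable_funB.
  - apply: filterS cvf => x cx; apply: cvg_EFin; first exact: nearW.
    by apply: cvg_norm; apply: cvgB => //; exact: cvg_cst.
  - near=> p; apply: hN; first exact: leq_trans (sn n).
    by apply: leq_trans (sn p); near: p; exact: nbhs_infty_ge.
(* Summable tolerances: the increments along [s] have an integrable sum [G], and the sequence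
   converges wherever [G] is finite. *)
have e0 (k : nat) : (0 : R) < 1 / (2 ^ k.+1)%:R.
  by rewrite divr_gt0// ltr0n expn_gt0.
have [N hN] := choice (fun k => cf _ (e0 k)).
pose s := fix s k := if k is k'.+1 then maxn (s k').+1 (N k) else N 0%N.
have sS k : (s k < s k.+1)%N by rewrite /= leq_max leqnn.
have sN k : (N k <= s k)%N by case: k => //= k; rewrite leq_max leqnn orbT.
have sn n : (n <= s n)%N by elim: n => // n ih; exact: leq_ltn_trans (sS n).
pose g k x : R := `|f_ (s k.+1) x - f_ (s k) x|.
have g0 k x : 0 <= g k x by exact: normr_ge0.
have mg k : measurable_fun setT (fun x => (g k x)%:E).
  by apply/measurable_EFinP; apply: measurableT_comp => //; exact: measurable_funB.
have ig k : (\int[mu]_x (g k x)%:E <= (1 / (2 ^ k.+1)%:R)%:E)%E.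
  by apply: hN => //; apply: leq_trans (sN k) (ltnW (sS k)).
pose G x : \bar R := (\sum_(0 <= k <oo) (g k x)%:E)%E.
have G0 x : (0 <= G x)%E by apply: nneseries_ge0 => k _ _; rewrite lee_fin.
have mG : measurable_fun setT G.
  by apply: ge0_emeasurable_sum => [k x _ _|k _]; rewrite ?lee_fin.
have iG : mu.-integrable setT G.
  apply/integrableP; split => //.
  under eq_integral do rewrite gee0_abs//.
  rewrite integral_nneseries//; last by move=> k x _; rewrite lee_fin.
  apply: (@le_lt_trans _ _ 1%:E); last by rewrite ltry.
  apply: le_trans (@epsilon_trick0 R 1 xpredT ler01).
  by apply: lee_nneseries => [k _ _|k _ //]; apply: integral_ge0 => x _; rewrite lee_fin.
exists s, (fun x => fine (limn_esup (fun n => (f_ (s n) x)%:E))); split => //.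
  apply: measurableT_comp => //.
  by apply: measurable_fun_limn_esup => n; exact/measurable_EFinP.
have := integrable_ae measurableT iG.
apply: filterS => x /(_ I) Gx.
have cv : cvgn (fun n => f_ (s n) x).
  pose u n := f_ (s n) x.
  have : cvgn [normed series (telescope u)].
    apply: nondecreasing_is_cvgn.
      by apply: nondecreasing_series => k _ _; exact: normr_ge0.
    exists (fine (G x)) => _ [n _ <-].
    rewrite -lee_fin fineK// /series/= -sumEFin.
    by apply: nneseries_lim_ge => k _ _; rewrite lee_fin.
  move=> /normed_cvg; rewrite telescopeK => cu.
  rewrite (_ : (fun n => _) = [sequence u n - u 0%N]_n + (fun=> u 0%N)).
    by apply: is_cvgD => //; exact: is_cvg_cst.
  by apply/funext => n; rewrite fctE /= subrK.
move: (cv) => /cvg_ex[l fl].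
suff -> : limn_esup (fun n => (f_ (s n) x)%:E) = l%:E by [].
have /cvg_limn_einf_sup[_ ->//] : (fun n => (f_ (s n) x)%:E) @ \oo --> l%:E.
by apply: cvg_EFin => //; near=> n.
Unshelve. all: by end_near. Qed.

End L1_cauchy.

(** * Approximation in L1 by elements of a convex cone *)

Section pseudo_huber.
Context {R : realType}.
Implicit Types x y u v : R.

(** The Euclidean norm of [(1, x)], a smooth stand-in for [|x|]. Its derivative [dhub] is bounded by
    1, so the derivative of the integral functional is a bounded test function. *)
Definition hub x := Num.sqrt (1 + x ^+ 2).
Definition dhub x := x / hub x.

Lemma hub_ge1 x : 1 <= hub x.
Proof.
rewrite -[leLHS]sqrtr1 ler_wsqrtr// lerDl; exact: sqr_ge0.
Qed.

Lemma hub_gt0 x : 0 < hub x.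
Proof. exact: lt_le_trans ltr01 (hub_ge1 x). Qed.

Lemma sqr_hub x : hub x ^+ 2 = 1 + x ^+ 2.
Proof. by rewrite sqr_sqrtr// addr_ge0// sqr_ge0. Qed.

Lemma dhub_le1 x : `|dhub x| <= 1.
Proof.
rewrite normrM normrV ?unitfE ?gt_eqF ?hub_gt0//.
rewrite (gtr0_norm (hub_gt0 x)) ler_pdivrMr ?hub_gt0// mul1r.
rewrite -sqrtr_sqr ler_wsqrtr// lerDr//.
Qed.

(** From [2 h h' <= h^2 + h'^2] with [h = hub x], [h' = hub (x + y)] and the squares expanded; the
    second-order coefficient is explicit. *)
Lemma hub_upper x y : hub (x + y) <= hub x + dhub x * y + y ^+ 2 / (2 * hub x).
Proof.
have h0 := hub_gt0 x.
rewrite [leRHS](_ : _ = (hub x ^+ 2 + hub (x + y) ^+ 2) / (2 * hub x)).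
  rewrite ler_pdivlMr ?mulr_gt0//.
  by have := sqr_ge0 (hub x - hub (x + y)); nra.
rewrite !sqr_hub /dhub.
transitivity (hub x ^+ 2 / hub x + x / hub x * y + y ^+ 2 / (2 * hub x)).
  by rewrite expr2 mulfK ?gt_eqF.
by rewrite sqr_hub; field; rewrite gt_eqF.
Qed.

(** The right-hand side is the defect in the triangle inequality for [(1, u)] and [(1, v)], and
    [dhub] is the second coordinate of the normalised vector. For vectors of length at least 1 the
    defect controls the difference of directions. *)
Lemma dhub_gap u v : (dhub u - dhub v) ^+ 2 / 4 <= hub u + hub v - 2 * hub ((u + v) / 2).
Proof.
set a := hub u; set b := hub v; set c := hub _.
have a1 : 1 <= a := hub_ge1 u; have b1 : 1 <= b := hub_ge1 v.
have c1 : 1 <= c := hub_ge1 _.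
have a2 : a ^+ 2 = 1 + u ^+ 2 := sqr_hub u.
have b2 : b ^+ 2 = 1 + v ^+ 2 := sqr_hub v.
have c2 : 4 * c ^+ 2 = 4 + (u + v) ^+ 2 by rewrite sqr_hub; field.
have ab0 : 0 < a * b by nra.
have key : a * b * (dhub u - dhub v) ^+ 2 <= (a + b) ^+ 2 - 4 * c ^+ 2.
  have -> : (a + b) ^+ 2 - 4 * c ^+ 2 =
      a * b * ((a^-1 - b^-1) ^+ 2 + (dhub u - dhub v) ^+ 2).
    transitivity (2 * (a * b) - 2 - 2 * (u * v)).
      by rewrite c2 sqrrD a2 b2; ring.
    transitivity (a ^+ 2 * (b / a) + b ^+ 2 * (a / b) - 2 - 2 * (u * v)).
      by field; rewrite !gt_eqF//; lra.
    by rewrite a2 b2 /dhub -/a -/b; field; rewrite !gt_eqF//; lra.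
  by rewrite ler_pM2l// lerDr sqr_ge0.
have cab : 2 * c <= a + b.
  rewrite -(@ler_pXn2r _ 2)// ?nnegrE; [|lra|lra].
  rewrite -subr_ge0 exprMn (_ : 2 ^+ 2 = 4); last by rewrite expr2; lra.
  by apply: le_trans key; rewrite mulr_ge0 ?sqr_ge0// ltW.
set D := (dhub u - dhub v) ^+ 2 in key *.
have D0 : 0 <= D by exact: sqr_ge0.
have h1 : a * b * D <= (a + b - 2 * c) * (2 * (a + b)).
  by apply: (le_trans key); nra.
have h2 : (a + b) / 2 <= a * b by nra.
have h3 : (a + b) / 2 * D <= (a + b - 2 * c) * (2 * (a + b)).
  by apply: le_trans h1; rewrite ler_wpM2r.
have : 0 < a + b by lra.
move=> ab; rewrite -(ler_pM2r ab); nra.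
Qed.

Lemma measurable_hub : measurable_fun [set: R] hub.
Proof.
apply: continuous_measurable_fun => x; apply: continuous_comp.
  by apply: cvgD; [exact: cvg_cst|exact: exprn_continuous].
exact: sqrt_continuous.
Qed.

Lemma measurable_dhub : measurable_fun [set: R] dhub.
Proof.
apply: continuous_measurable_fun => x; apply: cvgM; first exact: cvg_id.
apply: cvgV; first by rewrite gt_eqF// hub_gt0.
apply: (@continuous_comp _ _ _ (fun x => 1 + x ^+ 2) Num.sqrt).
  by apply: cvgD; [exact: cvg_cst|exact: exprn_continuous].
exact: sqrt_continuous.
Qed.

(** From [x^2 = (hub x - 1) (hub x + 1)] and AM-GM with weight [s]. It turns a small integral of
    [hub - 1] into a small L1 norm. *)
Lemma ge0_norm_le_hub s x : 0 < s ->
  `|x| <= (hub x - 1) * (s / 2 + s^-1 / 2) + s.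
Proof.
move=> s0; set a := hub x.
have a1 : 1 <= a := hub_ge1 x.
have a2 : `|x| ^+ 2 = (a - 1) * (a + 1).
  by rewrite -normrX ger0_norm ?sqr_ge0//; have := sqr_hub x; rewrite -/a; nra.
rewrite -(ler_pM2r s0).
have -> : ((a - 1) * (s / 2 + s^-1 / 2) + s) * s =
  ((a - 1) + s ^+ 2 * (a + 1)) / 2 by field; rewrite gt_eqF.
set p := Num.sqrt (a - 1); set q := Num.sqrt (a + 1).
have p2 : p ^+ 2 = a - 1 by rewrite sqr_sqrtr//; lra.
have q2 : q ^+ 2 = a + 1 by rewrite sqr_sqrtr//; lra.
have -> : `|x| = p * q.
  apply/eqP; rewrite -(@eqrXn2 _ 2)// ?mulr_ge0 ?sqrtr_ge0//.
  by rewrite a2 exprMn p2 q2.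
rewrite -p2 -q2; have := sqr_ge0 (p - s * q); nra.
Qed.

(** Convexity: the tangent at [x], evaluated at the origin, lies below [hub 0 = 1]. *)
Lemma hub_sub1_le x : hub x - 1 <= dhub x * x.
Proof.
have h0 := hub_gt0 x; have h1 := hub_ge1 x.
rewrite /dhub mulrAC ler_pdivlMr//.
by have := sqr_hub x; nra.
Qed.

End pseudo_huber.

Section bounded_functions.
Context d (X : measurableType d) (R : realType).

Definition bmfun (f : X -> R) :=
  measurable_fun setT f /\ exists M : R, forall x, `|f x| <= M.

Lemma bmfun_rint (mu : {finite_measure set X -> \bar R}) f : bmfun f -> rint mu f.
Proof. by move=> [mf [M fM]]; exact: rint_bounded fM. Qed.

Lemma bmfunM f g : bmfun f -> bmfun g -> bmfun (fun x => f x * g x).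
Proof.
move=> [mf [M fM]] [mg [N gN]]; split; first exact: measurable_funM.
by exists (M * N) => x; rewrite normrM ler_pM.
Qed.

Lemma bmfunD f g : bmfun f -> bmfun g -> bmfun (fun x => f x + g x).
Proof.
move=> [mf [M fM]] [mg [N gN]]; split; first exact: measurable_funD.
by exists (M + N) => x; rewrite (le_trans (ler_normD _ _))// lerD.
Qed.

Lemma bmfunZ k f : bmfun f -> bmfun (fun x => k * f x).
Proof.
move=> [mf [M fM]]; split; first exact: measurable_funM.
by exists (`|k| * M) => x; rewrite normrM ler_wpM2l.
Qed.

Lemma bmfunN f : bmfun f -> bmfun (fun x => - f x).
Proof.
move=> [mf [M fM]]; split; first exact: measurableT_comp.
by exists M => x; rewrite normrN.
Qed.

Lemma bmfunB f g : bmfun f -> bmfun g -> bmfun (fun x => f x - g x).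
Proof. by move=> bf bg; apply: bmfunD => //; exact: bmfunN. Qed.

Lemma bmfun_hub f : bmfun f -> bmfun (fun x => hub (f x)).
Proof.
move=> [mf [M fM]]; split.
  by apply: measurableT_comp => //; exact: measurable_hub.
exists (1 + `|M|) => x; rewrite ger0_norm ?sqrtr_ge0//.
rewrite -(@ler_pXn2r _ 2)// ?nnegrE ?sqrtr_ge0// sqr_hub sqrrD expr1n mul1r.
rewrite -addrA lerD2l ler_wpDl ?mulrn_wge0//.
rewrite -(ger0_norm (sqr_ge0 (f x))) normrX ler_pXn2r ?nnegrE//.
by rewrite (le_trans (fM x))// ler_norm.
Qed.

Lemma bmfun_dhub f : measurable_fun setT f -> bmfun (fun x => dhub (f x)).
Proof.
move=> mf; split; first by apply: measurableT_comp => //; exact: measurable_dhub.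
by exists 1 => x; exact: dhub_le1.
Qed.

End bounded_functions.

Section separation.
Context d (X : measurableType d) (R : realType).
Variable mu : {finite_measure set X -> \bar R}.

Let mass := fine (mu setT).

Let mass0 : 0 <= mass. Proof. exact: fine_ge0. Qed.

(* The dual certificate is the limit of the derivatives at a minimising
   sequence of the smooth coercive functional [k |-> int sqrt (1 + (g - k)^2)]. *)
Lemma L1_cone_duality (K : set (X -> R)) (g : X -> R) :
  (forall k, K k -> bmfun k) -> K (fun=> 0) ->
  (forall k1 k2, K k1 -> K k2 -> K (fun x => k1 x + k2 x)) ->
  (forall c k, 0 <= c -> K k -> K (fun x => c * k x)) ->
  measurable_fun setT g -> (forall x, `|g x| <= 1) ->
  (forall h, bmfun h -> (forall k, K k -> 0 <= \int[mu]_x (h x * k x)) ->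
     0 <= \int[mu]_x (h x * g x)) ->
  forall e : R, 0 < e -> exists2 k, K k & \int[mu]_x `|g x - k x| <= e.
Proof.
move=> Kb K0 KD KZ mg g1 hyp.
have bg : bmfun g by split => //; exists 1.
pose J (k : X -> R) := \int[mu]_x (hub (g x - k x) - 1).
have b1 c : bmfun (fun _ : X => c) by split => //; exists `|c|.
have bJ k : bmfun k -> bmfun (fun x => hub (g x - k x) - 1).
  by move=> bk; apply: bmfunB => //; apply: bmfun_hub; exact: bmfunB.
have iJ k : K k -> rint mu (fun x => hub (g x - k x) - 1).
  by move=> /Kb/bJ/bmfun_rint.
have J0 k : 0 <= J k.
  by apply: Rintegral_ge0 => x _; rewrite subr_ge0 hub_ge1.
have hJ : has_inf [set J k | k in K].
  split; first by exists (J (fun=> 0)), (fun=> 0).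
  by exists 0 => _ [k _ <-].
pose m := inf [set J k | k in K].
have m0 : 0 <= m by apply: lb_le_inf; [exact: hJ.1|move=> _ [k _ <-]].
have mJ k : K k -> m <= J k by move=> Kk; apply: ge_inf; [exact: hJ.2|exists k].
have Jm (e : R) : 0 < e -> exists2 k, K k & J k < m + e.
  by move=> /inf_adherent -/(_ _ hJ)[_ [k Kk <-]]; exists k.
have [e_ e_E] : exists e_ : nat -> R, forall n, e_ n = n.+1%:R^-1 by exists (fun n => n.+1%:R^-1).
have n0 n : 0 < e_ n by rewrite e_E invr_gt0.
have e_le n p : (n <= p)%N -> e_ p <= e_ n.
  by move=> np; rewrite !e_E lef_pV2 ?posrE ?ltr0n// ler_nat.
have e_small (e : R) : 0 < e -> \forall n \near \oo, e_ n < e.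
  move=> e0; near=> n; rewrite e_E.
  by near: n; exact: (near_infty_natSinv_lt (PosNum e0)).
have Jn n : exists k, K k /\ J k < m + e_ n.
  by have [k Kk Jk] := Jm _ (n0 n); exists k.
have [k_ k_P] := choice Jn.
pose h_ n x := dhub (g x - k_ n x).
have mk n : measurable_fun setT (k_ n) by case: (Kb _ (k_P n).1).
have mgk n : measurable_fun setT (fun x => g x - k_ n x) by exact: measurable_funB.
have bh n : bmfun (h_ n) by exact: bmfun_dhub.
have mh n : measurable_fun setT (h_ n) by case: (bh n).
(* The midpoint of [k_ n] and [k_ p] is in [K], so [J] is at least [m] there; [dhub_gap] then bounds
   the L2 distance of the derivatives. *)
have gapJ n p : \int[mu]_x ((h_ n x - h_ p x) ^+ 2 / 4) <= e_ n + e_ p.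
  have Kmid : K (fun x => 2^-1 * (k_ n x + k_ p x)).
    by apply: KZ; rewrite ?invr_ge0//; apply: KD; [exact: (k_P n).1|exact: (k_P p).1].
  apply: (@le_trans _ _ (J (k_ n) + J (k_ p) - 2 * J (fun x => 2^-1 * (k_ n x + k_ p x)))); last first.
    by have := mJ _ Kmid; have := (k_P n).2; have := (k_P p).2; lra.
  have i1 := iJ _ (k_P n).1; have i2 := iJ _ (k_P p).1; have i3 := iJ _ Kmid.
  rewrite /J -RintegralD// -RintegralZl// -RintegralB//; last 2 first.
  - exact: rintD.
  - exact: rintZ.
  apply: le_rint.
  - apply: bmfun_rint; rewrite (_ : (fun x => _) =
      fun x => 4^-1 * ((h_ n x - h_ p x) * (h_ n x - h_ p x))).
      by apply: bmfunZ; apply: bmfunM; exact: bmfunB.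
    by apply/funext => x; rewrite mulrC expr2.
  - by apply: rintB; [exact: rintD|exact: rintZ].
  move=> x; have := dhub_gap (g x - k_ n x) (g x - k_ p x).
  rewrite -/(h_ n x) -/(h_ p x).
  rewrite (_ : (g x - k_ n x + (g x - k_ p x)) / 2 = g x - 2^-1 * (k_ n x + k_ p x)); last by field.
  lra.
have [|s [h [sn mh' cvh _]]] := @L1_cauchy_subsequence _ _ _ mu h_ mh.
  move=> e e_gt0.
  have [t t0 h1] := small_mul (divr_gt0 e_gt0 (ltr0Sn _ 1)) mass0.
  have [N _ /(_ _ (leqnn N)) hN] := e_small (e / 4 * t) (mulr_gt0 (divr_gt0 e_gt0 (ltr0Sn _ _)) t0).
  exists N => n p Nn Np.
  have bd : bmfun (fun x => h_ n x - h_ p x) by exact: bmfunB.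
  have bd2 : bmfun (fun x => (h_ n x - h_ p x) ^+ 2 / 4).
    rewrite (_ : (fun x => _) =
      fun x => 4^-1 * ((h_ n x - h_ p x) * (h_ n x - h_ p x))).
      by apply: bmfunZ; apply: bmfunM.
    by apply/funext => x; rewrite mulrC expr2.
  have ib2 := bmfun_rint mu bd2.
  rewrite rintegralE; last exact/rint_abs/bmfun_rint.
  rewrite lee_fin.
  apply: (@le_trans _ _ (\int[mu]_x (t + t^-1 * ((h_ n x - h_ p x) ^+ 2 / 4)))).
    apply: le_rint.
    - exact/rint_abs/bmfun_rint.
    - by apply: rintD; [exact: rint_cst|exact: rintZ].
    by move=> x; exact: norm_le_sqr.
  rewrite RintegralD//; [|exact: rint_cst|exact: rintZ].
  rewrite Rintegral_cst// RintegralZl// -/mass.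
  have h2 : t^-1 * (\int[mu]_x ((h_ n x - h_ p x) ^+ 2 / 4)) <= e / 2.
    rewrite mulrC ler_pdivrMr//; apply: (le_trans (gapJ n p)).
    have := e_le _ _ Nn; have := e_le _ _ Np; move: hN.
    rewrite (_ : e / 2 * t = e / 4 * t + e / 4 * t); last by field.
    set q := e / 4 * t; lra.
  by lra.
(* The limit is bounded by 1 only almost everywhere; truncation makes it a [bmfun]. *)
pose h' x := if `|h x| <= 1 then h x else 0.
have mh'' : measurable_fun setT h'.
  apply: measurable_fun_ifT => //.
  by apply: measurable_fun_ler => //; exact: measurableT_comp.
have bh' : bmfun h'.
  by split => //; exists 1 => x; rewrite /h'; case: ifPn => //; rewrite normr0.
have cvh' : {ae mu, forall x, h_ (s n) x @[n --> \oo] --> h' x}.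
  apply: filterS cvh => x cx; rewrite /h' ifT//.
  have : `|h_ (s n) x| @[n --> \oo] --> `|h x| by exact: cvg_norm.
  move=> /cvg_lim <-//; apply: limr_le; first by apply: is_cvg_norm; apply/cvg_ex; exists (h x).
  by apply: nearW => n; exact: dhub_le1.
have cvI u : bmfun u -> \int[mu]_x (h_ (s n) x * u x) @[n --> \oo] --> \int[mu]_x (h' x * u x).
  move=> [mu_ [M uM]].
  have [] // := @Rdominated_convergence _ _ _ mu (fun n x => h_ (s n) x * u x)
    (fun x => h' x * u x) (fun=> M).
  - by move=> n; exact: measurable_funM.
  - exact: measurable_funM.
  - exact: rint_cst.
  - move=> n x; rewrite normrM -[leRHS]mul1r ler_pM// dhub_le1//.
  - by apply: filterS cvh' => x cx; apply: cvgMl.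
have n_small (e : R) : 0 < e -> \forall n \near \oo, e_ (s n) < e.
  move=> e0; near=> n; apply: (@le_lt_trans _ _ (e_ n)); first exact: e_le.
  by near: n; exact: e_small.
(* Adding [t * k] to [k_ (s n)] stays in the cone and cannot bring [J] below [m]; by [hub_upper] the
   integral of [h_ (s n) * k] is then at most [t * (1 + C)] once [e_ (s n) < t ^+ 2]. *)
have h'K k : K k -> \int[mu]_x (h' x * k x) <= 0.
  move=> Kk; have bk := Kb _ Kk.
  pose C := \int[mu]_x (2^-1 * (k x * k x)).
  apply: (@le0_of_small _ _ (1 + C)) => t t0 _.
  apply: (cvgr_to_le (cvI _ bk)).
  near=> n.
  have Kn := (k_P (s n)).1.
  have Kkt : K (fun x => k_ (s n) x + t * k x) by apply: KD => //; apply: KZ => //; exact: ltW.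
  have bhk := bmfunM (bh (s n)) bk.
  have : m <= J (k_ (s n)) - t * \int[mu]_x (h_ (s n) x * k x) + t ^+ 2 * C.
    apply: (le_trans (mJ _ Kkt)).
    have i1 := iJ _ Kn; have i2 : rint mu (fun x => t * (h_ (s n) x * k x)) by apply: rintZ; exact: bmfun_rint.
    have i3 : rint mu (fun x => 2^-1 * (k x * k x)) by apply/rintZ/bmfun_rint/bmfunM.
    rewrite /J /C -RintegralZl//; last exact: bmfun_rint.
    rewrite -RintegralZl// -RintegralB// -RintegralD//; [|exact: rintB|exact: rintZ].
    apply: le_rint; [exact: iJ|by apply: rintD; [exact: rintB|exact: rintZ]|].
    move=> x.
    have := hub_upper (g x - k_ (s n) x) (- (t * k x)).
    rewrite -/(h_ (s n) x).
    rewrite (_ : g x - (k_ (s n) x + t * k x) = g x - k_ (s n) x + - (t * k x)); last by ring.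
    set A := hub _; set B := hub (g x - k_ _ x).
    have B1 : 1 <= B by exact: hub_ge1.
    have : (- (t * k x)) ^+ 2 / (2 * B) <= t ^+ 2 * (2^-1 * (k x * k x)).
      rewrite sqrrN exprMn ler_pdivrMr; last by rewrite mulr_gt0//; lra.
      have : 0 <= t ^+ 2 * (k x ^+ 2) by rewrite mulr_ge0 ?sqr_ge0.
      nra.
    lra.
  have J2 := (k_P (s n)).2 => H.
  have nt : e_ (s n) < t ^+ 2 by near: n; apply: n_small; rewrite exprn_gt0.
  rewrite -(ler_pM2l t0); nra.
(* Shrinking [k_ (s n)] by [1 - t] stays in the cone, so the integral of [h_ (s n) * k_ (s n)] is
   almost nonnegative; by convexity [J (k_ (s n))] is at most the integral of
   [h_ (s n) * (g - k_ (s n))]. *)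
have h'g : m <= \int[mu]_x (h' x * g x).
  rewrite -subr_le0; pose C := m + 1 + mass.
  apply: (@le0_of_small _ _ (1 + C)) => t t0 t1.
  rewrite lerBlDr -lerBlDl.
  apply: (cvgr_to_ge (cvI _ bg)).
  near=> n.
  have Kn := (k_P (s n)).1; have bkn := Kb _ Kn.
  have Kkt : K (fun x => (1 - t) * k_ (s n) x) by apply: KZ => //; rewrite subr_ge0.
  have J2 := (k_P (s n)).2.
  have bhk := bmfunM (bh (s n)) bkn; have bhg := bmfunM (bh (s n)) bg.
  have ihub : rint mu (fun x => hub (g x - k_ (s n) x)).
    by apply: bmfun_rint; apply: bmfun_hub; exact: bmfunB.
  have Hhub : \int[mu]_x hub (g x - k_ (s n) x) = J (k_ (s n)) + mass.
    rewrite /J RintegralB//; last exact: rint_cst.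
    by rewrite Rintegral_cst// mul1r -/mass subrK.
  have H1 : m <= J (k_ (s n)) + t * \int[mu]_x (h_ (s n) x * k_ (s n) x) + t ^+ 2 * (J (k_ (s n)) + mass).
    apply: (le_trans (mJ _ Kkt)); rewrite -Hhub.
    have i1 := iJ _ Kn; have i2 := bmfun_rint mu bhk.
    rewrite /J -RintegralZl// -RintegralZl// -RintegralD//; last exact: rintZ.
    rewrite -RintegralD//; [|by apply: rintD => //; exact: rintZ|exact: rintZ].
    apply: le_rint; [exact: iJ|by apply: rintD; [apply: rintD => //; exact: rintZ|exact: rintZ]|].
    move=> x; set y := g x - k_ (s n) x.
    have := hub_upper y (t * k_ (s n) x).
    rewrite -/(h_ (s n) x) (_ : y + t * k_ (s n) x = g x - (1 - t) * k_ (s n) x); last by rewrite /y; ring.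
    set A := hub (g x - (1 - t) * _); set B := hub y.
    have B1 : 1 <= B by exact: hub_ge1.
    (* Here [|g| <= 1] enters: [k = g - y] gives [k^2 <= 2 (1 + y^2) = 2 (hub y)^2]. *)
    have : (t * k_ (s n) x) ^+ 2 / (2 * B) <= t ^+ 2 * B.
      rewrite ler_pdivrMr; last by rewrite mulr_gt0//; lra.
      rewrite (_ : t ^+ 2 * B * (2 * B) = t ^+ 2 * (2 * B ^+ 2)); last by ring.
      rewrite exprMn ler_wpM2l ?sqr_ge0// sqr_hub.
      have g2 : g x ^+ 2 <= 1.
        by rewrite -(ger0_norm (sqr_ge0 (g x))) normrX expr_le1.
      have := sqr_ge0 (g x + y); rewrite sqrrD /y; nra.
    rewrite -/y /h_ -/y; lra.
  have H2 : J (k_ (s n)) <= \int[mu]_x (h_ (s n) x * g x) - \int[mu]_x (h_ (s n) x * k_ (s n) x).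
    rewrite -RintegralB//; [|exact: bmfun_rint|exact: bmfun_rint].
    apply: le_rint; [exact: iJ|by apply: rintB; exact: bmfun_rint|].
    by move=> x; rewrite -mulrBr; exact: hub_sub1_le.
  have nt : e_ (s n) < t ^+ 2 by near: n; apply: n_small; rewrite exprn_gt0.
  have t2 : t ^+ 2 <= 1 by rewrite expr_le1// ltW.
  have mJn := mJ _ Kn.
  rewrite -(ler_pM2l t0) /C.
  by have := mass0; have := sqr_ge0 t; nra.
(* [- h'] is nonnegative on the cone, so by hypothesis the integral of [h' * g] is at most 0,
   whereas it is at least [m]. *)
have m_eq0 : m = 0.
  apply/eqP; rewrite eq_le m0 andbT; apply: (le_trans h'g).
  have := hyp (fun x => - h' x) (bmfunN bh').
  have e k : bmfun k -> \int[mu]_x (- h' x * k x) = - \int[mu]_x (h' x * k x).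
    move=> bk; rewrite -mulN1r -RintegralZl//; last exact/bmfun_rint/bmfunM.
    by apply: eq_Rintegral => x _; rewrite mulN1r mulNr.
  rewrite e// oppr_ge0; apply => k Kk.
  by rewrite e ?oppr_ge0 ?h'K//; exact: Kb.
move=> e e_gt0.
have [t t0 h1] := small_mul (divr_gt0 e_gt0 (ltr0Sn _ 1)) mass0.
pose D := t / 2 + t^-1 / 2.
have D0 : 0 < D by rewrite addr_gt0// divr_gt0// invr_gt0.
have [k Kk Jk] := Jm (e / 2 / D) (divr_gt0 (divr_gt0 e_gt0 (ltr0Sn _ _)) D0).
exists k => //; have bk := Kb _ Kk.
apply: (@le_trans _ _ (\int[mu]_x ((hub (g x - k x) - 1) * D + t))).
  apply: le_rint.
  - by apply/rint_abs/bmfun_rint/bmfunB.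
  - apply: rintD; last exact: rint_cst.
    by under eq_fun do rewrite mulrC; apply/rintZ/iJ.
  by move=> x; exact: ge0_norm_le_hub.
have iD : rint mu (fun x => (hub (g x - k x) - 1) * D).
  by under eq_fun do rewrite mulrC; apply/rintZ/iJ.
rewrite RintegralD//; last exact: rint_cst.
rewrite Rintegral_cst// RintegralZr//; last exact: iJ.
rewrite -/mass -/(J k).
move: Jk; rewrite m_eq0 add0r ltr_pdivlMr// => Jk; lra.
Unshelve. all: by end_near. Qed.

End separation.

(** * Entropy along segments and exponential moments *)

Section entropy_directional_derivative.
Context d (X : measurableType d) (R : realType).
Variables (nu : probability X R) (f w : X -> R).
Hypotheses (mf : measurable_fun setT f) (mw : measurable_fun setT w)
  (f0 : forall x, 0 <= f x) (w0 : forall x, 0 <= w x)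
  (entf : rint nu (fun x => ent (f x))) (entw : rint nu (fun x => ent (w x))).

Lemma rint_ent_mix (t : R) : 0 <= t <= 1 ->
  rint nu (fun x => ent ((1 - t) * f x + t * w x)).
Proof.
move=> t01; have /andP[t0 t1] := t01.
apply: (rint_le _ _ (rintD (rintZ (1 - t) entf) (rintZ t entw))).
  apply: measurableT_comp; first exact: measurable_ent.
  by apply: measurable_funD; exact: measurable_funM.
move=> x; rewrite ger0_norm; first exact: ent_convex.
by apply: ent_ge0; rewrite addr_ge0// mulr_ge0// subr_ge0.
Qed.

(** Step lengths with an explicit logarithm, so that the divergence on [{f = 0}] is visibly linear
    in [n]. *)
Let dn (d0 : R) (n : nat) := d0 * expR (- n.+1%:R).

Let dn_gt0 d0 n : 0 < d0 -> 0 < dn d0 n.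
Proof. by move=> d0_gt0; rewrite mulr_gt0// expR_gt0. Qed.

Let dn_lt d0 n : 0 < d0 -> dn d0 n < d0.
Proof. by move=> d0_gt0; rewrite gtr_pMr// expR_lt1 oppr_lt0. Qed.

Let ln_dn d0 n : 0 < d0 -> ln (dn d0 n) = ln d0 - n.+1%:R.
Proof. by move=> d0_gt0; rewrite lnM ?posrE ?expR_gt0// expRK. Qed.

Let dn_cvg d0 : dn d0 n @[n --> \oo] --> (0 : R).
Proof.
rewrite -[X in _ --> X](mulr0 d0); apply: cvgMl_tmp.
apply: (@squeeze_cvgr _ _ _ _ (fun=> 0) (fun n => n.+1%:R^-1)).
- apply: nearW => n; rewrite expR_ge0/= expRN lef_pV2 ?posrE ?expR_gt0//.
  by apply: le_trans (expR_ge1Dx _); rewrite lerDr.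
- exact: cvg_cst.
- apply/cvgrPdist_lt => e e0; near=> n; rewrite sub0r normrN ger0_norm//.
  by near: n; exact: (near_infty_natSinv_lt (PosNum e0)).
Unshelve. all: by end_near. Qed.

Let quot t x := (ent ((1 - t) * f x + t * w x) - ent (f x)) / t.

(** By the tangent inequality at both ends, the quotient lies between [(w - f) ln f] and the same
    product with [ln] taken at the mixture. *)
Let quot_cvg d0 x : 0 < d0 -> d0 <= 1 -> 0 < f x ->
  quot (dn d0 n) x @[n --> \oo] --> (w x - f x) * ln (f x).
Proof.
move=> d0_gt0 d01 fx.
have mixE t : (1 - t) * f x + t * w x = f x + t * (w x - f x) by ring.
apply: (@squeeze_cvgr _ _ _ _ (fun=> (w x - f x) * ln (f x))
   (fun n => (w x - f x) * ln ((1 - dn d0 n) * f x + dn d0 n * w x))).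
- apply: nearW => n; have t0 := dn_gt0 n d0_gt0.
  have t1 : dn d0 n < 1 by apply: lt_le_trans d01; exact: dn_lt.
  rewrite /quot; set t := dn d0 n in t0 t1 *.
  have m0 : 0 < (1 - t) * f x + t * w x.
    by rewrite ltr_pwDl ?mulr_gt0 ?subr_gt0// mulr_ge0// ltW.
  have mB : (1 - t) * f x + t * w x - f x = t * (w x - f x) by rewrite mixE; ring.
  set m := (1 - t) * _ + _ in m0 mB *.
  rewrite ler_pdivlMr// ler_pdivrMr//; apply/andP; split.
    by have := ent_tangent (ltW m0) fx; rewrite mB; lra.
  have := ent_tangent (f0 x) m0.
  rewrite -[f x - m]opprB mB; lra.
- exact: cvg_cst.
- have h : (1 - dn d0 n) * f x + dn d0 n * w x @[n --> \oo] --> f x + 0 * (w x - f x).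
    under eq_cvg do rewrite mixE.
    by apply: cvgD; [exact: cvg_cst|apply: cvgMr_tmp; exact: dn_cvg].
  rewrite mul0r addr0 in h.
  by apply: cvgMl_tmp; apply: continuous_cvg; [exact: continuous_ln|exact: h].
Qed.

(** [G n], the full increment minus the difference quotient, is nonnegative by convexity, and a
    lower bound on the quotients bounds its integral from above. Fatou then yields all three
    conclusions, with no prior integrability of [w ln f]. *)
Lemma entropy_derivative (d0 c : R) : 0 < d0 ->
  (forall t, 0 < t -> t < d0 -> t <= 1 ->
    c <= (\int[nu]_x ent ((1 - t) * f x + t * w x) - \int[nu]_x ent (f x)) / t) ->
  [/\ {ae nu, forall x, f x = 0 -> w x = 0},
      rint nu (fun x => (w x - f x) * ln (f x)) &
      c <= \int[nu]_x ((w x - f x) * ln (f x))].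
Proof.
move=> d0_gt0 hc.
wlog d01 : d0 d0_gt0 hc / d0 <= 1.
  move=> /(_ (Num.min d0 1)); apply.
  - by rewrite lt_min d0_gt0 ltr01.
  - by move=> t t0; rewrite lt_min => /andP[td _]; exact: hc.
  - by rewrite ge_min lexx orbT.
pose Hf := \int[nu]_x ent (f x); pose Hw := \int[nu]_x ent (w x).
pose G n x := (ent (w x) - ent (f x)) - quot (dn d0 n) x.
have t01 n : 0 <= dn d0 n <= 1.
  by rewrite ltW ?dn_gt0//= ltW// (lt_le_trans _ d01)// dn_lt.
have ient n := rint_ent_mix (t01 n).
have iquot n : rint nu (quot (dn d0 n)).
  rewrite /quot; under eq_fun do rewrite mulrC.
  by apply: rintZ; exact: rintB.
have iwf := rintB entw entf.
have iG n : rint nu (G n) by exact: rintB.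
have G0 n x : 0 <= G n x.
  rewrite subr_ge0 /quot ler_pdivrMr ?dn_gt0//.
  by have := ent_convex (t01 n) (f0 x) (w0 x); lra.
have intG n : \int[nu]_x G n x <= Hw - Hf - c.
  have iq := iquot n; rewrite /G RintegralB// RintegralB// lerB// /quot.
  under eq_Rintegral do rewrite mulrC.
  rewrite RintegralZl//; last exact: rintB.
  rewrite RintegralB//; last exact: ient.
  rewrite mulrC; apply: hc.
  - exact: dn_gt0.
  - exact: dn_lt.
  - by have /andP[] := t01 n.
pose r x := (ent (w x) - ent (f x)) - (w x - f x) * ln (f x).
have mr : measurable_fun setT r.
  apply: measurable_funB; first exact: rint_measurable iwf.
  apply: measurable_funM; first exact: measurable_funB.
  by apply: measurableT_comp => //; exact: measurable_ln.
(* Where [f = 0 < w] the slope of the entropy is [-oo] and [G n] tends to [+oo]; finiteness of the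
   integral of [U] makes this set null. *)
pose U x : \bar R := if f x == 0 then (if w x == 0 then 0%E else +oo%E) else (r x)%:E.
have mU : measurable_fun setT U.
  apply: measurable_fun_ifT.
  - exact: measurable_fun_eqr.
  - by apply: measurable_fun_ifT => //; exact: measurable_fun_eqr.
  - exact/measurable_EFinP.
have cU x : (G n x)%:E @[n --> \oo] --> U x.
  have [fx|fx] := eqVneq (f x) 0; last first.
    have fp : 0 < f x by rewrite lt_neqAle eq_sym fx f0.
    rewrite (_ : U x = (r x)%:E); last by rewrite /U (negbTE fx).
    apply: cvg_EFin; first exact: nearW.
    by apply: cvgB; [exact: cvg_cst|exact: quot_cvg].
  have GE n : G n x = w x * (n.+1%:R - ln d0).
    rewrite /G /quot fx mulr0 add0r.
    have [->|wx] := eqVneq (w x) 0; first by rewrite mulr0 !subrr !mul0r subrr.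
    have wp : 0 < w x by rewrite lt_neqAle eq_sym wx w0.
    have tp := dn_gt0 n d0_gt0.
    rewrite /ent lnM ?posrE// ln_dn//; field.
    by rewrite gt_eqF.
  have [wx|wx] := eqVneq (w x) 0.
    rewrite (_ : U x = 0%:E); last by rewrite /U fx wx !eqxx.
    rewrite (_ : (fun n => _) = cst 0%:E); first exact: cvg_cst.
    by apply/funext => n; rewrite GE wx mul0r.
  have wp : 0 < w x by rewrite lt_neqAle eq_sym wx w0.
  rewrite (_ : U x = +oo%E); last by rewrite /U fx eqxx (negbTE wx).
  apply/cvgeryP/cvgryPge => A; near=> n.
  rewrite GE -ler_pdivrMl// lerBrDr.
  near: n; have [N _ hN] := nbhs_infty_gtr ((w x)^-1 * A + ln d0).
  exists N => // n /= Nn; apply: ltW; apply: lt_trans (hN _ Nn) _.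
  by rewrite ltr_nat.
have UB : (\int[nu]_x U x <= (Hw - Hf - c)%:E)%E.
  apply: (@fatou_le _ _ _ _ G) => //.
  - by move=> n; exact: rint_measurable (iG n).
  - exact: aeW.
  - by apply: nearW => n; rewrite rintegralE// lee_fin.
have r_ge0 x : 0 < f x -> 0 <= r x.
  move=> fx; have := cU x; rewrite /U gt_eqF// => /fine_cvg /= cx.
  by apply: (cvgr_to_ge cx); apply: nearW => n; exact: G0.
have U0 x : (0 <= U x)%E.
  rewrite /U; case: eqP => [fx|/eqP fx]; first by case: ifPn.
  by rewrite lee_fin r_ge0// lt_neqAle eq_sym fx f0.
have iU : nu.-integrable setT U.
  apply/integrableP; split => //.
  under eq_integral do rewrite gee0_abs//.
  exact: le_lt_trans UB (ltry _).
have ae0 : {ae nu, forall x, f x = 0 -> w x = 0}.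
  have := integrable_ae measurableT iU; apply: filterS => x /(_ I).
  by rewrite /U => + fx; rewrite fx eqxx; case: eqP.
have aeU : ae_eq nu setT U (EFin \o r).
  apply: filterS ae0 => x h _; rewrite /U; case: eqP => // fx.
  by rewrite h// eqxx /= /r fx h// !subrr mul0r subr0.
have ir : rint nu r.
  by apply: (ae_eq_integrable _ aeU iU); exact/measurable_EFinP.
have intr : \int[nu]_x r x <= Hw - Hf - c.
  rewrite -lee_fin -rintegralE//; apply: le_trans UB.
  by rewrite (ae_eq_integral _ _ _ _ _ aeU)//; exact/measurable_EFinP.
have e x : (w x - f x) * ln (f x) = (ent (w x) - ent (f x)) - r x by rewrite /r; ring.
have i2 : rint nu (fun x => (w x - f x) * ln (f x)).
  by under eq_fun do rewrite e; exact: rintB.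
split => //; under eq_Rintegral do rewrite e.
rewrite RintegralB// RintegralB// -/Hw -/Hf; lra.
Unshelve. all: by end_near. Qed.

End entropy_directional_derivative.

Section exponential_moments.
Context d (X : measurableType d) (R : realType).
Variables (nu : probability X R) (phi : X -> R).
Hypotheses (mphi : measurable_fun setT phi) (phi0 : forall x, 0 <= phi x)
  (hnu : forall alpha : R, 0 < alpha ->
    (\int[nu]_x (expR (alpha * phi x))%:E < +oo)%E).

Lemma rint_exp_moment (a : R) : 0 < a -> rint nu (fun x => expR (a * phi x)).
Proof.
move=> a0; apply: rint_ge0 => [|x|]; [|exact: expR_ge0|exact: hnu].
by apply: measurableT_comp => //; exact: measurable_funM.
Qed.

Lemma rint_moment_ent (f : X -> R) : measurable_fun setT f -> (forall x, 0 <= f x) ->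
  rint nu (fun x => ent (f x)) -> rint nu (fun x => phi x * f x).
Proof.
move=> mf f0 ef.
apply: (rint_le _ _ (rintD ef (rint_exp_moment ltr01))).
  exact: measurable_funM.
move=> x; rewrite ger0_norm ?mulr_ge0// mul1r.
by have := ent_young (phi x) (f0 x); lra.
Qed.

Lemma rint_ent_density_fun (f : X -> R) : measurable_fun setT f -> (forall x, 0 <= f x) ->
  rint nu (fun x => ent (f x)) -> rint nu f.
Proof.
move=> mf f0 ef; apply: (rint_le _ _ (rintD ef (rint_cst nu (expR 1)))) => // x.
by rewrite ger0_norm//; have := ent_young 1 (f0 x); lra.
Qed.

(** Uniform integrability of [phi] over entropy balls: Young's inequality at [a * phi] bounds [a]
    times the tail by the entropy plus the tail of [expR (a * phi)], and this last tail does not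
    involve [f]. *)
Lemma moment_tail (C e : R) : 0 < e -> exists2 N : R, 0 <= N &
  forall f : X -> R, measurable_fun setT f -> (forall x, 0 <= f x) ->
    rint nu (fun x => ent (f x)) -> \int[nu]_x ent (f x) <= C ->
    \int[nu]_x (\1_[set x | N < phi x] x * (phi x * f x)) <= e.
Proof.
(* [C1] bounds the entropy plus 1 for the exponential tail; [a = C1 / e] turns this total into
   [e]. *)
move=> e0; pose C1 := Num.max C 0 + 1.
have C1_gt0 : 0 < C1 by rewrite ltr_wpDl// le_max lexx orbT.
pose a := C1 / e; have a0 : 0 < a by rewrite divr_gt0.
have iexp := rint_exp_moment a0.
have mS (N : R) : measurable [set x | N < phi x].
  have := mphi measurableT (measurable_itv `]N, +oo[); rewrite setTI.
  by congr measurable; apply/seteqP; split => x /=; rewrite in_itv/= andbT.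
have mI (N : R) : measurable_fun setT (\1_[set x | N < phi x] : X -> R).
  exact/measurable_indicP.
have I01 (N : R) x : 0 <= (\1_[set x | N < phi x] x : R) <= 1.
  by rewrite indicE; case: (_ \in _); rewrite ?lexx ?ler01.
have [_ _ cexp] : [/\ rint nu (fun=> 0), 
    \int[nu]_x `|\1_[set x | n%:R < phi x] x * expR (a * phi x) - 0| @[n --> \oo] --> (0 : R) &
    \int[nu]_x (\1_[set x | n%:R < phi x] x * expR (a * phi x)) @[n --> \oo] --> \int[nu]_x (0 : R)].
  apply: (Rdominated_convergence _ _ iexp) => //.
  - by move=> n; apply: measurable_funM => //; exact: rint_measurable iexp.
  - move=> n x; have /andP[h0 h1] := I01 n%:R x.
    by rewrite normrM !ger0_norm ?expR_ge0// ler_piMl// expR_ge0.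
  - apply: aeW => x; apply: cvg_near_cst; near=> n.
    rewrite indicE memNset ?mul0r//=; apply/negP; rewrite -leNgt; apply: ltW.
    by near: n; exact: nbhs_infty_gtr.
rewrite Rintegral_cst// mul0r in cexp.
have /cvgrPdist_le/(_ _ ltr01)[N _ /(_ N (leqnn N))] := cexp.
rewrite sub0r normrN => hN; exists N%:R => // f mf f0 ef efC.
have iphif := rint_moment_ent mf f0 ef.
have i1 : rint nu (fun x => \1_[set x | N%:R < phi x] x * expR (a * phi x)).
  apply: (rint_le _ _ iexp).
    by apply: measurable_funM => //; exact: rint_measurable iexp.
  move=> x; have /andP[h0 h1] := I01 N%:R x.
  by rewrite normrM !ger0_norm ?expR_ge0// ler_piMl// expR_ge0.
apply: (@le_trans _ _ (\int[nu]_x (a^-1 * (ent (f x) + \1_[set x | N%:R < phi x] x * expR (a * phi x))))).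
  apply: le_rint.
  - apply: (rint_le _ _ iphif).
      by apply: measurable_funM => //; exact: rint_measurable iphif.
    move=> x; have /andP[h0 h1] := I01 N%:R x.
    by rewrite normrM !ger0_norm ?mulr_ge0// ler_piMl// mulr_ge0.
  - by apply: rintZ; exact: rintD.
  move=> x; rewrite indicE; case: (_ \in _).
    rewrite !mul1r ler_pdivlMl// mulrA.
    by have := ent_young (a * phi x) (f0 x); lra.
  by rewrite !mul0r addr0 mulr_ge0 ?invr_ge0 ?ent_ge0// ltW.
rewrite RintegralZl//; last exact: rintD.
rewrite RintegralD// ler_pdivrMl// /a divfK ?gt_eqF//.
rewrite /C1; apply: lerD; first by rewrite (le_trans efC)// le_max lexx.
exact: le_trans (ler_norm _) hN.
Unshelve. all: by end_near. Qed.

(** Where [phi <= N] the weight is at most [1 + N]; elsewhere [phi |f_n - f| <= phi f_n + phi f],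
    which [moment_tail] controls uniformly. Each of the three contributions is at most [e / 3]. *)
Lemma moment_L1_cvg (C : R) (f_ : nat -> X -> R) (f : X -> R) :
  (forall n, [/\ measurable_fun setT (f_ n), forall x, 0 <= f_ n x,
     rint nu (fun x => ent (f_ n x)) & \int[nu]_x ent (f_ n x) <= C]) ->
  [/\ measurable_fun setT f, forall x, 0 <= f x,
     rint nu (fun x => ent (f x)) & \int[nu]_x ent (f x) <= C] ->
  (forall e : R, 0 < e -> \forall n \near \oo, \int[nu]_x `|f_ n x - f x| <= e) ->
  forall e : R, 0 < e ->
    \forall n \near \oo, \int[nu]_x ((1 + phi x) * `|f_ n x - f x|) <= e.
Proof.
move=> hf_ [mf f0 ef efC] cf e e0.
have [N N0 hN] := moment_tail C (divr_gt0 e0 (ltr0Sn _ 2)).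
have [e1 e1_gt0 he1] := small_mul (divr_gt0 e0 (ltr0Sn _ 2)) (addr_ge0 ler01 N0).
have i_f := rint_ent_density_fun mf f0 ef.
have iphif := rint_moment_ent mf f0 ef.
have mS : measurable [set x | N < phi x].
  have := mphi measurableT (measurable_itv `]N, +oo[); rewrite setTI.
  by congr measurable; apply/seteqP; split => x /=; rewrite in_itv/= andbT.
have mI : measurable_fun setT (\1_[set x | N < phi x] : X -> R).
  exact/measurable_indicP.
have iI u : (forall x, 0 <= u x) -> rint nu (fun x => phi x * u x) ->
    rint nu (fun x => \1_[set x | N < phi x] x * (phi x * u x)).
  move=> u0 iu; apply: (rint_le _ _ iu).
    by apply: measurable_funM => //; exact: rint_measurable iu.
  move=> x; rewrite indicE; case: (_ \in _); rewrite ?mul1r ?mul0r ?normr0 ?mulr_ge0//.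
  by rewrite ger0_norm ?mulr_ge0.
near=> n.
have [mfn fn0 efn efnC] := hf_ n.
have i_fn := rint_ent_density_fun mfn fn0 efn.
have iphifn := rint_moment_ent mfn fn0 efn.
have iabs := rint_abs (rintB i_fn i_f).
have i2 := rintD (iI _ fn0 iphifn) (iI _ f0 iphif).
apply: (@le_trans _ _ (\int[nu]_x ((1 + N) * `|f_ n x - f x| +
   (\1_[set x | N < phi x] x * (phi x * f_ n x) + \1_[set x | N < phi x] x * (phi x * f x))))).
  apply: le_rint.
  - apply: (rint_le _ _ (rintD (rintD i_fn i_f) (rintD iphifn iphif))).
      apply: measurable_funM; first exact: measurable_funD.
      exact: rint_measurable iabs.
    move=> x; rewrite ger0_norm; last by rewrite mulr_ge0// addr_ge0.
    have := ler_normB (f_ n x) (f x); rewrite (ger0_norm (fn0 x)) (ger0_norm (f0 x)).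
    have := phi0 x; set p := phi x; set b := `|_|; have := fn0 x; have := f0 x; nra.
  - by apply: rintD => //; exact: rintZ.
  move=> x; rewrite indicE /=; have p0 := phi0 x.
  have b0 := normr_ge0 (f_ n x - f x).
  have hb := ler_normB (f_ n x) (f x); rewrite (ger0_norm (fn0 x)) (ger0_norm (f0 x)) in hb.
  set b := `|f_ n x - f x| in b0 hb *.
  case: (boolP (x \in _)) => xN; rewrite ?mul1r ?mul0r ?addr0.
    by have := fn0 x; have := f0 x; nra.
  rewrite ler_wpM2r// lerD2l leNgt; apply/negP => h.
  by move/negP : xN; apply; rewrite inE.
rewrite RintegralD//; [|exact: rintZ]; rewrite RintegralZl// RintegralD//; [|exact: iI|exact: iI].
have h1 := hN _ mfn fn0 efn efnC; have h2 := hN _ mf f0 ef efC.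
have h3 : (1 + N) * \int[nu]_x `|f_ n x - f x| <= e / 3.
  apply: le_trans he1; rewrite mulrC ler_wpM2r ?addr_ge0//.
  by near: n; exact: cf.
move: h1 h2 h3; set p := Rintegral _ _ _; set q := Rintegral _ _ _; lra.
Unshelve. all: by end_near. Qed.

End exponential_moments.

(** * Weak limits of discrete measures on a compact metric space *)

Lemma filter_forall_lt (T : Type) (F : set_system T) (P : nat -> T -> Prop) :
  Filter F -> (forall i, F (P i)) ->
  forall N, F [set y | forall j, (j < N)%N -> P j y].
Proof.
move=> FF h; elim=> [|N ih]; first by apply: filterE => y j; rewrite ltn0.
apply: filterS2 (h N) ih => y PN Pj j.
by rewrite ltnS leq_eqVlt => /orP[/eqP->//|]; exact: Pj.
Qed.

Section product_sequences.
Context {R : realType}.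

(** A cluster point in the compact product replaces diagonal extraction; [s n] is picked so that the
    first [n] coordinates are within [1 / (n + 1)] of it. *)
Lemma bounded_array_subsequence (x : nat -> nat -> R) (M : R) :
  (forall n j, 0 <= x n j <= M) ->
  exists (s : nat -> nat) (m : nat -> R), (forall n, (n <= s n)%N) /\
    forall j, x (s n) j @[n --> \oo] --> m j.
Proof.
move=> xM.
pose F := x @ \oo : set_system (forall j : nat, (fun=> R : topologicalType) j).
have PF : ProperFilter F by exact: fmap_proper_filter.
have := @tychonoff nat (fun=> R) (fun=> `[0, M]%classic).
move=> /(_ (fun=> @segment_compact R 0 M) F PF)[].
  by exists 0%N => // n _ j; rewrite /= in_itv/=; exact: xM.
move=> m [_ clm].
have hs n : exists k, (n <= k)%N /\ forall j, (j < n)%N -> `|m j - x k j| < n.+1%:R^-1.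
  pose V := [set y : forall j : nat, (fun=> R : topologicalType) j |
     forall j, (j < n)%N -> `|m j - y j| < n.+1%:R^-1].
  have nV : nbhs m V.
    have h (i : nat) : \forall y \near m, `|m i - y i| < n.+1%:R^-1.
      have nb : nbhs (m i : R) [set r : R | `|m i - r| < n.+1%:R^-1].
        have /cvgrPdist_lt : id r @[r --> (m i : R)] --> (m i : R) by exact: cvg_id.
        by apply; rewrite invr_gt0.
      exact: (@proj_continuous _ (fun=> R : topologicalType) i m _ nb).
    exact: (@filter_forall_lt _ _ _ (nbhs_filter m) h n).
  have FB : F [set x k | k in [set k | (n <= k)%N]].
    by exists n => // k /= nk; exists k.
  by have [_ [[k /= nk <-] Vx]] := clm _ _ FB nV; exists k.
have [s sP] := choice hs.
exists s, m; split=> [n|j]; first exact: (sP n).1.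
apply/cvgrPdist_lt => e e0; near=> n.
apply: (lt_trans ((sP n).2 j _)); first by near: n; exact: nbhs_infty_gt.
by near: n; exact: (near_infty_natSinv_lt (PosNum e0)).
Unshelve. all: by end_near. Qed.

End product_sequences.

Section cantor_cylinders.
Implicit Types b : cantor_space.

Definition prefix_of k b : seq bool := mkseq b k.

Lemma size_prefix_of k b : size (prefix_of k b) = k.
Proof. exact: size_mkseq. Qed.

Lemma prefix_of_eq k b b' :
  prefix_of k b = prefix_of k b' <-> forall i, (i < k)%N -> b i = b' i.
Proof.
split=> [e i ik|e]; last first.
  apply/eq_in_map => i; rewrite mem_iota => /andP[_]; exact: e.
by rewrite -(nth_mkseq false b ik) -(nth_mkseq false b' ik) -/(prefix_of k b) e.
Qed.

Lemma cantor_nbhs_prefix b (A : set cantor_space) : nbhs b A ->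
  exists k, forall b', prefix_of k b' = prefix_of k b -> A b'.
Proof.
pose B k := [set b' | prefix_of k b' = prefix_of k b].
pose G := filter_from [set: nat] B.
have FG : Filter G.
  apply: filter_from_filter; first by exists 0%N.
  move=> i j _ _; exists (maxn i j) => // b' /prefix_of_eq h.
  split; apply/prefix_of_eq => l li; apply: h; rewrite leq_max li ?orbT//.
suff : G --> b by move=> Gb /Gb[k _ kA]; exists k.
apply/cvg_sup => i.
apply: (@cvg_initial cantor_space bool (fun b' => b' i) G b FG).
move=> C nC; exists i.+1 => // b' /prefix_of_eq/(_ i (ltnSn i)) e.
by rewrite /= e; exact: nbhs_singleton nC.
Qed.

Lemma nbhs_prefix k b : nbhs b [set b' | prefix_of k b' = prefix_of k b].
Proof.
suff : \forall b' \near b, forall i, (i < k)%N -> b' i = b i.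
  by apply: filterS => b' h; apply/prefix_of_eq.
have h (i : nat) : \forall b' \near b, (b' : cantor_space) i = b i.
  have nb : nbhs (proj i b) [set b i] by exact: discrete_set1.
  exact: (@proj_continuous _ (fun=> bool : topologicalType) i b _ nb).
exact: (@filter_forall_lt _ _ _ (nbhs_filter b) h k).
Qed.

Definition extend0 (s : seq bool) : cantor_space := nth false s.

Lemma prefix_of_extend0 j k b : (j <= k)%N ->
  prefix_of j (extend0 (prefix_of k b)) = prefix_of j b.
Proof.
move=> jk; apply/prefix_of_eq => i ij.
by rewrite /extend0 nth_mkseq// (leq_trans ij).
Qed.

(** Uniform continuity: by compactness [F] is within [e] of a function of finitely many digits, so
    an integral of [F] depends on finitely many cylinder masses up to a small error. *)
Lemma cantor_uniform_prefix (R : realType) (F : cantor_space -> R) (e : R) :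
  continuous F -> 0 < e ->
  exists k, forall b, `|F b - F (extend0 (prefix_of k b))| <= e.
Proof.
move=> cF e0.
have /compact_near_coveringP := cantor_space_compact.
move=> /(_ nat \oo (fun k b => `|F b - F (extend0 (prefix_of k b))| <= e) _)[].
  move=> b _.
  have /cvgrPdist_lt/(_ (e / 2)) := cF b; rewrite divr_gt0// => /(_ isT) nF.
  have [k kP] := cantor_nbhs_prefix nF.
  near=> b' n.
  have kn : (k <= n)%N by near: n; exact: nbhs_infty_ge.
  have b'b : prefix_of k b' = prefix_of k b.
    near: b'; exact: nbhs_prefix.
  rewrite (splitr e) (le_trans (ler_distD (F b) _ _))// lerD//.
    by rewrite distrC ltW//; apply: kP.
  by rewrite ltW//; apply: kP; rewrite prefix_of_extend0.
move=> k _ /(_ k (leqnn k)) h; exists k => b.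
exact: h.
Unshelve. all: by end_near. Qed.

End cantor_cylinders.

Section dyadic_measure.
Context {R : realType}.
Variable m : seq bool -> R.
Hypothesis m_ge0 : forall s, 0 <= m s.
Hypothesis m_split : forall s, m s = m (rcons s false) + m (rcons s true).

(* [[lo s, lo s + m s)] are the nested intervals of length [m s] laid out in
   lexicographic order in [[0, m [::])]. *)
Definition lo (s : seq bool) : R :=
  \sum_(i < size s | nth false s i) m (rcons (take i s) false).

Definition next_digit (u : R) s := lo s + m (rcons s false) <= u.

Fixpoint digit_word (u : R) k : seq bool :=
  if k is k'.+1 then rcons (digit_word u k') (next_digit u (digit_word u k')) else [::].

Definition digits (u : R) : cantor_space := fun k => next_digit u (digit_word u k).

Lemma lo_rcons s b : lo (rcons s b) = lo s + (if b then m (rcons s false) else 0).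
Proof.
rewrite /lo size_rcons big_mkcond big_ord_recr/= -big_mkcond/=; congr (_ + _).
  rewrite big_mkcond [RHS]big_mkcond/=; apply: eq_bigr => i _.
  rewrite nth_rcons ltn_ord (_ : take i (rcons s b) = take i s)//.
  by rewrite -cats1 takel_cat// ltnW.
rewrite nth_rcons ltnn eqxx (_ : take _ (rcons s b) = s)//.
by rewrite -cats1 take_size_cat.
Qed.

Lemma size_path u k : size (digit_word u k) = k.
Proof. by elim: k => //= k ih; rewrite size_rcons ih. Qed.

Lemma prefix_of_digits u k : prefix_of k (digits u) = digit_word u k.
Proof. by elim: k => //= k ih; rewrite /prefix_of mkseqS -/(prefix_of _ _) ih. Qed.

Lemma path_itv u k : 0 <= u < m [::] -> lo (digit_word u k) <= u < lo (digit_word u k) + m (digit_word u k).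
Proof.
move=> u0; elim: k => [|k /andP[ih1 ih2]] /=; first by rewrite /lo big_ord0 add0r.
rewrite lo_rcons; case: ifPn => h; rewrite /next_digit in h.
  by rewrite h/= -addrA -m_split ih2.
by rewrite addr0 ih1/= ltNge.
Qed.

Lemma itv_path u s : lo s <= u < lo s + m s -> digit_word u (size s) = s.
Proof.
elim/last_ind: s => // s b ih; rewrite lo_rcons size_rcons/= => /andP[h1 h2].
have e : digit_word u (size s) = s.
  apply: ih; move: h1 h2; rewrite (m_split s).
  have := m_ge0 (rcons s false); have := m_ge0 (rcons s true).
  by case: b => *; apply/andP; split; lra.
rewrite e; congr rcons; rewrite /next_digit; case: b h1 h2 => // h1 h2.
by apply/negbTE; rewrite -ltNge; move: h2; rewrite addr0.
Qed.

Lemma lo_ge0 s : 0 <= lo s.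
Proof. exact: sumr_ge0. Qed.

Lemma lo_le s : lo s + m s <= m [::].
Proof.
elim/last_ind: s => [|s b ih]; first by rewrite /lo big_ord0 add0r.
apply: le_trans ih; rewrite lo_rcons (m_split s) -!addrA lerD2l.
have := m_ge0 (rcons s false); have := m_ge0 (rcons s true); case: b => /=; lra.
Qed.

(** Greedy digits exist for every real [u], so points outside the base interval also fall into cells
    and have to be cut off. *)
Lemma cell_itv s : [set u | digit_word u (size s) = s] `&` `[0, m [::][%classic = `[lo s, lo s + m s[%classic.
Proof.
apply/seteqP; split => u /=; rewrite !in_itv/=.
  by move=> [e /(path_itv (size s))]; rewrite e.
move=> us; split; first exact: itv_path.
by have := lo_ge0 s; have := lo_le s; move: us; lra.
Qed.

Lemma measurable_cell s : measurable [set u : R | digit_word u (size s) = s].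
Proof.
elim/last_ind: s => [|s b ih].
  by rewrite (_ : mkset _ = setT)//; apply/seteqP; split.
rewrite size_rcons/= (_ : mkset _ = [set u | digit_word u (size s) = s] `&`
   (if b then `[lo s + m (rcons s false), +oo[%classic else `]-oo, lo s + m (rcons s false)[%classic)).
  by apply: measurableI => //; case: b.
apply/seteqP; split => u /=.
  move=> /rcons_inj[e]; rewrite e => <-; split=> //.
  by rewrite /next_digit; case: ifPn => /=; rewrite in_itv/= ?andbT// -ltNge.
move=> [e h]; rewrite e; congr rcons; rewrite /next_digit; case: b h => /=; rewrite in_itv/= ?andbT//.
by move=> h; apply/negbTE; rewrite -ltNge.
Qed.

(** Encoding masses as lengths takes countable additivity from Lebesgue measure instead of an
    extension theorem on the Cantor space. *)
Lemma exists_dyadic_measure :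
  exists mu : {finite_measure set (measurableTypeR R) -> \bar R},
  forall s, mu [set u | digit_word u (size s) = s] = (m s)%:E.
Proof.
have mD : measurable (`[0%R, m [::][%classic : set (measurableTypeR R)).
  exact: measurable_itv.
have fin : (@lebesgue_measure R `[0%R, m [::][%classic < +oo)%E.
  by rewrite lebesgue_measure_itv/=; case: ifPn => _; rewrite -?EFinB ltry.
exists (@mfrestr _ (measurableTypeR R) R _ lebesgue_measure mD fin) => s.
transitivity (@lebesgue_measure R ([set u | digit_word u (size s) = s] `&` `[0%R, m [::][%classic)); first by [].
rewrite cell_itv lebesgue_measure_itv/= lte_fin ltrDl.
case: ifPn => [|]; first by rewrite -EFinB addrC addKr.
by rewrite -leNgt => h; congr EFin; apply/eqP; rewrite eq_le m_ge0 h.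
Qed.

Lemma measurable_digits_preimage (V : set cantor_space) : open V ->
  measurable [set u : R | V (digits u)].
Proof.
move=> oV.
rewrite (_ : mkset _ = \bigcup_(s in [set: seq bool])
   (if `[< forall b, prefix_of (size s) b = s -> V b >]
    then [set u | digit_word u (size s) = s] else set0)).
  apply: countable_bigcupT_measurable => [|s]; first exact: countableP.
  by case: ifPn => // _; exact: measurable_cell.
apply/seteqP; split => u /=.
  move=> Vu; have [|k kV] := @cantor_nbhs_prefix (digits u) V.
    exact: open_nbhs_nbhs.
  exists (digit_word u k) => //; rewrite size_path ifT//=.
  by apply/asboolP => b bu; apply: kV; rewrite bu prefix_of_digits.
move=> [s _]; case: ifPn => // /asboolP h /= e.
by apply: h; rewrite prefix_of_digits.
Qed.

End dyadic_measure.

Lemma cvg_sum_seq (R : realType) (I : Type) (r : seq I) (u : I -> nat -> R) (l : I -> R) :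
  (forall i, u i n @[n --> \oo] --> l i) ->
  \sum_(i <- r) u i n @[n --> \oo] --> \sum_(i <- r) l i.
Proof.
move=> ul; elim: r => [|i r ih].
  by rewrite big_nil; under eq_cvg do rewrite big_nil; exact: cvg_cst.
by rewrite big_cons; under eq_cvg do rewrite big_cons; exact: cvgD.
Qed.

Lemma exists_finite_pushforward d d' (X : measurableType d) (Y : measurableType d')
    (R : realType) (mu : {finite_measure set X -> \bar R}) (q : X -> Y) :
  measurable_fun setT q ->
  exists lam : {finite_measure set Y -> \bar R}, forall u : Y -> R,
    measurable_fun setT u -> rint mu (u \o q) ->
    \int[lam]_y u y = \int[mu]_x u (q x).
Proof.
move=> mq.
have [lam0 lam0E] : exists lam : {measure set Y -> \bar R}, lam = pushforward mu q :> (set Y -> \bar R).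
  by unshelve (eexists (pushforward mu q)); [exact: mq|].
have fin : (lam0 setT < +oo)%E.
  rewrite lam0E /pushforward preimage_setT.
  by rewrite -ge0_fin_numE ?fin_num_measure.
(* Restriction to the whole space changes no value and supplies the finite-measure structure. *)
exists (mfrestr measurableT fin) => u mu_ iu; congr fine.
transitivity (\int[pushforward mu q]_y (u y)%:E)%E; last first.
  by rewrite integral_pushforward//; exact/measurable_EFinP.
apply: eq_measure_integral => A mA _.
transitivity (lam0 (A `&` setT)); first by [].
by rewrite setIT lam0E.
Qed.

Section weak_limits.
Context {R : realType} {T : pointedMetricType R}.
Hypothesis compactT : compact [set: T].

Lemma continuous_compact_bounded (f : T -> R) : continuous f ->
  exists M : R, forall t, `|f t| <= M.
Proof.
move=> cf.
have : compact (f @` setT) by apply: continuous_compact => //; exact: continuous_subspaceT.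
move=> /compact_bounded[M [_ hM]]; exists (M + 1) => t.
by apply: (hM (M + 1)); [rewrite ltrDl|exists t].
Qed.

Lemma continuous_compact_rint (lam : {finite_measure set (Borel T) -> \bar R}) (f : T -> R) :
  continuous f -> rint lam (f : Borel T -> R).
Proof.
move=> cf; have [M fM] := continuous_compact_bounded cf.
by apply: (@rint_bounded _ (Borel T) R lam f M) => //; exact: continuous_Borel_measurable.
Qed.

(* [T] is a continuous image of the Cantor space; the masses of the cylinders
   converge along a subsequence, and the limit masses are realised by the
   Lebesgue measure on nested intervals, pushed forward to [T]. *)
Lemma discrete_measures_weak_limit (l : nat -> seq (R * T)) (M : R) :
  (forall n, all (fun p => 0 <= p.1) (l n)) ->
  (forall n, \sum_(p <- l n) p.1 <= M) ->
  exists (lam : {finite_measure set (Borel T) -> \bar R}) (s : nat -> nat),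
    (forall n, (n <= s n)%N) /\
    forall f : T -> R, continuous f ->
      \sum_(p <- l (s n)) p.1 * f p.2 @[n --> \oo] --> \int[lam]_t f t.
Proof.
move=> l0 lM.
have [c cc] := cantor_surj compactT (@metric_hausdorff R T).
(* Measurability of [sec] is not at stake: it is applied only to the finitely many atoms of each
   [l n]. *)
have [sec secK] : exists sec : T -> cantor_space, forall t, c (sec t) = t.
  have h t : exists b, c b = t by have [b _ <-] := @surj _ _ _ _ c t I; exists b.
  by have [sec secK] := choice h; exists sec.
pose L n (s : seq bool) : R := \sum_(p <- l n) p.1 * (prefix_of (size s) (sec p.2) == s)%:R.
have p0 n p : p \in l n -> 0 <= p.1 by move=> /(allP (l0 n)).
have L0 n s : 0 <= L n s.
  by rewrite /L big_seq; apply: sumr_ge0 => p /p0 h; rewrite mulr_ge0.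
have LM n s : L n s <= M.
  apply: le_trans (lM n); rewrite /L !big_seq; apply: ler_sum => p /p0 h.
  by rewrite ler_piMr//; case: eqP.
have Lsplit n s : L n s = L n (rcons s false) + L n (rcons s true).
  rewrite /L -big_split/=; apply: eq_bigr => p _; rewrite -mulrDr; congr (_ * _).
  rewrite !size_rcons /prefix_of !mkseqS !eqseq_rcons.
  by case: eqP => //= _; case: (sec p.2 (size s)); rewrite ?addr0 ?add0r.
have [s [m0 [sn cvm]]] : exists (s : nat -> nat) (m : nat -> R), (forall n, (n <= s n)%N) /\
    forall j, L (s n) (odflt [::] (unpickle j)) @[n --> \oo] --> m j.
  apply: (@bounded_array_subsequence R (fun n j => L n (odflt [::] (unpickle j))) M) => n j.
  by rewrite L0 LM.
pose m (r : seq bool) := m0 (pickle r).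
have cvL q : L (s n) q @[n --> \oo] --> m q.
  by have := cvm (pickle q); rewrite pickleK.
have m_ge0 q : 0 <= m q by apply: (cvgr_to_ge (cvL q)); exact: nearW.
have m_split q : m q = m (rcons q false) + m (rcons q true).
  rewrite -(cvg_lim (@Rhausdorff R) (cvL q)); apply: cvg_lim => //.
  by under eq_cvg do rewrite Lsplit; exact: cvgD.
have [mu muE] := exists_dyadic_measure m_ge0 m_split.
pose q u : T := c (digits m u).
have mq : measurable_fun [set: measurableTypeR R] (q : _ -> Borel T).
  apply: (@measurability _ _ _ (Borel T) setT q (@open T)) => // _ [V oV <-]; rewrite setTI.
  apply: (measurable_digits_preimage m (V := c @^-1` V)).
  by move/continuousP : cc; exact.
have [lam lamE] := exists_finite_pushforward mu mq.
exists lam, s; split => // f cf.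
pose F b := f (c b).
have cF : continuous F by move=> b; apply: continuous_comp; [exact: cc|exact: cf].
have mf : measurable_fun setT (f : Borel T -> R) by exact: continuous_Borel_measurable.
have mfq : measurable_fun [set: measurableTypeR R] (fun u => f (q u)) := measurableT_comp mf mq.
have [Mf fM] := continuous_compact_bounded cf.
have -> : \int[lam]_t f t = \int[mu]_u f (q u).
  apply: lamE => //.
  exact: (rint_bounded mu mfq (fun u => fM (q u))).
have M0 : 0 <= M by apply: le_trans (LM 0%N [::]); exact: L0.
pose mass := fine (mu setT).
have mass0 : 0 <= mass by exact: fine_ge0.
apply/cvgrPdist_le => e e0.
have [e1 e1_gt0 e1M] : exists2 t, 0 < t & t * (M + mass) <= e / 2.
  by apply: small_mul; [exact: divr_gt0|exact: addr_ge0].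
have [k kP] := cantor_uniform_prefix cF e1_gt0.
(* Both integrals are compared with sums over cylinders of depth [k]; there are finitely many, so
   convergence of the masses suffices. *)
pose I1 := \sum_(r : k.-tuple bool) m r * F (extend0 r).
pose J n := \sum_(r : k.-tuple bool) L (s n) r * F (extend0 r).
have mu_I : `|\int[mu]_u f (q u) - I1| <= e1 * mass.
  pose cell r := [set u | digit_word m u (size r) = r].
  pose st u := \sum_(r : k.-tuple bool) F (extend0 r) * \1_(cell r) u.
  have stE u : st u = F (extend0 (digit_word m u k)).
    pose r0 : k.-tuple bool := Tuple (introT eqP (size_path m u k)).
    rewrite /st (bigD1 r0)//= big1 ?addr0 => [|r rr0].
      by rewrite indicE mem_set ?mulr1//= /cell/= size_path.
    rewrite indicE memNset ?mulr0// /cell/= size_tuple => e'.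
    by move/eqP : rr0; apply; apply/val_inj.
  have icell (r : k.-tuple bool) : rint mu (\1_(cell r) : measurableTypeR R -> R).
    apply: (@rint_bounded _ _ R mu _ 1).
      by apply/measurable_indicP; exact: measurable_cell.
    by move=> x; rewrite indicE; case: (_ \in _); rewrite ?normr1 ?normr0.
  have iterm (r : k.-tuple bool) : rint mu (fun u => F (extend0 r) * \1_(cell r) u).
    exact: rintZ.
  have ist : rint mu st by exact: rint_sum.
  have -> : I1 = \int[mu]_u st u.
    rewrite Rintegral_sum// /I1; apply: eq_bigr => r _.
    have -> : \int[mu]_x (F (extend0 r) * \1_(cell r) x) =
        F (extend0 r) * \int[mu]_x \1_(cell r) x.
      by apply: RintegralZl => //; exact: icell.
    rewrite mulrC; congr (_ * _).
    rewrite /Rintegral integral_indic//; last exact: measurable_cell.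
    by rewrite setIT -[RHS]/(fine (mu [set u | digit_word m u (size r) = r])) muE.
  have ifq : rint mu (fun u => f (q u)).
    exact: (rint_bounded mu mfq (fun u => fM (q u))).
  rewrite -RintegralB//.
  apply: (le_trans (le_normr_Rintegral measurableT _)); first exact: rintB.
  apply: (@le_trans _ _ (\int[mu]_u e1)).
    apply: le_rint; [exact/rint_abs/rintB|exact: rint_cst|].
    by move=> u; rewrite stE -prefix_of_digits; exact: kP.
  by rewrite Rintegral_cst.
have l_J n : `|J n - \sum_(p <- l (s n)) p.1 * f p.2| <= e1 * M.
  have -> : J n = \sum_(p <- l (s n)) p.1 * F (extend0 (prefix_of k (sec p.2))).
    rewrite /J /L; under eq_bigr do rewrite mulr_suml.
    rewrite exchange_big/=; apply: eq_bigr => p _.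
    pose r0 : k.-tuple bool := Tuple (introT eqP (size_prefix_of k (sec p.2))).
    rewrite (bigD1 r0)//= big1 ?addr0 => [|r rr0].
      by rewrite size_prefix_of eqxx mulr1.
    rewrite size_tuple; case: eqP => [e'|]; last by rewrite mulr0 mul0r.
    by case/eqP : rr0; apply/val_inj.
  rewrite -sumrB (le_trans (ler_norm_sum _ _ _))//.
  apply: (@le_trans _ _ (e1 * \sum_(p <- l (s n)) p.1)); last by rewrite ler_pM2l.
  rewrite mulr_sumr !big_seq; apply: ler_sum => p /p0 h.
  rewrite -mulrBr normrM (ger0_norm h) mulrC ler_wpM2r//.
  by rewrite distrC -{1}(secK p.2); exact: kP.
have J_cvg : J n @[n --> \oo] --> I1.
  by apply: cvg_sum_seq => r; apply: cvgMr_tmp; exact: cvL.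
near=> n.
have h1 := l_J n.
have h2 : `|I1 - J n| <= e / 2.
  by near: n; move/cvgrPdist_le : J_cvg; apply; exact: divr_gt0.
rewrite (le_trans (ler_distD I1 _ _))//.
have := ler_distD (J n) I1 (\sum_(p <- l (s n)) p.1 * f p.2).
move: e1M; rewrite mulrDr; lra.
Unshelve. all: by end_near. Qed.

End weak_limits.

(** * Quantisation of measures and integrals depending on a parameter *)

Section quantization.
Context {R : realType} {T : pointedMetricType R}.
Hypothesis compactT : compact [set: T].

(** Brings continuity in [t] within reach of dominated convergence, a statement about sequences. *)
Lemma sequentially_continuous (f : T -> R) :
  (forall (t : T) (u : nat -> T), u @ \oo --> t -> f (u n) @[n --> \oo] --> f t) ->
  continuous f.
Proof.
move=> h t; apply/cvgrPdist_lt => e e0; apply/nbhs_ballP; apply: contrapT => H.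
have hn (n : nat) : exists y, ball t n.+1%:R^-1 y /\ e <= `|f t - f y|.
  apply: contrapT => Hn; apply: H; exists n.+1%:R^-1; first by rewrite /= invr_gt0.
  move=> y ty /=; rewrite ltNge; apply/negP => ye; apply: Hn; by exists y.
have [u uP] := choice hn.
have : u @ \oo --> t.
  apply/cvg_ballP => r r0; near=> n.
  apply: (le_ball _ (uP n).1); apply: ltW.
  by near: n; exact: (near_infty_natSinv_lt (PosNum r0)).
move=> /h/cvgrPdist_lt/(_ _ e0)[N _ /(_ N (leqnn N))] /=.
by rewrite ltNge (uP N).2.
Unshelve. all: by end_near. Qed.

Lemma compact_finite_balls (e : R) : 0 < e ->
  exists s : seq T, forall t, exists2 u, u \in s & (ball u e)^° t.
Proof.
move=> e0; move: compactT; rewrite compact_cover => /(_ T setT (fun u => (ball u e)^°)).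
case.
- by move=> u _; exact: open_interior.
- move=> t _; exists t => //; apply: nbhsx_ballx => //.
move=> D _ cov; exists (finmap.enum_fset D) => t.
by have [u /= uD ut] := cov t I; exists u.
Qed.

(** The space is cut into disjoint pieces of balls of radius [1 / (n + 1)], and the mass of each
    piece is put at the centre of its ball. Integrals against [lam] become limits of finite sums. *)
Lemma finite_quantization (lam : {finite_measure set (Borel T) -> \bar R}) :
  exists l : nat -> seq (R * T), (forall n, all (fun p => 0 <= p.1) (l n)) /\
    forall f : T -> R, continuous f ->
      \sum_(p <- l n) p.1 * f p.2 @[n --> \oo] --> \int[lam]_t f t.
Proof.
have e0 (n : nat) : 0 < n.+1%:R^-1 :> R by rewrite invr_gt0.
have [s sP] := choice (fun n => compact_finite_balls (e0 n)).
pose U n i : set T := if (i < size (s n))%N then (ball (nth point (s n) i) n.+1%:R^-1)^° else set0.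
have mU n i : measurable (U n i : set (Borel T)).
  rewrite /U; case: ifPn => _ //; apply: sub_sigma_algebra; exact: open_interior.
pose C n i : set (Borel T) := seqDU (U n) i.
have mC n i : measurable (C n i).
  by apply: measurableD => //; apply: bigsetU_measurable => j _; exact: mU.
pose l n := [seq (fine (lam (C n i)), nth point (s n) i) | i <- iota 0 (size (s n))].
exists l; split.
  by move=> n; apply/allP => _ /mapP[i _ ->] /=; exact: fine_ge0.
move=> f cf.
pose st n t := \sum_(i <- iota 0 (size (s n))) f (nth point (s n) i) * \1_(C n i) t.
have hst n t : exists2 u, ball u n.+1%:R^-1 t & st n t = f u.
  have tU : (\bigcup_i U n i) t.
    have [u us ut] := sP n t; exists (index u (s n)) => //.
    by rewrite /U index_mem us nth_index.
  have [i0 _ ti0] : (\bigcup_i C n i) t by rewrite /C -seqDU_bigcup_eq.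
  have ti0' : U n i0 t by case: ti0.
  have i0s : (i0 < size (s n))%N by move: ti0'; rewrite /U; case: ifPn.
  exists (nth point (s n) i0).
    by move: ti0'; rewrite /U i0s; exact: interior_subset.
  rewrite /st (bigD1_seq i0)/= ?iota_uniq ?mem_iota//.
  rewrite indicE mem_set// mulr1 big1 ?addr0// => j ji0.
  rewrite indicE memNset ?mulr0// => tj.
  by have /trivIsetP/(_ j i0 I I ji0) := @trivIset_seqDU T (U n); rewrite -subset0 => /(_ t); apply.
have iC n i : rint lam (\1_(C n i) : Borel T -> R).
  apply: (@rint_bounded _ _ R lam _ 1); first exact/measurable_indicP.
  by move=> x; rewrite indicE; case: (_ \in _); rewrite ?normr1 ?normr0.
have ist n i : rint lam (fun t => f (nth point (s n) i) * \1_(C n i) t).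
  exact: rintZ.
have stE n : \sum_(p <- l n) p.1 * f p.2 = \int[lam]_t st n t.
  rewrite big_map Rintegral_sum//; apply: eq_bigr => i _ /=.
  have -> : \int[lam]_x (f (nth point (s n) i) * \1_(C n i) x) =
      f (nth point (s n) i) * \int[lam]_x \1_(C n i) x.
    by apply: RintegralZl => //; exact: iC.
  by rewrite mulrC /Rintegral integral_indic// setIT.
have [M fM] := continuous_compact_bounded compactT cf.
under eq_cvg do rewrite stE.
have [] // := @Rdominated_convergence _ _ _ lam st f (fun=> M).
- by move=> n; apply: (rint_measurable (mu := lam)); exact: rint_sum.
- exact: continuous_Borel_measurable.
- exact: rint_cst.
- by move=> n t; have [u _ ->] := hst n t.
apply: aeW => t; apply/cvgrPdist_lt => e e_gt0.
have /cvgrPdist_lt/(_ _ e_gt0)/nbhs_ballP[r /= r0 rP] := cf t.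
near=> n; have [u ut ->] := hst n t.
apply: rP; apply: ball_sym; apply: (le_ball _ ut); apply: ltW.
by near: n; exact: (near_infty_natSinv_lt (PosNum r0)).
Unshelve. all: by end_near. Qed.

Section kernel.
Context d (X : measurableType d).
Variables (mu : {measure set X -> \bar R}) (psi : T -> X -> R) (G : X -> R).
Hypotheses (mpsi : forall t, measurable_fun setT (psi t))
  (cpsi : forall x, continuous (psi ^~ x))
  (psiG : forall t x, `|psi t x| <= G x) (iG : rint mu G).

Lemma kernel_rint t : rint mu (psi t).
Proof. exact: rint_le iG. Qed.

Lemma kernel_continuous : continuous (fun t => \int[mu]_x psi t x).
Proof.
apply: sequentially_continuous => t u ut.
have [] // := @Rdominated_convergence _ _ _ mu (fun n => psi (u n)) (psi t) G.
apply: aeW => x; exact: (cvg_comp _ _ ut (@cpsi x t)).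
Qed.

Variable lam : {finite_measure set (Borel T) -> \bar R}.

Lemma kernel_measurable : measurable_fun setT (fun x => \int[lam]_t psi t x).
Proof.
have [l [_ lP]] := finite_quantization lam.
have h x : \sum_(p <- l n) p.1 * psi p.2 x @[n --> \oo] --> \int[lam]_t psi t x.
  exact: (lP (psi ^~ x) (@cpsi x)).
apply: (measurable_fun_cvg (h := fun n x => \sum_(p <- l n) p.1 * psi p.2 x)) => //.
move=> n; apply: measurable_sum => p; exact: measurable_funM.
Qed.

Lemma kernel_bound x : `|\int[lam]_t psi t x| <= fine (lam setT) * G x.
Proof.
have i1 := continuous_compact_rint compactT lam (@cpsi x).
apply: (le_trans (le_normr_Rintegral measurableT i1)).
rewrite mulrC -Rintegral_cst//; apply: le_rint => //; first exact: rint_abs.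
exact: rint_cst.
Qed.

Lemma kernel_integral_rint : rint mu (fun x => \int[lam]_t psi t x).
Proof.
apply: rint_le kernel_measurable kernel_bound _; exact: rintZ.
Qed.

(** For finite sums the exchange is linearity. One side passes to the limit by domination, the other
    by continuity in [t] of the inner integral, so no joint measurability of [psi] enters. *)
Lemma kernel_fubini : \int[mu]_x (\int[lam]_t psi t x) = \int[lam]_t (\int[mu]_x psi t x).
Proof.
have [l [l0 lP]] := finite_quantization lam.
have c1 := lP _ kernel_continuous.
have sumE n : \sum_(p <- l n) p.1 * \int[mu]_x psi p.2 x =
    \int[mu]_x (\sum_(p <- l n) p.1 * psi p.2 x).
  rewrite Rintegral_sum; last by move=> p; apply: rintZ; exact: kernel_rint.
  by apply: eq_bigr => p _; rewrite RintegralZl//; exact: kernel_rint.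
have {}c1 : \int[mu]_x (\sum_(p <- l n) p.1 * psi p.2 x) @[n --> \oo] -->
    \int[lam]_t (\int[mu]_x psi t x).
  by under eq_cvg do rewrite -sumE.
have cmass := lP (fun=> 1) (fun t => cvg_cst _).
(* The total masses converge (test function 1), hence are bounded; this gives the dominating
   function [B * G]. *)
have [B hB] : exists B : R, forall n, \sum_(p <- l n) p.1 * 1 <= B.
  have /cvg_seq_bounded[B [_ hB]] : cvgn (fun n => \sum_(p <- l n) p.1 * 1).
    by apply/cvg_ex; eexists; exact: cmass.
  exists (B + 1) => n; apply: le_trans (ler_norm _) _.
  by apply: hB => //; rewrite ltrDl.
rewrite -(cvg_lim (@Rhausdorff R) c1); apply/esym/cvg_lim => //.
have [] // := @Rdominated_convergence _ _ _ mu
  (fun n x => \sum_(p <- l n) p.1 * psi p.2 x) (fun x => \int[lam]_t psi t x) (fun x => B * G x).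
- by move=> n; apply: measurable_sum => p; exact: measurable_funM.
- exact: kernel_measurable.
- exact: rintZ.
- move=> n x; apply: (le_trans (ler_norm_sum _ _ _)).
  have G0 : 0 <= G x by apply: le_trans (psiG point x).
  apply: (@le_trans _ _ ((\sum_(p <- l n) p.1 * 1) * G x)); last by rewrite ler_wpM2r.
  rewrite mulr_suml !big_seq; apply: ler_sum => p /(allP (l0 n)) p0.
  by rewrite mulr1 normrM ger0_norm// ler_wpM2l.
- by apply: aeW => x; exact: (lP (psi ^~ x) (@cpsi x)).
Qed.

End kernel.
End quantization.

Lemma compact_positive_bound (R : realType) (T : pointedMetricType R) (f : T -> R) :
  compact [set: T] -> continuous f -> (forall t, 0 < f t) ->
  exists2 c : R, 0 < c & forall t, c <= f t.
Proof.
move=> hT cf f0.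
have [M hM] : exists M : R, forall t, `|(f t)^-1| <= M.
  apply: continuous_compact_bounded => // t; apply: cvgV; first by rewrite gt_eqF.
  exact: cf.
have M0 : 0 < M.
  by apply: lt_le_trans (hM point); rewrite normr_gt0 invr_eq0 gt_eqF.
exists M^-1; first by rewrite invr_gt0.
move=> t; have := hM t; rewrite gtr0_norm ?invr_gt0// => h.
by rewrite -[leRHS]invrK lef_pV2// posrE invr_gt0.
Qed.

(** Only [x = 0] needs work: for small positive [z], [ent z <= 1], and the tangent at [y = e / 3]
    gives [ent z >= 1 - y + z ln y]. For [z <= 0] the logarithm is 0. *)
Lemma ent_continuous (R : realType) (x : R) : 0 <= x -> {for x, continuous (@ent R)}.
Proof.
rewrite le_eqVlt => /orP[/eqP <-|x0]; last first.
  by apply: cvgD; [apply: cvgB => //; apply: cvgM => //; exact: continuous_ln|exact: cvg_cst].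
apply/cvgrPdist_lt => e e0.
pose y := e / 3.
have y0 : 0 < y by rewrite divr_gt0.
have [t t0 ty] := small_mul y0 (normr_ge0 (ln y)).
have near0 (r : R) : 0 < r -> \forall z \near (0 : R), `|z| < r.
  move=> r0; apply/nbhs_ballP; exists r => // z.
  by rewrite /ball/= sub0r normrN.
near=> z.
have zt : `|z| < t by near: z; exact: near0.
have z1 : `|z| < 1 by near: z; exact: near0.
have ze : `|z| < e by near: z; exact: near0.
rewrite [in ent 0]/ent mul0r subr0 add0r.
have [z0|z0] := leP z 0.
  by rewrite /ent ln0// mulr0 sub0r opprD opprK addrCA subrr addr0.
have h1 := ent_tangent (ltW z0) y0.
have h2 : ent z <= 1.
  rewrite /ent gerDr subr_le0 ger_pMr//.
  rewrite (le_trans (ln_le_sub1 z0))// lerBlDr.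
  by move: z1; rewrite gtr0_norm//; lra.
rewrite ger0_norm ?subr_ge0//.
have h3 : z * `|ln y| <= y.
  by apply: le_trans ty; rewrite ler_wpM2r// ltW//; move: zt; rewrite gtr0_norm.
have h4 : - (z * `|ln y|) <= z * ln y.
  by rewrite -mulrN ler_pM2l// lerNl ler_normr lexx orbT.
have ey : ent y = y * ln y - y + 1 by [].
have e3 : e = 3 * y by rewrite /y; field.
by rewrite e3; rewrite ey in h1; lra.
Unshelve. all: by end_near. Qed.

Lemma Rintegral_eq0_ae d (X : measurableType d) (R : realType)
    (mu : {measure set X -> \bar R}) (f : X -> R) :
  rint mu f -> (forall x, 0 <= f x) -> \int[mu]_x f x = 0 ->
  {ae mu, forall x, f x = 0}.
Proof.
move=> i_f f0 z.
have mE : measurable_fun setT (EFin \o f) by exact: measurable_int i_f.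
have /(ae_eq_integral_abs _ measurableT mE) : (\int[mu]_x `|(EFin \o f) x| = 0)%E.
  under eq_integral do rewrite /= ger0_norm//.
  by rewrite rintegralE// z.
by apply: filterS => x /(_ I) [].
Qed.

Lemma cvg_right_le (R : realType) (q : R -> R) (l B d : R) : 0 < d ->
  (forall e, 0 < e -> e < d -> q e <= B) -> q e @[e --> 0^'+] --> l -> l <= B.
Proof.
move=> d0 qB ql; apply: (cvgr_to_le ql); near=> e; apply: qB.
  by near: e; exact: nbhs_right_gt.
by near: e; exact: nbhs_right_lt.
Unshelve. all: by end_near. Qed.

Lemma near_right_interval (R : realType) (P : R -> Prop) : (\forall e \near (0 : R)^'+, P e) ->
  exists2 d : R, 0 < d & forall e, 0 < e -> e < d -> P e.
Proof.
move=> [d /= d0 hd]; exists d => // e e0 ed; apply: hd => //=.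
by rewrite /ball/= sub0r normrN gtr0_norm.
Qed.

(** * Functions with a subgradient at every point of an interval *)

Section subgradient.
Context (R : realType).
Variables (b : R) (v L : R -> R).
Hypotheses (b0 : 0 < b) (L0 : forall e : R, 0 <= e <= b -> 0 <= L e)
  (sub : forall e e' : R, 0 <= e <= b -> 0 <= e' <= b -> v e - L e * (e' - e) <= v e').

Lemma subgradient_nonincreasing (e e' : R) : 0 <= e <= b -> 0 <= e' <= b -> e <= e' -> L e' <= L e.
Proof.
move=> eb eb'; rewrite le_eqVlt => /predU1P[->//|ee'].
have h := sub eb eb'; have h' := sub eb' eb.
by rewrite -(@ler_pM2r _ (e' - e)) ?subr_gt0//; lra.
Qed.

(** [L 0] is the largest slope on the interval, hence a Lipschitz constant; it later serves as the
    stability constant. *)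
Lemma subgradient_bound (e e' : R) : 0 <= e -> e <= e' -> e' <= b ->
  0 <= v e - v e' <= L 0 * (e' - e).
Proof.
move=> e0 ee' eb'.
have i0 : (0 : R) <= 0 <= b by rewrite lexx ltW.
have ie : 0 <= e <= b by rewrite e0 (le_trans ee').
have ie' : 0 <= e' <= b by rewrite eb' (le_trans e0).
have h := sub ie ie'; have h' := sub ie' ie.
have d0 : 0 <= e' - e by rewrite subr_ge0.
have h1 := mulr_ge0 (L0 ie') d0.
have h2 := ler_wpM2r d0 (subgradient_nonincreasing i0 ie e0).
by apply/andP; split; lra.
Qed.

Lemma subgradient_absolutely_continuous : absolutely_continuous_on 0 b v.
Proof.
move=> e e0; have i0 : (0 : R) <= 0 <= b by rewrite lexx ltW.
have M0 : 0 < L 0 + 1 by rewrite ltr_wpDl// L0.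
exists (e / (L 0 + 1)); first exact: divr_gt0.
move=> n u w uw _; rewrite ltr_pdivlMr// => lt_e.
apply: le_lt_trans lt_e; rewrite mulr_suml; apply: ler_sum => i _.
have [u0 uwi wb] := uw i; have /andP[h1 h2] := subgradient_bound u0 uwi wb.
rewrite distrC ger0_norm// (le_trans h2)// mulrC ler_wpM2l ?subr_ge0//.
by rewrite lerDl.
Qed.

(** The one-sided limits of the monotone [- L] exist and enclose [- L e]; when equal they make [L]
    continuous at [e]. The inequalities at [e] and [e + h] confine the difference quotient between
    [- L e] and [- L (e + h)]. *)
Lemma subgradient_derive (e : R) : 0 < e -> e < b -> ~ discontinuity (fun x => - L x) e ->
  is_derive e 1 v (- L e).
Proof.
move=> e0 eb ndisc.
have mono x y : 0 < x -> x <= y -> y < b -> - L x <= - L y.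
  move=> x0 xy yb; rewrite lerN2; apply: subgradient_nonincreasing => //.
    by rewrite (ltW x0)/= (le_trans xy)// ltW.
  by rewrite (ltW yb) andbT (le_trans (ltW x0)).
have cl : cvg (- L x @[x --> e^'-]).
  apply: nondecreasing_at_left_is_cvgr; near=> s.
  - have s0 : 0 < s by near: s; exact: nbhs_left_gt.
    move=> x y; rewrite !in_itv/= => /andP[sx xe] /andP[sy ye] xy; apply: mono => //.
      exact: lt_trans sx.
    exact: lt_trans eb.
  - have s0 : 0 < s by near: s; exact: nbhs_left_gt.
    exists (- L e) => _ [y /= + <-]; rewrite in_itv/= => /andP[sy ye].
    by apply: mono (ltW ye) eb; exact: lt_trans sy.
have cr : cvg (- L x @[x --> e^'+]).
  apply: nondecreasing_at_right_is_cvgr; near=> s.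
  - have sb : s < b by near: s; exact: nbhs_right_lt.
    move=> x y; rewrite !in_itv/= => /andP[ex xs] /andP[ey ys] xy; apply: mono => //.
      exact: lt_trans ex.
    exact: lt_trans sb.
  - have sb : s < b by near: s; exact: nbhs_right_lt.
    exists (- L e) => _ [y /= + <-]; rewrite in_itv/= => /andP[ey ys].
    by apply: mono e0 (ltW ey) _; exact: lt_trans sb.
have le1 : lim (- L x @[x --> e^'-]) <= - L e.
  apply: limr_le => //; near=> x.
  have x0 : 0 < x by near: x; exact: nbhs_left_gt.
  have xe : x <= e by near: x; exact: nbhs_left_le.
  exact: mono.
have le2 : - L e <= lim (- L x @[x --> e^'+]).
  apply: limr_ge => //; near=> x.
  have ex : e <= x by near: x; exact: nbhs_right_ge.
  have xb : x < b by near: x; exact: nbhs_right_lt.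
  exact: mono.
have leq : lim (- L x @[x --> e^'-]) = lim (- L x @[x --> e^'+]).
  by apply/eqP; apply: contrapT => /negP h; exact: ndisc.
have cL : {for e, continuous L}.
  rewrite -[L](_ : (fun x => - - L x) = _); last by apply/funext => x; rewrite opprK.
  apply: cvgN; apply/left_right_continuousP; split.
    by rewrite -(_ : lim (- L x @[x --> e^'-]) = - L e)//; apply/le_anti; rewrite le1 leq.
  by rewrite -(_ : lim (- L x @[x --> e^'+]) = - L e)//; apply/le_anti; rewrite le2 -leq le1.
have hd : h^-1 *: (v (h *: (1 : R) + e) - v e) @[h --> (0 : R)^'] --> - L e.
  apply/cvgrPdist_le => d d0.
  have /cvgrPdist_le/(_ _ d0)/nbhs_ballP[r /= r0 hr] := cL.
  near=> h.
  have h0 : h != 0 by near: h; exact: nbhs_dnbhs_neq.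
  have hh : `|h| < Num.min r (Num.min e (b - e)).
    near: h; apply: dnbhs0_lt; rewrite !lt_min r0 e0/= subr_gt0//.
  move: hh; rewrite !lt_min => /and3P[h1 h2 h3].
  have ie : 0 <= e <= b by rewrite !ltW.
  have ieh : 0 <= h + e <= b.
    have n1 := ler_norm h; have n2 := ler_norm (- h); rewrite normrN in n2.
    by apply/andP; split; lra.
  have s1 := sub ie ieh; have s2 := sub ieh ie.
  have hL := hr (h + e); rewrite /ball/= in hL.
  have dL : `|L e - L (h + e)| <= d by apply: hL; rewrite distrC addrK.
  have -> : h *: (1 : R) = h by rewrite /GRing.scale/= mulr1.
  rewrite -[h^-1 *: _]/(h^-1 * _).
  rewrite (_ : _ - _ = - (h^-1 * (v (h + e) - v e + L e * h))); last by field.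
  rewrite normrN normrM normfV ler_pdivrMl ?normr_gt0//.
  have d1 : 0 <= v (h + e) - v e + L e * h by lra.
  rewrite ger0_norm//.
  apply: (@le_trans _ _ ((L e - L (h + e)) * h)); first by lra.
  apply: (le_trans (ler_norm _)); rewrite normrM mulrC.
  by rewrite ler_wpM2l.
have dv : derivable v e 1 by apply/cvg_ex; exists (- L e).
by apply: DeriveDef => //; exact: cvg_lim hd.
Unshelve. all: by end_near. Qed.

Lemma subgradient_ae_derive :
  {ae (@lebesgue_measure R), forall e, 0 < e < b -> is_derive e 1 v (- L e)}.
Proof.
have nd : {in `[0, b] &, nondecreasing_fun (fun x => - L x)}.
  move=> x y; rewrite !in_itv/= => xb yb xy.
  by rewrite lerN2; exact: subgradient_nonincreasing.
have cN := discontinuity_countable nd.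
exists [set x | (x \in `]0, b[) /\ discontinuity (fun x => - L x) x]; split.
- exact: countable_measurable.
- exact: countable_lebesgue_measure0.
- move=> e /=; apply: contra_notP => ne /andP[e0 eb].
  apply: subgradient_derive => // disc; apply: ne; split => //.
  by rewrite in_itv/= e0.
Qed.

End subgradient.

(** * Existence and uniqueness of the minimiser *)

Section Pphi_facts.
Context (R : realType) (E : completeMetricType R) (phi : moment_fun E).
Implicit Types mu : Pphi phi.

Lemma measurable_moment : measurable_fun [set: Borel E] (phi : Borel E -> R).
Proof. apply: continuous_Borel_measurable; exact: moment_continuous. Qed.

Lemma rint_moment mu : rint mu (phi : Borel E -> R).
Proof.
apply: rint_ge0; [exact: measurable_moment|exact: moment_ge0|exact: (svalP mu)].
Qed.

Lemma rint_moment_bound mu (u : Borel E -> R) (C : R) : measurable_fun setT u ->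
  (forall x, `|u x| <= C * (1 + phi x)) -> rint mu u.
Proof.
move=> mu_ uC; apply: (rint_le mu_ uC); apply: rintZ.
by apply: rintD; [exact: rint_cst|exact: rint_moment].
Qed.

Lemma mixture_density d (X : measurableType d) (nu : probability X R)
    (P P' : probability X R) (f f' : X -> R) (a : R) : 0 <= a <= 1 ->
  has_density P nu f -> has_density P' nu f' ->
  has_density (mixture a P P') nu (fun x => (1 - a) * f x + a * f' x).
Proof.
move=> a01 [mf f0 fE] [mf' f'0 f'E]; have /andP[a0 a1] := a01.
split.
- by apply: measurable_funD; exact: measurable_funM.
- by move=> x; rewrite addr_ge0// mulr_ge0// subr_ge0.
move=> A mA; rewrite mixtureE// fE// f'E//.
have mfA : measurable_fun A (fun x => (f x)%:E) by apply/measurable_EFinP; exact: measurable_funTS.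
have mfA' : measurable_fun A (fun x => (f' x)%:E) by apply/measurable_EFinP; exact: measurable_funTS.
rewrite -ge0_integralZl_EFin//; [|by move=> x _; rewrite lee_fin|by rewrite subr_ge0].
rewrite -ge0_integralZl_EFin//; last by move=> x _; rewrite lee_fin.
rewrite -ge0_integralD//.
- by move=> x _; rewrite mule_ge0// lee_fin ?subr_ge0.
- exact: measurable_funeM.
- by move=> x _; rewrite mule_ge0// lee_fin.
- exact: measurable_funeM.
Qed.

Lemma mixture_rint d (X : measurableType d) (nu : probability X R)
    (P P' Q : probability X R) (f f' h u : X -> R) (a b : R) :
  has_density P nu f -> has_density P' nu f' -> has_density Q nu h ->
  {ae nu, forall x, h x = a * f x + b * f' x} ->
  rint P u -> rint P' u ->
  rint Q u /\ \int[Q]_x u x = a * \int[P]_x u x + b * \int[P']_x u x.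
Proof.
move=> df df' dh hE iu iu'.
have mu_ : measurable_fun setT u by exact: rint_measurable iu.
have iuf := (integrable_density df mu_).1 iu.
have iuf' := (integrable_density df' mu_).1 iu'.
have [mh _ _] := dh.
have iab := rintD (rintZ a iuf) (rintZ b iuf').
have e : {ae nu, forall x, a * (u x * f x) + b * (u x * f' x) = u x * h x}.
  by apply: filterS hE => x ->; ring.
have iuh : rint nu (fun x => u x * h x).
  by apply: ae_rint e iab; exact: measurable_funM.
split; first exact/(integrable_density dh mu_).
rewrite (Rintegral_density dh mu_) (Rintegral_density df mu_) (Rintegral_density df' mu_).
rewrite -RintegralZl// -RintegralZl// -RintegralD//; [|exact: rintZ|exact: rintZ].
apply: ae_eq_Rintegral; [exact: rint_measurable iuh|exact: rint_measurable iab|].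
by apply: filterS e => x ->.
Qed.

End Pphi_facts.

Section problem_domain.
Context (R : realType) (E : completeMetricType R)
  (phi : moment_fun E) (nu : probability (Borel E) R)
  (F : Pphi phi -> \bar R)
  (S : Type) (zeta : S -> E -> R)
  (T : pointedMetricType R)
  (Psi : T -> Pphi phi -> R).
Hypotheses (hF_gtNy : forall mu, (-oo < F mu)%E)
  (hnu : forall alpha : R, 0 < alpha ->
    (\int[nu]_x (expR (alpha * phi x))%:E < +oo)%E)
  (hzeta : forall s, continuous (zeta s) /\
    exists2 C : R, 0 <= C & forall x, `|zeta s x| <= C * (1 + phi x))
  (hF_convex : convex_functional F)
  (hPsi_convex : forall t, convex_functional (fun mu => (Psi t mu)%:E)).
Implicit Types mu : Pphi phi.

Let D := rate_dom nu F.

(* Junk value [0] when [mu] is not absolutely continuous with respect to [nu]. *)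
Definition dens mu : Borel E -> R :=
  if pselect (exists f, has_density mu nu f) is left h then projT1 (cid h)
  else fun=> 0.

Definition Hent mu : R := \int[nu]_x ent (dens mu x).

Definition Fr mu : R := fine (F mu).

Lemma entropy_of_density (P : probability (Borel E) R) (f : Borel E -> R) :
  has_density P nu f -> rint nu (fun x => ent (f x)) ->
  entropy P nu = (\int[nu]_x ent (f x))%:E.
Proof. by move=> fE ief; rewrite (entropyE fE) rintegralE. Qed.

Lemma densP mu : D mu -> has_density mu nu (dens mu).
Proof.
move=> [lt _]; rewrite /dens; case: pselect => [h|nh]; first by case: cid.
exfalso; apply: nh; apply: exists_density; apply: contrapT => h.
by move: lt; rewrite /entropy asboolF// ltxx.
Qed.

Lemma rint_ent_dens mu : D mu -> rint nu (fun x => ent (dens mu x)).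
Proof.
move=> Dmu; have fE := densP Dmu; have [mf f0 _] := fE.
apply: rint_ge0; first by apply: measurableT_comp => //; exact: measurable_ent.
  by move=> x; exact: ent_ge0.
by rewrite -(entropyE fE); exact: Dmu.1.
Qed.

Lemma entropy_dens mu : D mu -> entropy mu nu = (Hent mu)%:E.
Proof. by move=> Dmu; exact: entropy_of_density (densP Dmu) (rint_ent_dens Dmu). Qed.

Lemma F_fine mu : D mu -> F mu = (Fr mu)%:E.
Proof.
by move=> Dmu; rewrite /Fr fineK// fin_numE gt_eqF//= lt_eqF//; exact: Dmu.2.
Qed.

Lemma rate_fine mu : D mu -> rate nu F mu = (Hent mu + Fr mu)%:E.
Proof. by move=> Dmu; rewrite /rate entropy_dens// F_fine. Qed.

Lemma Hent_ge0 mu : D mu -> 0 <= Hent mu.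
Proof.
move=> Dmu; have [_ f0 _] := densP Dmu.
by apply: Rintegral_ge0 => x _; exact: ent_ge0.
Qed.

Lemma pmix_density a mu mu' : 0 <= a <= 1 -> D mu -> D mu' ->
  has_density (pmix a mu mu') nu (fun x => (1 - a) * dens mu x + a * dens mu' x).
Proof. by move=> a01 Dmu Dmu'; exact: mixture_density a01 (densP Dmu) (densP Dmu'). Qed.

Lemma rint_ent_pmix a mu mu' : 0 <= a <= 1 -> D mu -> D mu' ->
  rint nu (fun x => ent ((1 - a) * dens mu x + a * dens mu' x)).
Proof.
move=> a01 Dmu Dmu'; have [mf f0 _] := densP Dmu; have [mf' f'0 _] := densP Dmu'.
exact: rint_ent_mix (rint_ent_dens Dmu) (rint_ent_dens Dmu') _ a01.
Qed.

Lemma D_pmix a mu mu' : 0 <= a <= 1 -> D mu -> D mu' -> D (pmix a mu mu').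
Proof.
move=> a01 Dmu Dmu'; split.
  rewrite (entropy_of_density (pmix_density a01 Dmu Dmu') (rint_ent_pmix a01 Dmu Dmu')).
  exact: ltry.
apply: (le_lt_trans (hF_convex _ _ a01)).
by rewrite F_fine// F_fine// -!EFinM -EFinD ltry.
Qed.

Lemma Hent_pmix a mu mu' : 0 <= a <= 1 -> D mu -> D mu' ->
  Hent (pmix a mu mu') = \int[nu]_x ent ((1 - a) * dens mu x + a * dens mu' x).
Proof.
move=> a01 Dmu Dmu'.
have := entropy_dens (D_pmix a01 Dmu Dmu').
rewrite (entropy_of_density (pmix_density a01 Dmu Dmu') (rint_ent_pmix a01 Dmu Dmu')).
by case.
Qed.

Lemma Fr_pmix a mu mu' : 0 <= a <= 1 -> D mu -> D mu' ->
  Fr (pmix a mu mu') <= (1 - a) * Fr mu + a * Fr mu'.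
Proof.
move=> a01 Dmu Dmu'; have := hF_convex mu mu' a01.
by rewrite (F_fine Dmu) (F_fine Dmu') (F_fine (D_pmix a01 Dmu Dmu')) -!EFinM -EFinD lee_fin.
Qed.

Lemma Psi_pmix t a mu mu' : 0 <= a <= 1 ->
  Psi t (pmix a mu mu') <= (1 - a) * Psi t mu + a * Psi t mu'.
Proof. by move=> a01; have := hPsi_convex t mu mu' a01; rewrite -!EFinM -EFinD lee_fin. Qed.

Lemma pmix_rint a mu mu' (u : Borel E -> R) : 0 <= a <= 1 -> D mu -> D mu' ->
  rint mu u -> rint mu' u -> rint (pmix a mu mu') u /\
  \int[pmix a mu mu']_x u x = (1 - a) * \int[mu]_x u x + a * \int[mu']_x u x.
Proof.
move=> a01 Dmu Dmu' iu iu'.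
apply: (mixture_rint (densP Dmu) (densP Dmu') (pmix_density a01 Dmu Dmu') _ iu iu').
exact: aeW.
Qed.

Lemma measurable_zeta s : measurable_fun [set: Borel E] (zeta s : Borel E -> R).
Proof. by apply: continuous_Borel_measurable; have [] := @hzeta s. Qed.

Lemma rint_zeta mu s : rint mu (zeta s : Borel E -> R).
Proof.
have [_ [C _ hC]] := @hzeta s; exact: rint_moment_bound (@measurable_zeta s) hC.
Qed.

Lemma AzetaP mu : Azeta zeta mu <-> forall s, \int[mu]_x zeta s x = 0.
Proof.
split=> h s; first by rewrite /Rintegral h.
by rewrite (rintegralE (rint_zeta mu s)) h.
Qed.

Lemma Azeta_pmix a mu mu' : 0 <= a <= 1 -> D mu -> D mu' ->
  Azeta zeta mu -> Azeta zeta mu' -> Azeta zeta (pmix a mu mu').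
Proof.
move=> a01 Dmu Dmu' /AzetaP z /AzetaP z'; apply/AzetaP => s.
have [_ ->] := pmix_rint a01 Dmu Dmu' (rint_zeta mu s) (rint_zeta mu' s).
by rewrite z z' !mulr0 addr0.
Qed.

Lemma feasible_pmix eps a mu mu' : 0 <= a <= 1 ->
  feasible nu F zeta Psi eps mu -> feasible nu F zeta Psi eps mu' ->
  feasible nu F zeta Psi eps (pmix a mu mu').
Proof.
move=> a01 [Dmu [zmu pmu]] [Dmu' [zmu' pmu']].
split; [exact: D_pmix|split; [exact: Azeta_pmix|]] => t.
apply: (le_trans (Psi_pmix t mu mu' a01)).
have /andP[a0 a1] := a01; have := pmu t; have := pmu' t.
have : 0 <= 1 - a by rewrite subr_ge0.
nra.
Qed.

Lemma feasible_le eps eps' mu : eps <= eps' ->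
  feasible nu F zeta Psi eps mu -> feasible nu F zeta Psi eps' mu.
Proof.
by move=> ee' [Dmu [zmu pmu]]; split => //; split => // t; exact: le_trans (pmu t) ee'.
Qed.

(** [ent_gap] integrated: two densities have total integral 2, and convexity of [F] at the midpoint
    allows [Fr] to be added to the gap, which becomes that of the full objective. *)
Lemma dens_gap (s : R) mu mu' : 0 < s -> D mu -> D mu' ->
  \int[nu]_x `|dens mu x - dens mu' x| <=
  ((Hent mu + Fr mu) + (Hent mu' + Fr mu') -
    2 * (Hent (pmix 2^-1 mu mu') + Fr (pmix 2^-1 mu mu'))) / s + s * 2.
Proof.
move=> s0 Dmu Dmu'.
have h01 : 0 <= (2^-1 : R) <= 1 by apply/andP; split; lra.
have [mf f0 _] := densP Dmu; have [mf' f'0 _] := densP Dmu'.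
have ef := rint_ent_dens Dmu; have ef' := rint_ent_dens Dmu'.
have em := rint_ent_pmix h01 Dmu Dmu'.
have i1 := density_integrable (densP Dmu); have i2 := density_integrable (densP Dmu').
apply: (@le_trans _ _ ((Hent mu + Hent mu' - 2 * Hent (pmix 2^-1 mu mu')) / s + s * 2)); last first.
  rewrite lerD2r ler_pM2r ?invr_gt0//.
  by have := Fr_pmix h01 Dmu Dmu'; lra.
rewrite Hent_pmix// /Hent.
have e1 : rint nu (fun x => s^-1 * (ent (dens mu x) + ent (dens mu' x) -
    2 * ent ((1 - 2^-1) * dens mu x + 2^-1 * dens mu' x))).
  by apply: rintZ; apply: rintB; [exact: rintD|exact: rintZ].
have e2 : rint nu (fun x => s * (dens mu x + dens mu' x)) by apply: rintZ; exact: rintD.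
apply: (@le_trans _ _ (\int[nu]_x (s^-1 * (ent (dens mu x) + ent (dens mu' x) -
    2 * ent ((1 - 2^-1) * dens mu x + 2^-1 * dens mu' x)) + s * (dens mu x + dens mu' x)))).
  apply: le_rint; [exact/rint_abs/rintB|exact: rintD|].
  move=> x; have := ent_gap s0 (f0 x) (f'0 x).
  rewrite (_ : (dens mu x + dens mu' x) / 2 = (1 - 2^-1) * dens mu x + 2^-1 * dens mu' x); last by field.
  by rewrite [_ / s]mulrC.
have i3 := rintD ef ef'; have i4 := rintZ 2 em.
rewrite (RintD e1 e2) (RintZ _ (rintB i3 i4)) (RintB i3 i4) (RintD ef ef').
rewrite (RintZ _ em) (RintZ _ (rintD i1 i2)) (RintD i1 i2).
rewrite (Rintegral_density1 (densP Dmu)) (Rintegral_density1 (densP Dmu')).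
rewrite [_ / s]mulrC (_ : 1 + 1 = 2 :> R)//.
Qed.

Lemma Pphi_of_density (f : Borel E -> R) : measurable_fun setT f ->
  (forall x, 0 <= f x) -> \int[nu]_x f x = 1 -> rint nu (fun x => ent (f x)) ->
  exists mu : Pphi phi, has_density mu nu f.
Proof.
move=> mf f0 f1 ief.
have i_f := rint_ent_density_fun mf f0 ief.
have [|P PE] := @probability_of_density _ _ _ nu f mf f0.
  by rewrite (rintegralE i_f) f1.
have iphi : (\int[P]_x (phi x)%:E < +oo)%E.
  rewrite (integral_density PE); last exact: measurable_moment.
  apply: rint_lty; apply: rint_moment_ent => //; first exact: measurable_moment.
  exact: moment_ge0.
by exists (exist _ P iphi).
Qed.

Lemma Rintegral_dens_cvg (u : Borel E -> R) (C : R) (mu_ : nat -> Pphi phi) mu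
    (f_ : nat -> Borel E -> R) (f : Borel E -> R) :
  measurable_fun setT u -> (forall x, `|u x| <= C * (1 + phi x)) ->
  (forall n, has_density (mu_ n) nu (f_ n)) -> has_density mu nu f ->
  (forall n, rint nu (fun x => ent (f_ n x))) -> rint nu (fun x => ent (f x)) ->
  (forall e : R, 0 < e ->
    \forall n \near \oo, \int[nu]_x ((1 + phi x) * `|f_ n x - f x|) <= e) ->
  \int[mu_ n]_x u x @[n --> \oo] --> \int[mu]_x u x.
Proof.
move=> mu0 uC df_ df ief_ ief cf.
have C0 : 0 <= C.
  have := le_trans (normr_ge0 _) (uC point); rewrite pmulr_lge0//.
  by rewrite ltr_pwDl// moment_ge0.
have iu : rint nu (fun x => u x * f x).
  by apply/(integrable_density df mu0); exact: rint_moment_bound uC.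
have iu_ n : rint nu (fun x => u x * f_ n x).
  by apply/(integrable_density (df_ n) mu0); exact: rint_moment_bound uC.
have mphi := @measurable_moment _ _ phi.
have imom (g : Borel E -> R) P : has_density (P : Pphi phi) nu g -> rint nu (fun x => (1 + phi x) * g x).
  move=> dg.
  have m1 : measurable_fun setT (fun x : Borel E => 1 + phi x) by exact: measurable_funD.
  by apply/(integrable_density dg m1); apply: rintD; [exact: rint_cst|exact: rint_moment].
apply/cvgrPdist_le => e e0.
have [t t0 tC] := small_mul e0 C0.
near=> n.
rewrite (Rintegral_density (df_ n) mu0) (Rintegral_density df mu0).
rewrite -RintB//.
apply: (le_trans (le_normr_Rintegral measurableT (rintB iu (iu_ n)))).
have [mf f0 _] := df; have [mfn fn0 _] := df_ n.
have i1 : rint nu (fun x => (1 + phi x) * `|f_ n x - f x|).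
  apply: (rint_le _ _ (rintD (imom _ _ (df_ n)) (imom _ _ df))).
    apply: measurable_funM; first exact: measurable_funD.
    by apply: measurableT_comp => //; exact: measurable_funB.
  move=> x; have p0 := @moment_ge0 _ _ phi x.
  rewrite ger0_norm ?mulr_ge0 ?addr_ge0// -mulrDr ler_wpM2l ?addr_ge0//.
  by rewrite (le_trans (ler_normB _ _))// !ger0_norm.
apply: (@le_trans _ _ (\int[nu]_x (C * ((1 + phi x) * `|f_ n x - f x|)))).
  apply: le_rint; [exact/rint_abs/rintB|exact: rintZ|].
  by move=> x; rewrite -mulrBr normrM distrC mulrA ler_wpM2r.
rewrite RintZ// (le_trans _ tC)// mulrC ler_wpM2r//.
by near: n; exact: cf.
Unshelve. all: by end_near. Qed.

Definition Ir mu : R := Hent mu + Fr mu.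

Definition minimises eps mu := feasible nu F zeta Psi eps mu /\
  forall mu', feasible nu F zeta Psi eps mu' -> Ir mu <= Ir mu'.

Lemma minimises_value eps mu : minimises eps mu ->
  value nu F zeta Psi eps = (Ir mu)%:E.
Proof.
move=> [fmu mmu]; apply/eqP; rewrite eq_le; apply/andP; split.
  by apply: ereal_inf_lbound; exists mu => //; rewrite rate_fine//; exact: fmu.1.
apply: le_ereal_inf_tmp => _ [mu' fmu' <-].
by rewrite rate_fine ?lee_fin; [exact: mmu|exact: fmu'.1].
Qed.

Lemma is_minimiserP eps mu : is_minimiser nu F zeta Psi eps mu <-> minimises eps mu.
Proof.
split=> [[fmu rmu]|mmu].
  split=> // mu' fmu'; rewrite -lee_fin -(rate_fine fmu.1) -(rate_fine fmu'.1) rmu.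
  by apply: ereal_inf_lbound; exists mu'.
split; first exact: mmu.1.
by rewrite (minimises_value mmu) (rate_fine mmu.1.1).
Qed.

(** The midpoint is feasible, so its objective is at least [m]; near-minimisers are therefore close
    in L1. *)
Lemma feasible_gap eps (s m : R) mu mu' : 0 < s ->
  (forall mu, feasible nu F zeta Psi eps mu -> m <= Ir mu) ->
  feasible nu F zeta Psi eps mu -> feasible nu F zeta Psi eps mu' ->
  \int[nu]_x `|dens mu x - dens mu' x| <= ((Ir mu - m) + (Ir mu' - m)) / s + s * 2.
Proof.
move=> s0 mI fmu fmu'; apply: (le_trans (dens_gap s0 fmu.1 fmu'.1)).
rewrite lerD2r ler_pM2r ?invr_gt0//.
have h01 : 0 <= (2^-1 : R) <= 1 by apply/andP; split; lra.
have := mI _ (feasible_pmix h01 fmu fmu'); rewrite /Ir; lra.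
Qed.

(** Both excesses over the minimum vanish, so the L1 distance of the densities is at most [2 s] for
    every [s > 0]. *)
Lemma minimises_unique eps mu mu' : minimises eps mu -> minimises eps mu' ->
  forall A : set (Borel E), measurable A -> mu A = mu' A.
Proof.
move=> [fmu mmu] [fmu' mmu'] A mA.
have e : Ir mu' = Ir mu by apply/eqP; rewrite eq_le mmu// mmu'.
have dmu := densP fmu.1; have dmu' := densP fmu'.1.
have i1 := density_integrable dmu; have i2 := density_integrable dmu'.
have z : \int[nu]_x `|dens mu x - dens mu' x| = 0.
  apply/eqP; rewrite eq_le; apply/andP; split; last exact: Rintegral_ge0.
  apply: (@le0_of_small _ _ 2) => s s0 _.
  have := feasible_gap s0 mmu fmu fmu'; rewrite e subrr addr0 mul0r add0r; exact.
have iabs := rint_abs (rintB i1 i2).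
have ae0 := Rintegral_eq0_ae iabs (fun x => normr_ge0 _) z.
have [mf f0 ->//] := dmu; have [mf' f'0 ->//] := dmu'.
apply: ae_eq_integral => //.
- by apply/measurable_EFinP; exact: measurable_funTS.
- by apply/measurable_EFinP; exact: measurable_funTS.
by apply: filterS ae0 => x /eqP; rewrite normr_eq0 subr_eq0 => /eqP -> _.
Qed.

Hypotheses (hI_lsc : lower_semicontinuous (rate nu F))
  (hPsi_lsc : forall t, lower_semicontinuous (fun mu => (Psi t mu)%:E))
  (hF_bounded : exists m : R, forall mu, (m%:E <= F mu)%E).

Lemma exists_minimises eps : (exists mu, feasible nu F zeta Psi eps mu) ->
  exists mu, minimises eps mu.
Proof.
move=> [mu0 fmu0]; have [b hb] := hF_bounded.
have FrB mu : D mu -> b <= Fr mu by move=> Dmu; rewrite -lee_fin -F_fine.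
pose V := [set Ir mu | mu in feasible nu F zeta Psi eps].
have hV : has_inf V.
  split; first by exists (Ir mu0), mu0.
  exists b => _ [mu fmu <-]; rewrite /Ir.
  by have := Hent_ge0 fmu.1; have := FrB _ fmu.1; lra.
pose m := inf V.
have mI mu : feasible nu F zeta Psi eps mu -> m <= Ir mu.
  by move=> fmu; apply: ge_inf; [exact: hV.2|exists mu].
have [e_ e_E] : exists e_ : nat -> R, forall n, e_ n = n.+1%:R^-1 by exists (fun n => n.+1%:R^-1).
have n0 n : 0 < e_ n by rewrite e_E invr_gt0.
have e_le n p : (n <= p)%N -> e_ p <= e_ n.
  by move=> np; rewrite !e_E lef_pV2 ?posrE ?ltr0n// ler_nat.
have e_small (e : R) : 0 < e -> \forall n \near \oo, e_ n < e.
  move=> e0; near=> n; rewrite e_E.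
  by near: n; exact: (near_infty_natSinv_lt (PosNum e0)).
have hn n : exists mu, feasible nu F zeta Psi eps mu /\ Ir mu < m + e_ n.
  by have [_ [mu fmu <-] h] := inf_adherent (n0 n) hV; exists mu.
have [mu_ mu_P] := choice hn.
have fmu n := (mu_P n).1; have Imu n := (mu_P n).2.
have Dmu n := (fmu n).1.
pose f_ n := dens (mu_ n).
have df n : has_density (mu_ n) nu (f_ n) := densP (Dmu n).
have mf n : measurable_fun setT (f_ n) by have [] := df n.
have f0 n x : 0 <= f_ n x by have [_ ->] := df n.
have i_f n := density_integrable (df n).
have ief n := rint_ent_dens (Dmu n).
(* The lower bound [b] on [F] converts a bounded objective into bounded entropy, as uniform
   integrability of [phi] requires. *)
have HC n : Hent (mu_ n) <= m + e_ 0%N - b.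
  have := Imu n; have := e_le _ _ (leq0n n); have := FrB _ (Dmu n); rewrite /Ir; lra.
have cauchy (e : R) : 0 < e -> exists N : nat, forall n p : nat, (N <= n)%N -> (N <= p)%N ->
    (\int[nu]_x `|f_ n x - f_ p x|%:E <= e%:E)%E.
  move=> e_gt0.
  (* [feasible_gap] is used with [s = e / 4]: the excesses divided by [s] contribute at most
     [e / 2], and [s * 2] is the other half. *)
  have [N _ /(_ _ (leqnn N)) hN] := e_small (e / 4 * (e / 4)) (mulr_gt0 (divr_gt0 e_gt0 (ltr0Sn _ _)) (divr_gt0 e_gt0 (ltr0Sn _ _))).
  exists N => n p Nn Np.
  rewrite (rintegralE (rint_abs (rintB (i_f n) (i_f p)))).
  rewrite lee_fin.
  have e4 : 0 < e / 4 by rewrite divr_gt0.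
  apply: (le_trans (feasible_gap e4 mI (fmu n) (fmu p))).
  suff : (Ir (mu_ n) - m + (Ir (mu_ p) - m)) / (e / 4) <= e / 4 + e / 4 by lra.
  rewrite ler_pdivrMr//.
  have := e_le _ _ Nn; have := e_le _ _ Np; have := Imu n; have := Imu p.
  move: hN; rewrite mulrDl; set q := e / 4 * (e / 4); lra.
have [s [g [sn mg cvg_g L1g]]] := L1_cauchy_subsequence mf cauchy.
(* The limit is nonnegative only almost everywhere, whereas a density must be so at every point. *)
pose f x := Num.max (g x) 0.
have mfl : measurable_fun setT f by exact: measurable_maxr.
have fl0 x : 0 <= f x by rewrite /f le_max lexx orbT.
have fg : {ae nu, forall x, f x = g x}.
  apply: filterS cvg_g => x cx; rewrite /f; apply/max_idPl.
  by apply: (cvgr_to_ge cx); exact: nearW.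
have cvf : {ae nu, forall x, f_ (s n) x @[n --> \oo] --> f x}.
  by apply: filterS2 fg cvg_g => x ->.
have iefl0 : (\int[nu]_x (ent (f x))%:E <= (m + e_ 0%N - b)%:E)%E.
  apply: (@fatou_le _ _ _ _ (fun n x => ent (f_ (s n) x))).
  - by move=> n; exact: rint_measurable (ief (s n)).
  - by apply/measurable_EFinP; apply: measurableT_comp => //; exact: measurable_ent.
  - by move=> n x; exact: ent_ge0.
  - apply: filterS cvf => x cx; apply: cvg_EFin; first exact: nearW.
    by apply: (continuous_cvg _ _ cx); exact: ent_continuous (fl0 x).
  - by apply: nearW => n; rewrite (rintegralE (ief (s n))) lee_fin; exact: HC.
have iefl : rint nu (fun x => ent (f x)).
  apply: rint_ge0; [|by move=> x; exact: ent_ge0|exact: le_lt_trans iefl0 (ltry _)].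
  by apply: measurableT_comp => //; exact: measurable_ent.
have HfC : \int[nu]_x ent (f x) <= m + e_ 0%N - b by rewrite -lee_fin -rintegralE.
have ifl := rint_ent_density_fun mfl fl0 iefl.
have L1f (e : R) : 0 < e -> \forall n \near \oo, \int[nu]_x `|f_ (s n) x - f x| <= e.
  move=> e_gt0; apply: filterS (L1g _ e_gt0) => n.
  rewrite -lee_fin -(rintegralE (rint_abs (rintB (i_f (s n)) ifl))); apply: le_trans.
  rewrite le_eqVlt; apply/orP; left; apply/eqP; apply: ae_eq_integral => //.
  - by apply/measurable_EFinP; apply: measurableT_comp => //; exact: measurable_funB.
  - by apply/measurable_EFinP; apply: measurableT_comp => //; exact: measurable_funB.
  - by apply: filterS fg => x ->.
have f1 : \int[nu]_x f x = 1.
  apply/eqP; rewrite -subr_eq0 -normr_le0; apply: (@le0_of_small _ _ 1) => e e_gt0 _.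
  have [N _ /(_ _ (leqnn N)) hN] := L1f _ e_gt0.
  rewrite mulr1 -(Rintegral_density1 (df (s N))) distrC -(RintB (i_f (s N)) ifl).
  by apply: le_trans hN; apply: le_normr_Rintegral => //; exact: (rintB (i_f (s N)) ifl).
have [mu dmu] := Pphi_of_density mfl fl0 f1 iefl.
have momcv := @moment_L1_cvg _ _ _ nu phi (@measurable_moment _ _ phi) (@moment_ge0 _ _ phi) hnu
  (m + e_ 0%N - b) (fun n => f_ (s n)) f _ _ L1f.
have {}momcv : forall e : R, 0 < e ->
    \forall n \near \oo, \int[nu]_x ((1 + phi x) * `|f_ (s n) x - f x|) <= e.
  apply: momcv; last by split.
  by move=> n; split; [exact: mf|exact: f0|exact: ief|exact: HC].
(* Convergence in L1 weighted by [1 + phi] handles at once [phi], bounded continuous functions and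
   the [zeta s]. *)
have cvI (u : Borel E -> R) C : measurable_fun setT u -> (forall x, `|u x| <= C * (1 + phi x)) ->
    \int[mu_ (s n)]_x u x @[n --> \oo] --> \int[mu]_x u x.
  move=> mu' uC; apply: (Rintegral_dens_cvg mu' uC (fun n => df (s n)) dmu) => //.
  by move=> n; exact: ief.
have cvmu : (mu_ \o s) @ \oo --> mu.
  apply/Pphi_cvgP; split.
    apply: (cvI _ 1 (@measurable_moment _ _ phi)) => x.
    by rewrite mul1r ger0_norm ?moment_ge0// lerDr.
  move=> u cu [B [_ hB]].
  apply: (cvI _ (`|B| + 1)); first exact: continuous_Borel_measurable.
  move=> x; apply: (@le_trans _ _ (`|B| + 1)).
    by apply: hB => //; apply: le_lt_trans (ler_norm B) _; rewrite ltrDl.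
  by rewrite ler_peMr ?addr_ge0// lerDl moment_ge0.
have entmu : (entropy mu nu < +oo)%E.
  by rewrite (entropy_of_density dmu iefl) ltry.
have rmu : (rate nu F mu <= m%:E)%E.
  rewrite leNgt; apply/negP => mr.
  (* A level [a] strictly between [m] and the value at the limit would persist on a neighbourhood,
     against [Ir (mu_ (s n)) < m + e_ (s n)]. *)
  have [a ma ar] : exists2 a, m < a & (a%:E < rate nu F mu)%E.
    case: (rate nu F mu) mr => [r|_|//]; last by exists (m + 1); rewrite ?ltry// ltrDl.
    by rewrite lte_fin => mr; exists ((m + r) / 2); rewrite ?lte_fin; lra.
  have [U nU hU] := hI_lsc ar.
  have am : 0 < a - m by rewrite subr_gt0.
  have : \forall n \near \oo, False.
    near=> n.
    have : (a%:E < rate nu F (mu_ (s n)))%E by apply: hU; near: n; exact: cvmu.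
    rewrite (rate_fine (Dmu (s n))) lte_fin -/(Ir _).
    have := Imu (s n); have := e_le _ _ (sn n).
    have : e_ n < a - m by near: n; exact: e_small.
    lra.
  by move=> [N _ /(_ _ (leqnn N))].
have Dmubar : D mu.
  split => //; have := le_lt_trans rmu (ltry m).
  rewrite /rate (entropy_of_density dmu iefl).
  by case: (F mu) (hF_gtNy mu) => [r _ _||]//; rewrite ltry.
have fmubar : feasible nu F zeta Psi eps mu.
  split => //; split.
    apply/AzetaP => sg.
    have [_ [C _ hC]] := @hzeta sg.
    have cz := cvI _ _ (@measurable_zeta sg) hC.
    rewrite -(cvg_lim (@Rhausdorff R) cz); apply: cvg_lim => //.
    rewrite (_ : (fun n => _) = fun=> 0); first exact: cvg_cst.
    by apply/funext => n; move/AzetaP : (fmu (s n)).2.1; apply.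
  move=> t; rewrite leNgt; apply/negP => et.
  have [|U nU hU] := @hPsi_lsc t mu eps; first by rewrite lte_fin.
  have : \forall n \near \oo, False.
    near=> n.
    have : (eps%:E < (Psi t (mu_ (s n)))%:E)%E by apply: hU; near: n; exact: cvmu.
    by rewrite lte_fin ltNge (fmu (s n)).2.2.
  by move=> [N _ /(_ _ (leqnn N))].
exists mu; split => // mu' fmu'; apply: le_trans (mI _ fmu').
by rewrite -lee_fin -(rate_fine Dmubar).
Unshelve. all: by end_near. Qed.

(** * Differentiability of the functionals and the Slater point *)

Variable epsstar : R.
Hypothesis hepsstar : 0 < epsstar.
Variables (dF : Pphi phi -> E -> R) (dPsi : T -> Pphi phi -> E -> R).
Hypothesis hT : compact [set: T].
Hypotheses (hF_diff : forall mubar, feasible nu F zeta Psi epsstar mubar ->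
    convex_subset (rate_dom nu F) /\
    is_lfderiv (rate_dom nu F) (fun mu => fine (F mu)) mubar (dF mubar))
  (hPsi_diff : forall mubar, feasible nu F zeta Psi epsstar mubar ->
    [/\ continuous (fun t : T => Psi t mubar),
        (forall t, is_lfderiv [set: Pphi phi] (Psi t) mubar (dPsi t mubar)),
        (forall mu : Pphi phi,
          ereal_sup (range (fun t : T =>
            (`| e^-1 * (Psi t (pmix e mubar mu) - Psi t mubar)
                - ((\int[mu]_x dPsi t mubar x)
                   - (\int[mubar]_x dPsi t mubar x)) |)%:E))
          @[e --> 0^'+] --> 0%E),
        (forall x : E, continuous (fun t : T => dPsi t mubar x)) &
        exists2 D : R, 0 <= D &
          forall x : E, (ereal_sup (range (fun t : T => `|dPsi t mubar x|%:E))
                          <= (D * (1 + phi x))%:E)%E]).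

Lemma dF_measurable mubar : feasible nu F zeta Psi epsstar mubar ->
  measurable_fun [set: Borel E] (dF mubar : Borel E -> R).
Proof. by move=> /hF_diff[_ []]. Qed.

Lemma dF_rint mubar mu : feasible nu F zeta Psi epsstar mubar -> D mu ->
  rint mu (dF mubar : Borel E -> R).
Proof. by move=> /hF_diff[_ [_ _ _ h _]] Dmu; have [] := h _ Dmu. Qed.

Lemma dF_int0 mubar : feasible nu F zeta Psi epsstar mubar ->
  \int[mubar]_x dF mubar x = 0.
Proof. by move=> /hF_diff[_ []]. Qed.

Lemma dF_cvg mubar mu : feasible nu F zeta Psi epsstar mubar -> D mu ->
  e^-1 * (Fr (pmix e mubar mu) - Fr mubar) @[e --> 0^'+] --> \int[mu]_x dF mubar x.
Proof.
move=> fmubar Dmu; have := dF_int0 fmubar.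
by have [_ [_ _ _ h _]] := hF_diff fmubar => h0; have [_] := h _ Dmu; rewrite h0 subr0.
Qed.

(** Convexity bounds every difference quotient by the full increment, and the bound survives the
    limit. *)
Lemma dF_tangent mubar mu : feasible nu F zeta Psi epsstar mubar -> D mu ->
  \int[mu]_x dF mubar x <= Fr mu - Fr mubar.
Proof.
move=> fmubar Dmu; apply: (cvg_right_le ltr01 _ (dF_cvg fmubar Dmu)) => e e0 e1.
have e01 : 0 <= e <= 1 by rewrite !ltW.
rewrite ler_pdivrMl//; have := Fr_pmix e01 fmubar.1 Dmu; lra.
Qed.

Lemma dPsi_measurable t mubar : feasible nu F zeta Psi epsstar mubar ->
  measurable_fun [set: Borel E] (dPsi t mubar : Borel E -> R).
Proof. by move=> /hPsi_diff[_ /(_ t)[]]. Qed.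

Lemma dPsi_continuous x mubar : feasible nu F zeta Psi epsstar mubar ->
  continuous (fun t : T => dPsi t mubar x).
Proof. by move=> /hPsi_diff[_ _ _ h _]; exact: h. Qed.

Lemma dPsi_bound mubar : feasible nu F zeta Psi epsstar mubar ->
  exists2 C : R, 0 <= C & forall t x, `|dPsi t mubar x| <= C * (1 + phi x).
Proof.
move=> /hPsi_diff[_ _ _ _ [C C0 hC]]; exists C => // t x.
rewrite -lee_fin; apply: le_trans (hC x).
by apply: ereal_sup_ubound; exists t.
Qed.

Lemma dPsi_rint t mubar mu : feasible nu F zeta Psi epsstar mubar ->
  rint mu (dPsi t mubar : Borel E -> R).
Proof.
move=> fmubar; have [C _ hC] := dPsi_bound fmubar.
exact: rint_moment_bound (dPsi_measurable t fmubar) (hC t).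
Qed.

Lemma dPsi_int0 t mubar : feasible nu F zeta Psi epsstar mubar ->
  \int[mubar]_x dPsi t mubar x = 0.
Proof. by move=> /hPsi_diff[_ /(_ t)[]]. Qed.

Lemma dPsi_tangent t mubar mu : feasible nu F zeta Psi epsstar mubar ->
  \int[mu]_x dPsi t mubar x <= Psi t mu - Psi t mubar.
Proof.
move=> fmubar; have h0 := dPsi_int0 t fmubar.
have [_ /(_ t)[_ _ _ /(_ mu I)[_ h] _] _ _ _] := hPsi_diff fmubar.
rewrite h0 subr0 in h; apply: (cvg_right_le ltr01 _ h) => e e0 e1.
have e01 : 0 <= e <= 1 by rewrite !ltW.
rewrite ler_pdivrMl//; have := Psi_pmix t mubar mu e01; lra.
Qed.

(** One step length [d] serves all constraints, because differentiability is assumed uniformly in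
    [t]. *)
Lemma dPsi_expansion mubar mu (eta : R) : 0 < eta ->
  feasible nu F zeta Psi epsstar mubar ->
  exists2 d : R, 0 < d & forall e t, 0 < e -> e < d ->
    Psi t (pmix e mubar mu) <= Psi t mubar + e * (\int[mu]_x dPsi t mubar x + eta).
Proof.
move=> eta0 fmubar; have [_ _ /(_ mu) h _ _] := hPsi_diff fmubar.
have := h [set r | (r < eta%:E)%E].
case.
  by apply: open_nbhs_nbhs; split; [exact: open_ereal_lt_ereal|rewrite /= lte_fin].
move=> d /= d0 hd; exists d => // e t e0 ed.
have := hd e; rewrite /ball/= sub0r normrN gtr0_norm// => /(_ ed e0) sup_lt.
have := le_lt_trans (ereal_sup_ubound _) sup_lt.
move=> /(_ _ (ex_intro2 _ _ t I erefl)); rewrite lte_fin dPsi_int0// subr0.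
move=> /ltW/(le_trans (ler_norm _)).
by rewrite lerBlDr ler_pdivrMl// addrC; lra.
Qed.

Lemma dPsi_int_bound mubar mu : feasible nu F zeta Psi epsstar mubar ->
  exists B : R, forall t, `|\int[mu]_x dPsi t mubar x| <= B.
Proof.
move=> fmubar; have [C _ hC] := dPsi_bound fmubar.
exists (\int[mu]_x (C * (1 + phi x))) => t.
apply: (le_trans (le_normr_Rintegral measurableT (dPsi_rint t mu fmubar))).
apply: le_rint; [exact/rint_abs/dPsi_rint| |exact: hC].
by apply: rintZ; apply: rintD; [exact: rint_cst|exact: rint_moment].
Qed.

Lemma dPsi_int_continuous mubar mu : feasible nu F zeta Psi epsstar mubar ->
  continuous (fun t : T => \int[mu]_x dPsi t mubar x).
Proof.
move=> fmubar; have [C _ hC] := dPsi_bound fmubar.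
pose G (x : Borel E) : R := C * (1 + phi x).
have iG : rint mu G by apply: rintZ; apply: rintD; [exact: rint_cst|exact: rint_moment].
exact: (kernel_continuous (fun t => dPsi_measurable t fmubar)
  (fun x => dPsi_continuous (x := x) fmubar) hC iG).
Qed.

Lemma dPsi_kernel mubar mu (lam : {finite_measure set (Borel T) -> \bar R}) :
  feasible nu F zeta Psi epsstar mubar ->
  rint mu (fun x => \int[lam]_t dPsi t mubar x) /\
  \int[mu]_x (\int[lam]_t dPsi t mubar x) = \int[lam]_t (\int[mu]_x dPsi t mubar x).
Proof.
move=> fmubar; have [C _ hC] := dPsi_bound fmubar.
pose G (x : Borel E) : R := C * (1 + phi x).
have iG : rint mu G by apply: rintZ; apply: rintD; [exact: rint_cst|exact: rint_moment].
have mps t := dPsi_measurable t fmubar.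
have cps x := dPsi_continuous (x := x) fmubar.
split.
- exact: (kernel_integral_rint hT mps cps hC iG lam).
- exact: (kernel_fubini hT mps cps hC iG lam).
Qed.

Variable mut : Pphi phi.
Hypotheses (Dmut : D mut) (zmut : Azeta zeta mut) (pmut : forall t, Psi t mut < 0).

Lemma feasible_mut eps : 0 <= eps -> feasible nu F zeta Psi eps mut.
Proof.
move=> e0; split => //; split => // t; exact: le_trans (ltW (pmut t)) e0.
Qed.

Lemma slater_margin : exists2 c : R, 0 < c & forall t, Psi t mut <= - c.
Proof.
have [cP _ _ _ _] := hPsi_diff (feasible_mut (ltW hepsstar)).
have [|t|c c0 hc] := @compact_positive_bound _ _ (fun t => - Psi t mut) hT.
- by move=> t; apply: cvgN; exact: cP.
- by rewrite oppr_gt0.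
by exists c => // t; rewrite lerNr.
Qed.

(** The margin [c] of the Slater point absorbs the first-order change [k * (B + 1)]. Any domain
    measure satisfying the equality constraints thus enters a feasible measure with positive weight,
    and inherits what feasible directions reveal. *)
Lemma slater_mix mu : D mu -> Azeta zeta mu ->
  exists k : R, [/\ 0 < k, k < 1 & feasible nu F zeta Psi 0 (pmix k mut mu)].
Proof.
move=> Dmu zmu; have fmut := feasible_mut (ltW hepsstar).
have [c c0 hc] := slater_margin.
have [d d0 hd] := dPsi_expansion mu ltr01 fmut.
have [B hB] := dPsi_int_bound mu fmut.
have B0 : 0 <= B by exact: le_trans (hB point).
have [r r0 hr] := small_mul c0 (addr_ge0 B0 ler01).
pose k := Num.min (1 / 2) (Num.min (d / 2) r).
have k0 : 0 < k by rewrite !lt_min r0 !divr_gt0.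
have k1 : k < 1 by rewrite gt_min; apply/orP; left; lra.
have kd : k < d by rewrite !gt_min; apply/orP; right; apply/orP; left; lra.
have kr : k <= r by rewrite !ge_min lexx !orbT.
have k01 : 0 <= k <= 1 by rewrite !ltW.
exists k; split => //; split; first exact: D_pmix.
split; first exact: Azeta_pmix.
move=> t; apply: (le_trans (hd k t k0 kd)).
have h1 : \int[mu]_x dPsi t mut x <= B by apply: le_trans (ler_norm _) (hB t).
have h2 : k * (B + 1) <= c by apply: le_trans hr; rewrite ler_wpM2r// addr_ge0.
have h3 : k * (\int[mu]_x dPsi t mut x + 1) <= k * (B + 1) by rewrite ler_pM2l// lerD2r.
by have := hc t; lra.
Qed.

Lemma density_unique (P : probability (Borel E) R) (f f' : Borel E -> R) :
  has_density P nu f -> has_density P nu f' -> {ae nu, forall x, f x = f' x}.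
Proof.
move=> /density_charge_RN h /density_charge_RN h'.
by apply: filterS2 h h' => x /(_ I) -> /(_ I) [].
Qed.

(** * First-order conditions at a minimiser *)

Section at_minimiser.
Variables (eps : R) (mubar : Pphi phi).
Hypotheses (eps0 : 0 <= eps) (epsle : eps <= epsstar) (mmubar : minimises eps mubar).

Let f := dens mubar.

Lemma feasible_mubar : feasible nu F zeta Psi epsstar mubar.
Proof. exact: feasible_le epsle mmubar.1. Qed.

Let Dmubar : D mubar. Proof. exact: mmubar.1.1. Qed.

Let fmubar := feasible_mubar.

Lemma measurable_ln_dens : measurable_fun setT (fun x => ln (f x)).
Proof. have [mf _ _] := densP Dmubar; exact: measurableT_comp. Qed.

Lemma rint_ln_dens_mubar : rint nu (fun x => ln (f x) * f x).
Proof. exact/(rint_ent_density (densP Dmubar))/rint_ent_dens. Qed.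

(** Minimality bounds the entropy quotient below by minus the quotient of [F], which is what
    [entropy_derivative] asks for. *)
Lemma direction_entropy w (d c : R) : D w -> 0 < d ->
  (forall t, 0 < t -> t < d -> t <= 1 -> feasible nu F zeta Psi eps (pmix t mubar w)) ->
  (forall t, 0 < t -> t < d -> t <= 1 -> c <= - (t^-1 * (Fr (pmix t mubar w) - Fr mubar))) ->
  [/\ {ae nu, forall x, f x = 0 -> dens w x = 0},
      rint nu (fun x => (dens w x - f x) * ln (f x)) &
      c <= \int[nu]_x ((dens w x - f x) * ln (f x))].
Proof.
move=> Dw d0 hfeas hc.
have [mf f0 _] := densP Dmubar; have [mw w0 _] := densP Dw.
apply: (entropy_derivative mf mw f0 w0 (rint_ent_dens Dmubar) (rint_ent_dens Dw) d0).
move=> t t0 td t1; apply: (le_trans (hc t t0 td t1)).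
have t01 : 0 <= t <= 1 by rewrite (ltW t0).
rewrite -/(Hent mubar) -(Hent_pmix t01 Dmubar Dw) mulrC -mulNr ler_pM2r ?invr_gt0//.
by have := mmubar.2 _ (hfeas t t0 td t1); rewrite /Ir; lra.
Qed.

(* A direction charging [{f = 0}] has slope [-oo] for the entropy. *)
Lemma minimiser_dominates mu : D mu -> Azeta zeta mu ->
  {ae nu, forall x, f x = 0 -> dens mu x = 0} /\ rint mu (fun x => ln (f x)).
Proof.
move=> Dmu zmu; have [k [k0 k1 fw]] := slater_mix Dmu zmu.
have k01 : 0 <= k <= 1 by rewrite !ltW.
set w := pmix k mut mu in fw.
have Dw : D w := fw.1.
have fw' : feasible nu F zeta Psi eps w by exact: feasible_le fw.
(* By convexity the quotients of [F] are at most [Fr w - Fr mubar]. This crude [c] is enough, since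
   only domination and integrability are kept. *)
have [|t t0 _ t1|ae0 irint _] := @direction_entropy w 1 (- (Fr w - Fr mubar)) Dw ltr01.
- by move=> t t0 _ t1; apply: feasible_pmix => //; [rewrite ltW|exact: mmubar.1].
- have t01 : 0 <= t <= 1 by rewrite ltW.
  by rewrite lerN2 ler_pdivrMl//; have := Fr_pmix t01 Dmubar Dw; lra.
have wE := density_unique (densP Dw) (pmix_density k01 Dmut Dmu).
have [mmu mu0 _] := densP Dmu; have [mt t0 _] := densP Dmut.
have aeE : {ae nu, forall x, f x = 0 -> dens mu x = 0}.
  apply: filterS2 ae0 wE => x h e fx; have := h fx; rewrite e => /eqP.
  rewrite paddr_eq0 ?mulr_ge0 ?subr_ge0// 1?ltW// => /andP[_].
  by rewrite mulf_eq0 gt_eqF//= => /eqP.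
split => //.
apply/(integrable_density (densP Dmu) measurable_ln_dens).
have iw : rint nu (fun x => dens w x * ln (f x)).
  have := rintD irint rint_ln_dens_mubar; congr (rint nu _).
  by apply/funext => x; ring.
have iw' : rint nu (fun x => k^-1 * (((1 - k) * dens mut x + k * dens mu x) * ln (f x))).
  apply: rintZ; apply: ae_rint iw; last by apply: filterS wE => x ->.
  apply: measurable_funM; last exact: measurable_ln_dens.
  by apply: measurable_funD; exact: measurable_funM.
apply: (rint_le _ _ (rint_abs iw')).
  by apply: measurable_funM => //; exact: measurable_ln_dens.
move=> x; rewrite mulrA normrM mulrC [leRHS]normrM ler_wpM2r//.
(* Up to null sets [dens mu <= k^-1 * dens w], so integrability of [ln f] passes from [w] to
   [mu]. *)
have h : dens mu x <= k^-1 * ((1 - k) * dens mut x + k * dens mu x).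
  rewrite ler_pdivlMl// lerDr mulr_ge0// subr_ge0 ltW//.
by rewrite !ger0_norm//; exact: le_trans h.
Qed.

Lemma minimiser_null_dominates mu : D mu -> Azeta zeta mu -> mu `<< mubar.
Proof.
move=> Dmu zmu; have [aeE _] := minimiser_dominates Dmu zmu.
have [mf f0 fE] := densP Dmubar; have [mm m0 mE] := densP Dmu.
apply/null_content_dominatesP => A mA /(etrans (esym (fE A mA))) A0.
have mfA : measurable_fun A (fun x => (f x)%:E) by apply/measurable_EFinP; exact: measurable_funTS.
have : (\int[nu]_(x in A) `|(f x)%:E| = 0)%E.
  by under eq_integral do rewrite /= ger0_norm//.
move=> /(ae_eq_integral_abs _ mA mfA) ae0.
apply: etrans (mE A mA) _; rewrite -(@integral0 _ _ _ nu A); apply: ae_eq_integral => //.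
  by apply/measurable_EFinP; exact: measurable_funTS.
by apply: filterS2 ae0 aeE => x h1 h2 /h1 [] /h2 ->.
Qed.

(** The gradient of the objective at [mubar], up to a constant that is invisible to differences of
    probabilities. *)
Definition gfun (x : Borel E) : R := ln (f x) + dF mubar x.

Lemma measurable_gfun : measurable_fun setT gfun.
Proof. by apply: measurable_funD; [exact: measurable_ln_dens|exact: dF_measurable]. Qed.

Lemma rint_gfun w : D w -> Azeta zeta w -> rint w gfun.
Proof.
move=> Dw zw; apply: rintD; [exact: (minimiser_dominates Dw zw).2|exact: dF_rint].
Qed.

(** [F] has only a limiting slope [L]; on a short interval its quotients are at most [L + e],
    minimality gives the inequality up to [e], and [e] is arbitrary. *)
Lemma first_order_direction w (d : R) : D w -> Azeta zeta w -> 0 < d ->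
  (forall t, 0 < t -> t < d -> t <= 1 -> feasible nu F zeta Psi eps (pmix t mubar w)) ->
  \int[mubar]_x gfun x <= \int[w]_x gfun x.
Proof.
move=> Dw zw d0 hfeas.
have zmubar : Azeta zeta mubar := mmubar.1.2.1.
have [_ il] := minimiser_dominates Dw zw.
have [_ ilb] := minimiser_dominates Dmubar zmubar.
have iF := dF_rint fmubar Dw; have iFb := dF_rint fmubar Dmubar.
rewrite /gfun (RintD ilb iFb) (RintD il iF) (dF_int0 fmubar) addr0.
set L := \int[w]_x dF mubar x.
rewrite -subr_le0; apply: (@le0_of_small _ _ 1) => e e0 _; rewrite mulr1.
have : \forall t \near (0 : R)^'+, t^-1 * (Fr (pmix t mubar w) - Fr mubar) <= L + e.
  have /cvgrPdist_le/(_ e e0) := dF_cvg fmubar Dw; rewrite -/L.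
  by apply: filterS => t; rewrite ler_distlC => /andP[].
move=> /near_right_interval[d1 d10 hd1].
have [|t t0|t t0|_ irint hc] := @direction_entropy w (Num.min d d1) (- (L + e)) Dw.
- by rewrite lt_min d0.
- by rewrite lt_min => /andP[td _]; exact: hfeas.
- by rewrite lt_min => /andP[_ td] _; rewrite lerN2; exact: hd1.
have iw : rint nu (fun x => ln (f x) * dens w x).
  exact/(integrable_density (densP Dw) measurable_ln_dens).
move: hc; rewrite (_ : (fun x => _) = (fun x => ln (f x) * dens w x - ln (f x) * f x)); last first.
  by apply/funext => x; ring.
rewrite (RintB iw rint_ln_dens_mubar).
rewrite -(Rintegral_density (densP Dw) measurable_ln_dens).
rewrite -(Rintegral_density (densP Dmubar) measurable_ln_dens).
lra.
Qed.

(* Mixing [w] with the Slater point makes the slopes of the active constraints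
   negative, so that short steps towards the mixture are feasible. *)
Lemma first_order w : D w -> Azeta zeta w ->
  (forall t, Psi t mubar = eps -> \int[w]_x dPsi t mubar x <= 0) ->
  \int[mubar]_x gfun x <= \int[w]_x gfun x.
Proof.
move=> Dw zw hw.
have [c c0 hc] := slater_margin.
have igw := rint_gfun Dw zw; have igt := rint_gfun Dmut zmut.
rewrite -subr_le0.
apply: (@le0_of_small _ _ (\int[mut]_x gfun x - \int[w]_x gfun x)) => k k0 k1.
have k01 : 0 <= k <= 1 by rewrite ltW.
have [iv eqv] := pmix_rint k01 Dw Dmut igw igt.
suff : \int[mubar]_x gfun x <= \int[pmix k w mut]_x gfun x by rewrite eqv; lra.
have Dv := D_pmix k01 Dw Dmut; have zv := Azeta_pmix k01 Dw Dmut zw zmut.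
set v := pmix k w mut in Dv zv *.
have intv t : \int[v]_x dPsi t mubar x =
    (1 - k) * \int[w]_x dPsi t mubar x + k * \int[mut]_x dPsi t mubar x.
  by have [_] := pmix_rint k01 Dw Dmut (dPsi_rint t w fmubar) (dPsi_rint t mut fmubar).
(* At an active [t] the tangent inequality gives the Slater point a slope at most [- c - eps], and
   its weight in [v] is [k]. *)
have slopeT t : Psi t mubar = eps -> \int[v]_x dPsi t mubar x <= - (k * c).
  move=> te; rewrite intv.
  have h1 := hw t te; have h2 := dPsi_tangent t mut fmubar; have h3 := hc t.
  rewrite te in h2; have e0 := eps0.
  have h4 : (1 - k) * \int[w]_x dPsi t mubar x <= 0 by rewrite mulr_ge0_le0// subr_ge0.
  have h5 : k * \int[mut]_x dPsi t mubar x <= k * (- c) by rewrite ler_pM2l//; lra.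
  lra.
have kc : 0 < k * c by rewrite mulr_gt0.
have [cP _ _ cdP _] := hPsi_diff fmubar.
have cint := @dPsi_int_continuous mubar v fmubar.
(* A steep enough multiple of the slack dominates the slope on the compact [T]. *)
have [L L0 hL] : exists2 L : R, 0 <= L & forall t,
    \int[v]_x dPsi t mubar x + k * c / 2 <= L * (eps - Psi t mubar).
  pose b t := \int[v]_x dPsi t mubar x + k * c / 2.
  pose a t := eps - Psi t mubar.
  have a0 t : 0 <= a t by rewrite subr_ge0; exact: mmubar.1.2.2.
  (* [q] is positive, for where the slack [a] vanishes the slope is at most [- (k * c)]. Its lower
     bound [r] on the compact [T] leaves, at each [t], a slack at least [r] or a negative [b]. *)
  pose q t := Num.max (a t) (- b t).
  have cq : continuous q.
    move=> t; apply: continuous_max.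
      by apply: cvgB; [exact: cvg_cst|exact: cP].
    by apply: cvgN; apply: cvgD; [exact: cint|exact: cvg_cst].
  have q0 t : 0 < q t.
    rewrite /q lt_max; apply/orP; have [at0|] := ltP 0 (a t); first by left.
    move=> at0; right; rewrite oppr_gt0 /b.
    have : Psi t mubar = eps by have := a0 t; rewrite /a in at0 *; lra.
    by move=> /slopeT; lra.
  have [r r0 hr] := compact_positive_bound hT cq q0.
  have [B hB] := dPsi_int_bound v fmubar.
  have B0 : 0 <= B by exact: le_trans (hB point).
  have Bkc : 0 <= B + k * c by rewrite addr_ge0// ltW.
  exists ((B + k * c) / r); first by rewrite divr_ge0// ltW.
  move=> t; rewrite -/(a t).
  have hb : b t <= B + k * c.
    by rewrite /b; have := le_trans (ler_norm _) (hB t); lra.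
  have := hr t; rewrite /q le_max => /orP[ra|rb].
    apply: (le_trans hb); rewrite mulrAC ler_pdivlMr// ler_wpM2l//.
  apply: (@le_trans _ _ 0); first by move: rb; rewrite -/(b t); lra.
  by rewrite mulr_ge0// divr_ge0// ltW.
have [d d0 hd] := dPsi_expansion v (divr_gt0 kc (ltr0Sn _ 1)) fmubar.
have [r r0 hr] := small_mul ltr01 L0.
apply: (@first_order_direction v (Num.min d r)) => //; first by rewrite lt_min d0.
move=> t t0; rewrite lt_min => /andP[td tr] t1.
have t01 : 0 <= t <= 1 by rewrite ltW.
split; first exact: D_pmix.
split; first by apply: Azeta_pmix => //; exact: mmubar.1.2.1.
move=> s; apply: (le_trans (hd t s t0 td)).
have h1 : t * (\int[v]_x dPsi s mubar x + k * c / 2) <= t * (L * (eps - Psi s mubar)).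
  by rewrite ler_pM2l.
have h2 : t * L <= 1 by apply: le_trans hr; rewrite ler_wpM2r// ltW.
have h3 : (t * L) * (eps - Psi s mubar) <= eps - Psi s mubar.
  by rewrite ler_piMl// subr_ge0; exact: mmubar.1.2.2.
lra.
Qed.

(** The density [h / <mu, h>] is bounded, so the measure stays in the domain. The product form of
    the conclusion includes [<mu, h> = 0], where [h * dens mu] vanishes almost everywhere and [mu]
    itself will do. *)
Lemma reweight (mu : Pphi phi) (h : Borel E -> R) : D mu ->
  (forall P : probability (Borel E) R, bounded_density P mu ->
     exists2 m : Pphi phi, Pphi_val m = P & D m) ->
  bmfun h -> (forall x, 0 <= h x) ->
  exists2 w, D w & {ae nu, forall x, (\int[mu]_y h y) * dens w x = h x * dens mu x}.
Proof.
move=> Dmu bd bh h0; have dmu := densP Dmu; have [mh [C hC]] := bh.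
set a := \int[mu]_y h y; have ih : rint mu h by exact: bmfun_rint.
have a0 : 0 <= a by apply: Rintegral_ge0 => x _.
have [a_eq|a_neq] := eqVneq a 0.
  exists mu => //; rewrite a_eq.
  have ihd : rint nu (fun x => h x * dens mu x) by apply/(integrable_density dmu mh).
  have e0 : \int[nu]_x (h x * dens mu x) = 0 by rewrite -(Rintegral_density dmu mh).
  have [_ d0 _] := dmu.
  have := Rintegral_eq0_ae ihd (fun x => mulr_ge0 (h0 x) (d0 x)) e0.
  by apply: filterS => x ->; rewrite mul0r.
have apos : 0 < a by rewrite lt_neqAle eq_sym a_neq.
have mha : measurable_fun setT (fun x => a^-1 * h x) by exact: measurable_funM.
have ha0 x : 0 <= a^-1 * h x by rewrite mulr_ge0// invr_ge0.
have int1 : (\int[mu]_x (a^-1 * h x)%:E = 1)%E.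
  by rewrite (rintegralE (rintZ a^-1 ih)) RintZ// mulVf.
have [P dP] := probability_of_density mha ha0 int1.
have [|m mP Dm] := bd P.
  exists (fun x => a^-1 * h x), (a^-1 * C); split => //; last by have [] := dP.
  move=> x; rewrite ha0/= ler_pM2l ?invr_gt0//.
  by apply: le_trans (hC x); exact: ler_norm.
exists m => //.
have dm : has_density (Pphi_val m) nu (fun x => a^-1 * h x * dens mu x).
  by rewrite mP; exact: has_density_trans dP dmu.
apply: filterS (density_unique (densP Dm) dm) => x ->.
by rewrite !mulrA divff// mul1r.
Qed.

(** * Lagrange multipliers and the Gibbs form *)

Section multiplier.
Hypotheses (bd_mubar : forall P : probability (Borel E) R, bounded_density P mubar ->
     exists2 m : Pphi phi, Pphi_val m = P & D m)
  (bd_mut : forall P : probability (Borel E) R, bounded_density P mut ->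
     exists2 m : Pphi phi, Pphi_val m = P & D m).

(** Dominates both densities, so one L1 bound relative to [r] holds at [mubar] and at the Slater
    point. *)
Let r (x : Borel E) : R := f x + dens mut x.

Let measurable_r : measurable_fun setT r.
Proof.
have [mf _ _] := densP Dmubar; have [mf' _ _] := densP Dmut; exact: measurable_funD.
Qed.

Let r_ge0 x : 0 <= r x.
Proof.
have [_ f0 _] := densP Dmubar; have [_ f0' _] := densP Dmut.
exact: addr_ge0.
Qed.

Let rint_r (u : Borel E -> R) : rint mubar u -> rint mut u ->
  rint nu (fun x => u x * r x).
Proof.
move=> iu iu'; have mu_ := rint_measurable iu.
have := rintD ((integrable_density (densP Dmubar) mu_).1 iu)
  ((integrable_density (densP Dmut) mu_).1 iu').
by congr (rint nu _); apply/funext => x; rewrite mulrDr.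
Qed.

(** [w] has density [h * r / W]: it mixes the two reweighted measures in proportion to their masses
    [a] and [b], where [a + b = W]. *)
Lemma weighted_direction (h : Borel E -> R) : bmfun h -> (forall x, 0 <= h x) ->
  0 < \int[nu]_x (h x * r x) ->
  exists2 w, D w & forall u : Borel E -> R, rint w u ->
    \int[nu]_x (u x * h x * r x) = \int[nu]_x (h x * r x) * \int[w]_x u x.
Proof.
move=> bh h0; have [mh _] := bh; set W := \int[nu]_x _ => W0.
have ih : rint mubar h by exact: bmfun_rint.
have ih' : rint mut h by exact: bmfun_rint.
have [w1 Dw1 e1] := reweight Dmubar bd_mubar bh h0.
have [w2 Dw2 e2] := reweight Dmut bd_mut bh h0.
have a0 : 0 <= \int[mubar]_y h y by apply: Rintegral_ge0 => x _.
have b0 : 0 <= \int[mut]_y h y by apply: Rintegral_ge0 => x _.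
have WE : W = \int[mubar]_y h y + \int[mut]_y h y.
  rewrite (Rintegral_density (densP Dmubar) mh) (Rintegral_density (densP Dmut) mh).
  rewrite -RintD; [|exact/(integrable_density (densP Dmubar) mh)|exact/(integrable_density (densP Dmut) mh)].
  by apply: eq_Rintegral => x _; rewrite mulrDr.
set a := \int[mubar]_y h y in e1 a0 WE; set b := \int[mut]_y h y in e2 b0 WE.
have b01 : 0 <= b / W <= 1.
  by apply/andP; split; [rewrite divr_ge0// ltW|rewrite ler_pdivrMr// mul1r WE lerDr].
exists (pmix (b / W) w1 w2); first exact: D_pmix.
move=> u iu; have Dw := D_pmix b01 Dw1 Dw2; have dw := densP Dw.
have [md _ _] := dw; have mu_ := rint_measurable iu.
have eW : {ae nu, forall x, h x * r x = W * dens (pmix (b / W) w1 w2) x}.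
  apply: filterS3 (density_unique dw (pmix_density b01 Dw1 Dw2)) e1 e2 => x -> h1 h2.
  rewrite mulrDr -h1 -h2 mulrDr !mulrA; congr (_ * _ + _ * _).
    by rewrite mulrBr mulr1 mulrCA divff ?gt_eqF// mulr1 WE addrK.
  by rewrite mulrAC divff ?gt_eqF// mul1r.
rewrite (Rintegral_density dw mu_) -RintZ; last exact/(integrable_density dw mu_).
apply: ae_eq_Rintegral.
- by apply: measurable_funM => //; exact: measurable_funM.
- by apply: measurable_funM => //; exact: measurable_funM.
- by apply: filterS eW => x e; rewrite -mulrA e; ring.
Qed.

Lemma rint_base_zero (u : Borel E -> R) (h : Borel E -> R) : (forall x, 0 <= h x) ->
  rint nu (fun x => h x * r x) -> \int[nu]_x (h x * r x) = 0 ->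
  measurable_fun setT (fun x => u x * h x * r x) ->
  \int[nu]_x (u x * h x * r x) = 0.
Proof.
move=> h0 ih e0 mu_.
have := Rintegral_eq0_ae ih (fun x => mulr_ge0 (h0 x) (r_ge0 x)) e0 => ae0.
transitivity (\int[nu]_x (cst 0 x : R)); last by rewrite Rintegral_prob_cst.
by apply: ae_eq_Rintegral => //; apply: filterS ae0 => x e; rewrite -mulrA e mulr0.
Qed.

Definition multiplier_comb (v : E -> R) (l : seq (R * T)) (x : Borel E) : R :=
  v x - \sum_(p <- l) p.1 * dPsi p.2 mubar x.

Definition active (l : seq (R * T)) :=
  all (fun p => (0 <= p.1) && (Psi p.2 mubar == eps)) l.

Lemma span_zetaE (l : seq (R * S)) (x : E) :
  (\sum_(p <- l) p.1 *: zeta p.2) x = \sum_(p <- l) p.1 * zeta p.2 x.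
Proof. by rewrite fct_sumE. Qed.

Lemma span_zeta0 : span_zeta zeta (fun=> 0).
Proof. by exists [::]; rewrite big_nil. Qed.

Lemma span_zeta_gen s : span_zeta zeta (zeta s).
Proof. by exists [:: (1, s)]; rewrite big_seq1 scale1r. Qed.

Lemma span_zetaD v v' : span_zeta zeta v -> span_zeta zeta v' ->
  span_zeta zeta (fun x => v x + v' x).
Proof. by move=> [l ->] [l' ->]; exists (l ++ l'); rewrite big_cat. Qed.

Lemma span_zetaZ c v : span_zeta zeta v -> span_zeta zeta (fun x => c * v x).
Proof.
move=> [l ->]; exists [seq (c * p.1, p.2) | p <- l]; rewrite big_map.
apply/funext => x; rewrite span_zetaE mulr_sumr fct_sumE.
by apply: eq_bigr => p _; rewrite /= -scalerA.
Qed.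

Lemma measurable_span v : span_zeta zeta v -> measurable_fun [set: Borel E] (v : Borel E -> R).
Proof.
move=> [l ->]; rewrite (_ : (\sum_(_ <- _) _) =
  (fun x => \sum_(p <- l) p.1 * zeta p.2 x)); last first.
  by apply/funext => x; rewrite span_zetaE.
by apply: measurable_sum => p; apply: measurable_funM => //; exact: measurable_zeta.
Qed.

Lemma span_bound v : span_zeta zeta v ->
  exists2 C : R, 0 <= C & forall x, `|v x| <= C * (1 + phi x).
Proof.
move=> [l ->]; elim: l => [|[c s] l [C C0 hC]].
  by exists 0 => // x; rewrite big_nil mul0r normr0.
have [_ [C' C'0 hC']] := @hzeta s; exists (`|c| * C' + C).
  by rewrite addr_ge0// mulr_ge0.
move=> x; move: (hC x); rewrite !span_zetaE big_cons/= => hCx.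
apply: (le_trans (ler_normD _ _)); rewrite mulrDl lerD// normrM -mulrA.
by rewrite ler_wpM2l.
Qed.

Lemma rint_span mu v : span_zeta zeta v -> rint mu (v : Borel E -> R).
Proof.
move=> sv; have [C _ hC] := span_bound sv; exact: rint_moment_bound (measurable_span sv) hC.
Qed.

Lemma Rintegral_span mu v : Azeta zeta mu -> span_zeta zeta v -> \int[mu]_x v x = 0.
Proof.
move=> /AzetaP zmu [l ->]; under eq_Rintegral do rewrite span_zetaE.
rewrite Rintegral_sum => [|p]; last by apply: rintZ; exact: rint_zeta.
by apply: big1 => p _; rewrite RintZ ?zmu ?mulr0//; exact: rint_zeta.
Qed.

Lemma rint_slope mu l : rint mu (fun x => \sum_(p <- l) p.1 * dPsi p.2 mubar x).
Proof. by apply: rint_sum => p; apply: rintZ; exact: dPsi_rint. Qed.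

Lemma Rintegral_slope mu l : \int[mu]_x (\sum_(p <- l) p.1 * dPsi p.2 mubar x) =
  \sum_(p <- l) p.1 * \int[mu]_x dPsi p.2 mubar x.
Proof.
rewrite Rintegral_sum => [|p]; last by apply: rintZ; exact: dPsi_rint.
by apply: eq_bigr => p _; rewrite RintZ//; exact: dPsi_rint.
Qed.

Lemma rint_comb mu v l : span_zeta zeta v -> rint mu (multiplier_comb v l).
Proof. by move=> sv; apply: rintB; [exact: rint_span|exact: rint_slope]. Qed.

Lemma Rintegral_comb mu v l : Azeta zeta mu -> span_zeta zeta v ->
  \int[mu]_x multiplier_comb v l x = - \sum_(p <- l) p.1 * \int[mu]_x dPsi p.2 mubar x.
Proof.
move=> zmu sv; rewrite RintB; [|exact: rint_span|exact: rint_slope].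
by rewrite Rintegral_span// sub0r Rintegral_slope.
Qed.

Lemma comb_bound v l : span_zeta zeta v ->
  exists2 C : R, 0 <= C & forall x, `|multiplier_comb v l x| <= C * (1 + phi x).
Proof.
move=> /span_bound[C C0 hC]; have [C' C'0 hC'] := dPsi_bound fmubar.
exists (C + (\sum_(p <- l) `|p.1|) * C').
  by rewrite addr_ge0// mulr_ge0// sumr_ge0.
move=> x; rewrite /multiplier_comb mulrDl.
apply: (le_trans (ler_normB _ _)); apply: lerD => //.
apply: (le_trans (ler_norm_sum _ _ _)); rewrite -mulrA mulr_suml.
by apply: ler_sum => p _; rewrite normrM ler_wpM2l.
Qed.

(** Centring at [mubar] makes the first-order condition homogeneous, [0 <= <w, g0>], as a duality
    with a cone requires. *)
Let c0 : R := \int[mubar]_x gfun x.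
Let g0 (x : Borel E) : R := gfun x - c0.
Let zmubar : Azeta zeta mubar. Proof. exact: mmubar.1.2.1. Qed.

Let rint_g0 mu : D mu -> Azeta zeta mu -> rint mu g0.
Proof. by move=> Dmu zmu; apply: rintB; [exact: rint_gfun|exact: rint_cst]. Qed.

Let g0_ge0 w : D w -> Azeta zeta w ->
  (forall t, Psi t mubar = eps -> \int[w]_x dPsi t mubar x <= 0) -> 0 <= \int[w]_x g0 x.
Proof.
move=> Dw zw hw; rewrite RintB; [|exact: rint_gfun|exact: rint_cst].
by rewrite Rintegral_prob_cst subr_ge0; exact: first_order.
Qed.

(** After division by [a], [g0] is bounded by 1 and the [zeta s] and [dPsi t] are bounded. The
    factor returns in the measure of density [a * r], finite because [a] is integrable at [mubar]
    and [mut]. *)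
Let a (x : Borel E) : R := 1 + (`|g0 x| + phi x).

Let a_ge1 x : 1 <= a x.
Proof. by rewrite lerDl addr_ge0//; exact: moment_ge0. Qed.

Let a_gt0 x : 0 < a x. Proof. exact: lt_le_trans ltr01 (a_ge1 x). Qed.

Let moment_le_a x : 1 + phi x <= a x.
Proof. by rewrite lerD2l lerDr. Qed.

Let measurable_g0 : measurable_fun setT g0.
Proof. by apply: measurable_funB => //; exact: measurable_gfun. Qed.

Let measurable_a : measurable_fun setT a.
Proof.
apply: measurable_funD => //; apply: measurable_funD; last exact: measurable_moment.
exact: measurableT_comp.
Qed.

Let rint_a mu : D mu -> Azeta zeta mu -> rint mu a.
Proof.
move=> Dmu zmu; apply: rintD; first exact: rint_cst.
by apply: rintD; [exact/rint_abs/rint_g0|exact: rint_moment].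
Qed.

Let measurable_div_a (u : Borel E -> R) : measurable_fun setT u ->
  measurable_fun setT (fun x => u x / a x).
Proof.
move=> mu_; apply: measurable_funM => //.
apply: (measurable_comp (F := [set x : R | x != 0])) => //.
- by apply: open_measurable; exact: open_neq.
- by move=> _ [x _ <-] /=; rewrite gt_eqF.
- apply: open_continuous_measurable_fun; first exact: open_neq.
  by move=> x; rewrite inE/= => x0; exact: inv_continuous.
Qed.

Let bmfun_div_a (u : Borel E -> R) (C : R) : measurable_fun setT u -> 0 <= C ->
  (forall x, `|u x| <= C * a x) -> bmfun (fun x => u x / a x).
Proof.
move=> mu_ C0 uC; split; first exact: measurable_div_a.
by exists C => x; rewrite normrM normfV (gtr0_norm (a_gt0 x)) ler_pdivrMr.
Qed.

Let bmfun_div_a_moment (u : Borel E -> R) (C : R) : measurable_fun setT u -> 0 <= C ->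
  (forall x, `|u x| <= C * (1 + phi x)) -> bmfun (fun x => u x / a x).
Proof.
move=> mu_ C0 uC; apply: (bmfun_div_a mu_ C0) => x.
by apply: (le_trans (uC x)); rewrite ler_wpM2l.
Qed.

Let g0_le_a x : `|g0 x| <= 1 * a x.
Proof. by rewrite mul1r /a addrCA lerDl addr_ge0//; exact: moment_ge0. Qed.

(** The summand [p] puts all bounded nonnegative functions into the cone, so that a function [h]
    nonnegative on the cone is itself nonnegative almost everywhere and can serve as a density. *)
Definition multiplier_cone (k : Borel E -> R) :=
  exists p v l, [/\ bmfun p, (forall x, 0 <= p x), span_zeta zeta v, active l &
    k = fun x => p x + multiplier_comb v l x / a x].

Lemma multiplier_cone_bm k : multiplier_cone k -> bmfun k.
Proof.
move=> [p [v [l [bp p0 sv al ->]]]]; apply: bmfunD => //.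
have [C C0 hC] := comb_bound l sv.
exact: bmfun_div_a_moment (rint_measurable (rint_comb mubar l sv)) C0 hC.
Qed.

Lemma multiplier_cone0 : multiplier_cone (fun=> 0).
Proof.
exists (fun=> 0), (fun=> 0), [::]; split => //; first by split => //; exists 0 => x; rewrite normr0.
  exact: span_zeta0.
by apply/funext => x; rewrite /multiplier_comb big_nil subrr mul0r addr0.
Qed.

Lemma multiplier_coneD k k' : multiplier_cone k -> multiplier_cone k' ->
  multiplier_cone (fun x => k x + k' x).
Proof.
move=> [p [v [l [bp p0 sv al ->]]]] [p' [v' [l' [bp' p0' sv' al' ->]]]].
exists (fun x => p x + p' x), (fun x => v x + v' x), (l ++ l'); split.
- exact: bmfunD.
- by move=> x; rewrite addr_ge0.
- exact: span_zetaD.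
- by rewrite /active all_cat; apply/andP.
- by apply/funext => x; rewrite /multiplier_comb big_cat/=; ring.
Qed.

Lemma multiplier_coneZ c k : 0 <= c -> multiplier_cone k ->
  multiplier_cone (fun x => c * k x).
Proof.
move=> c_ge0 [p [v [l [bp p0 sv al ->]]]].
exists (fun x => c * p x), (fun x => c * v x), [seq (c * p.1, p.2) | p <- l]; split.
- exact: bmfunZ.
- by move=> x; rewrite mulr_ge0.
- exact: span_zetaZ.
- rewrite /active all_map; apply: sub_all al => q /andP[q0 qe] /=.
  by rewrite mulr_ge0.
- apply/funext => x; rewrite /multiplier_comb big_map mulrDr; congr (_ + _).
  rewrite mulrA mulrBr mulr_sumr; congr ((_ - _) / _).
  by apply: eq_bigr => q _; rewrite mulrA.
Qed.

Let ainv u x : u / a x * (a x * r x) = u * r x.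
Proof. by rewrite mulrA -(mulrA u) mulVf ?gt_eqF// mulr1. Qed.

(* A dual certificate [h] defines the admissible direction of density
   [h r / int (h r)], obtained by reweighting [mubar] and [mut] with [h]; these
   are in the domain because [h] is bounded. *)
Let multiplier_cone_dual (m : {finite_measure set (Borel E) -> \bar R}) (h : Borel E -> R) :
  has_density m nu (fun x => a x * r x) -> bmfun h ->
  (forall k, multiplier_cone k -> 0 <= \int[m]_x (h x * k x)) ->
  0 <= \int[m]_x (h x * (g0 x / a x)).
Proof.
move=> dm bh hK; have [mh [C hC]] := bh.
pose hp x := Num.max (h x) 0; pose hn x := Num.max (- h x) 0.
have hp0 x : 0 <= hp x by rewrite /hp le_max lexx orbT.
have hn0 x : 0 <= hn x by rewrite /hn le_max lexx orbT.
have mhp : measurable_fun setT hp by exact: measurable_maxr.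
have mhn : measurable_fun setT hn by apply: measurable_maxr => //; exact: measurableT_comp.
have hcase x : (hp x = h x /\ hn x = 0) \/ (hp x = 0 /\ hn x = - h x).
  rewrite /hp /hn; have [h0|h0] := leP 0 (h x).
    by left; split => //; apply: max_r; rewrite oppr_le0.
  by right; split => //; apply: max_l; rewrite oppr_ge0 ltW.
have C0 : 0 <= C by exact: le_trans (hC point).
have bhp : bmfun hp.
  by split => //; exists C => x; have [[-> _]|[-> _]] := hcase x; rewrite ?normr0.
have bhn : bmfun hn.
  by split => //; exists C => x; have [[_ ->]|[_ ->]] := hcase x; rewrite ?normr0 ?normrN.
(* The negative part [hn] is in the cone; testing [h] on it gives minus the integral of [hn]
   squared. *)
have hn_ae : {ae m, forall x, hn x = 0}.
  have Khn : multiplier_cone hn.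
    exists hn, (fun=> 0), [::]; split => //; first exact: span_zeta0.
    by apply/funext => x; rewrite /multiplier_comb big_nil subrr mul0r addr0.
  have e : \int[m]_x (h x * hn x) = - \int[m]_x (hn x * hn x).
    rewrite -mulN1r -RintZ; last exact/bmfun_rint/bmfunM.
    by apply: eq_Rintegral => x _; have [[_ ->]|[_ ->]] := hcase x; ring.
  have := hK _ Khn; rewrite e oppr_ge0 => le0.
  have ge0 : 0 <= \int[m]_x (hn x * hn x) by apply: Rintegral_ge0 => x _; rewrite mulr_ge0.
  have := Rintegral_eq0_ae (bmfun_rint m (bmfunM bhn bhn)) (fun x => mulr_ge0 (hn0 x) (hn0 x))
    (le_anti (introT andP (conj le0 ge0))).
  by apply: filterS => x /eqP; rewrite mulf_eq0 orbb => /eqP.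
have transfer (u : Borel E -> R) : measurable_fun setT u ->
    \int[m]_x (h x * (u x / a x)) = \int[nu]_x (u x * hp x * r x).
  move=> mu_; have mua := measurable_div_a mu_.
  transitivity (\int[m]_x (hp x * (u x / a x))).
    apply: ae_eq_Rintegral; [exact: measurable_funM|exact: measurable_funM|].
    apply: filterS hn_ae => x hx; have [[-> _]//|[-> hE]] := hcase x.
    by move: hE; rewrite hx => /esym/eqP; rewrite oppr_eq0 => /eqP ->.
  rewrite (Rintegral_density dm); last exact: measurable_funM.
  by apply: eq_Rintegral => x _; rewrite -[LHS]mulrA ainv; ring.
have ihr : rint nu (fun x => hp x * r x).
  by apply: rint_r; exact: bmfun_rint.
rewrite transfer//.
have W0 : 0 <= \int[nu]_x (hp x * r x).
  by apply: Rintegral_ge0 => x _; rewrite mulr_ge0.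
have [W_eq|W_neq] := eqVneq (\int[nu]_x (hp x * r x)) 0.
  rewrite rint_base_zero//.
  by apply: measurable_funM => //; exact: measurable_funM.
have W_gt0 : 0 < \int[nu]_x (hp x * r x) by rewrite lt_neqAle eq_sym W_neq.
have [w Dw wE] := weighted_direction bhp hp0 W_gt0.
(* The span contains [- v] with [v], so nonnegativity on it means vanishing: [w] satisfies the
   equality constraints. *)
have int_span v : span_zeta zeta v -> 0 <= \int[w]_x v x.
  move=> sv; rewrite -(pmulr_rge0 _ W_gt0) -wE; last exact: rint_span.
  rewrite -transfer; last exact: measurable_span.
  apply: hK; exists (fun=> 0), v, [::]; split => //.
    by split => //; exists 0 => x; rewrite normr0.
  by apply/funext => x; rewrite /multiplier_comb big_nil subr0 add0r.
have zw : Azeta zeta w.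
  apply/AzetaP => s; apply/eqP; rewrite eq_le int_span ?andbT; last exact: span_zeta_gen.
  have := int_span _ (span_zetaZ (-1) (span_zeta_gen s)).
  by rewrite RintZ ?mulN1r ?oppr_ge0//; exact: rint_zeta.
rewrite wE; last exact: rint_g0.
apply: mulr_ge0 => //; apply: g0_ge0 => // t te.
(* For active [t] the single atom [(1, t)] puts [- dPsi t / a] in the cone, whence the sign
   condition of [first_order]. *)
rewrite -oppr_ge0 -mulN1r -RintZ; last exact: dPsi_rint.
rewrite -(pmulr_rge0 _ W_gt0) -wE; last exact/rintZ/dPsi_rint.
rewrite -transfer; last by apply: measurable_funM => //; exact: dPsi_measurable.
apply: hK; exists (fun=> 0), (fun=> 0), [:: (1, t)]; split => //.
- by split => //; exists 0 => x; rewrite normr0.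
- exact: span_zeta0.
- by rewrite /active/= ler01 te eqxx.
- by apply/funext => x; rewrite /multiplier_comb big_seq1/= add0r sub0r mulN1r mul1r.
Qed.

(** Multiplying by [a] undoes the weighting: the norm of [u / a] under density [a * r] is that of
    [u] under [r], hence bounds the norm under any [mu] with [dens mu <= r]. *)
Lemma multiplier_approx (e : R) : 0 < e -> exists (q : Borel E -> R) v l,
  [/\ (forall x, 0 <= q x), measurable_fun setT q, span_zeta zeta v, active l &
    forall mu, D mu -> Azeta zeta mu -> (forall x, dens mu x <= r x) ->
      rint mu (fun x => g0 x - q x - multiplier_comb v l x) /\
      \int[mu]_x `|g0 x - q x - multiplier_comb v l x| <= e].
Proof.
move=> e0.
have mar : measurable_fun setT (fun x => a x * r x) by exact: measurable_funM.
have ar0 x : 0 <= a x * r x by rewrite mulr_ge0// ltW.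
have iar : rint nu (fun x => a x * r x) by apply: rint_r; exact: rint_a.
have [m dm] := finite_measure_of_density mar ar0 (rint_lty iar).
have g0a1 x : `|g0 x / a x| <= 1.
  by rewrite normrM normfV (gtr0_norm (a_gt0 x)) ler_pdivrMr.
have [_ [p [v [l [bp p0 sv al ->]]]] hk] := L1_cone_duality multiplier_cone_bm
  multiplier_cone0 multiplier_coneD multiplier_coneZ (measurable_div_a measurable_g0)
  g0a1 (fun h => multiplier_cone_dual dm) e0.
have [mp _] := bp; have icomb := rint_measurable (rint_comb mubar l sv).
exists (fun x => a x * p x), v, l; split => //.
- by move=> x; rewrite mulr_ge0// ltW.
- exact: measurable_funM.
move=> mu Dmu zmu dr; have dmu := densP Dmu; have [md d0 _] := dmu.
set u := fun x => g0 x - a x * p x - multiplier_comb v l x.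
have mu_ : measurable_fun setT u.
  by apply: measurable_funB => //; apply: measurable_funB => //; exact: measurable_funM.
have uE x : g0 x / a x - (p x + multiplier_comb v l x / a x) = u x / a x.
  by rewrite /u; field; rewrite gt_eqF.
have mua := measurable_div_a mu_.
have bua : bmfun (fun x => u x / a x).
  have <- : (fun x => g0 x / a x - (p x + multiplier_comb v l x / a x)) =
      (fun x => u x / a x) by apply/funext => x; exact: uE.
  apply: bmfunB; first by split; [exact: measurable_div_a|exists 1].
  by apply: multiplier_cone_bm; exists p, v, l.
have absE x : `|u x / a x| * (a x * r x) = `|u x| * r x.
  by rewrite normrM normfV (gtr0_norm (a_gt0 x)) ainv.
have iur : rint nu (fun x => `|u x| * r x).
  have := (integrable_density dm _).1 (rint_abs (bmfun_rint m bua)).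
  move=> /(_ (measurableT_comp _ mua))-/(_ (@normr_measurable _ _)).
  by congr (rint nu _); apply/funext => x; exact: absE.
have le_r x : `|u x| * dens mu x <= `|u x| * r x by rewrite ler_wpM2l.
have iud : rint nu (fun x => u x * dens mu x).
  by apply: (rint_le _ _ iur) => [|x]; [exact: measurable_funM|rewrite normrM (ger0_norm (d0 x))].
have iu : rint mu u by exact/(integrable_density dmu mu_).
split => //; have mabs := rint_measurable (rint_abs iu).
have iabs := (integrable_density dmu mabs).1 (rint_abs iu).
rewrite (Rintegral_density dmu mabs); apply: le_trans hk.
rewrite (Rintegral_density dm); last first.
  by apply: measurableT_comp => //; under eq_fun do rewrite uE.
under [leRHS]eq_Rintegral do rewrite uE absE.
exact: le_rint.
Qed.

(* Testing against the Slater point bounds the mass of the multipliers; testing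
   against [mubar] shows that the positive part [q] is negligible. *)
Lemma multiplier_sequence : exists M : R, forall e : R, 0 < e -> e <= 1 ->
  exists v l, [/\ span_zeta zeta v, active l, \sum_(p <- l) p.1 <= M &
    \int[mubar]_x `|g0 x - multiplier_comb v l x| <= e *+ 2].
Proof.
have [c c_gt0 hc] := slater_margin; have zm := zmubar.
(* From [c * sum <= <mut, comb> <= <mut, g0> + e] with [e <= 1]. *)
exists ((\int[mut]_x g0 x + 1) / c) => e e0 e1.
have [q [v [l [q0 mq sv al hq]]]] := multiplier_approx e0.
have [_ f0 _] := densP Dmubar; have [_ f0' _] := densP Dmut.
have [|ib hb] := hq mubar Dmubar zm; first by move=> x; rewrite lerDl.
have [|it ht] := hq mut Dmut zmut; first by move=> x; rewrite lerDr.
have low mu : D mu -> Azeta zeta mu ->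
    rint mu (fun x => g0 x - q x - multiplier_comb v l x) ->
    \int[mu]_x `|g0 x - q x - multiplier_comb v l x| <= e ->
    rint mu q /\ \int[mu]_x q x <= \int[mu]_x g0 x - \int[mu]_x multiplier_comb v l x + e.
  move=> Dmu zmu i h; have ig := rint_g0 Dmu zmu; have ic := rint_comb mu l sv.
  have iq : rint mu q.
    by have := rintB (rintB ig ic) i; congr (rint mu _); apply/funext => x; ring.
  split => //; have := le_trans (le_normr_Rintegral measurableT i) h.
  by rewrite (RintB (rintB ig iq) ic) (RintB ig iq) ler_norml => /andP[+ _]; lra.
have [iqb hqb] := low _ Dmubar zm ib hb; have [iqt hqt] := low _ Dmut zmut it ht.
have qt0 : 0 <= \int[mut]_x q x by exact: Rintegral_ge0.
have l0 p : p \in l -> 0 <= p.1 /\ Psi p.2 mubar = eps.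
  by move=> /(allP al)/andP[? /eqP].
exists v, l; split => //.
  rewrite ler_pdivlMr// mulr_suml.
  apply: (@le_trans _ _ (\int[mut]_x multiplier_comb v l x)); last by lra.
  rewrite Rintegral_comb// -sumrN big_seq [leRHS]big_seq; apply: ler_sum => p /l0[p0 pe].
  rewrite -mulrN ler_wpM2l// lerNr.
  have := dPsi_tangent p.2 mut fmubar; rewrite pe => h; have := hc p.2; have := eps0; lra.
(* [g0] and the combination both have mean 0 at [mubar], so [q] has mean at most [e]; dropping it
   doubles the error. *)
have g0b : \int[mubar]_x g0 x = 0.
  by rewrite RintB ?Rintegral_prob_cst ?subrr//; [exact: rint_gfun|exact: rint_cst].
have cb : \int[mubar]_x multiplier_comb v l x = 0.
  by rewrite Rintegral_comb// big1 ?oppr0// => p _; rewrite dPsi_int0// mulr0.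
rewrite g0b cb subr0 add0r in hqb.
have igc := rintB (rint_g0 Dmubar zm) (rint_comb mubar l sv).
apply: (@le_trans _ _ (\int[mubar]_x (`|g0 x - q x - multiplier_comb v l x| + q x))).
  apply: le_rint; [exact: rint_abs|by apply: rintD => //; exact: rint_abs|move=> x].
  rewrite (_ : g0 x - multiplier_comb v l x = g0 x - q x - multiplier_comb v l x + q x); last by ring.
  by apply: (le_trans (ler_normD _ _)); rewrite (ger0_norm (q0 x)).
by rewrite RintD//; [rewrite mulr2n lerD|exact: rint_abs].
Qed.

(** The slope sums converge to the [lam]-integral, so minus the span part converges in L1 to [z],
    which is defined by solving the identity. Complementary slackness is the weak limit tested on
    the continuous slack, zero at every atom. *)
Lemma multipliers_exist :
  exists (z : E -> R) (lam : {finite_measure set (Borel T) -> \bar R}),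
  [/\ in_L1_closure mubar (span_zeta zeta) z, (\int[mubar]_x (z x)%:E = 0)%E,
      {ae lam, forall t, Psi t mubar = eps} &
      forall x, ln (f x) + dF mubar x + z x + \int[lam]_t dPsi t mubar x = c0].
Proof.
have [M hM] := multiplier_sequence; have zm := zmubar.
pose e_ n : R := n.+1%:R^-1.
have e_gt0 n : 0 < e_ n by rewrite invr_gt0.
have e_le1 n : e_ n <= 1 by rewrite invf_le1// ler1n.
have hseq n : exists vl : (E -> R) * seq (R * T), [/\ span_zeta zeta vl.1, active vl.2,
    \sum_(p <- vl.2) p.1 <= M & \int[mubar]_x `|g0 x - multiplier_comb vl.1 vl.2 x| <= e_ n *+ 2].
  by have [v [l H]] := hM _ (e_gt0 n) (e_le1 n); exists (v, l).
have [vl hvl] := choice hseq.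
pose v n := (vl n).1; pose l n := (vl n).2.
have l0 n : all (fun p => 0 <= p.1) (l n).
  by have [_ al _ _] := hvl n; apply: sub_all al => p /andP[].
have lM n : \sum_(p <- l n) p.1 <= M by have [] := hvl n.
have [lam [s [sn hlim]]] := discrete_measures_weak_limit hT l0 lM.
have [cP _ _ _ _] := hPsi_diff fmubar; have [C C_ge0 hC] := dPsi_bound fmubar.
pose q (x : Borel E) : R := \int[lam]_t dPsi t mubar x.
have [iq q_fub] := dPsi_kernel mubar lam fmubar; rewrite -/q in iq q_fub.
have ig := rint_g0 Dmubar zm.
pose z (x : E) : R := - (g0 x + q x).
have iz : rint mubar (z : Borel E -> R) by apply: rintN; exact: rintD.
have q_int : \int[mubar]_x q x = 0.
  rewrite q_fub; under eq_Rintegral do rewrite dPsi_int0//.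
  by rewrite /Rintegral integral0.
have g0b : \int[mubar]_x g0 x = 0.
  by rewrite RintB ?Rintegral_prob_cst ?subrr//; [exact: rint_gfun|exact: rint_cst].
exists z, lam; split.
- split => // e e_pos.
  pose u n (x : Borel E) : R := \sum_(p <- l (s n)) p.1 * dPsi p.2 mubar x.
  pose G (x : Borel E) : R := M * C * (1 + phi x).
  have iG : rint mubar G by apply: rintZ; apply: rintD; [exact: rint_cst|exact: rint_moment].
  have uG n x : `|u n x| <= G x.
    apply: (le_trans (ler_norm_sum _ _ _)).
    apply: (@le_trans _ _ ((\sum_(p <- l (s n)) p.1) * (C * (1 + phi x)))).
      rewrite mulr_suml big_seq [leRHS]big_seq; apply: ler_sum => p /(allP (l0 _)) p0.
      by rewrite normrM (ger0_norm p0) ler_wpM2l.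
    rewrite /G -mulrA ler_wpM2r// mulr_ge0// addr_ge0//; exact: moment_ge0.
  have mu_ n := rint_measurable (rint_slope mubar (l (s n))).
  have uq : {ae mubar, forall x, u n x @[n --> \oo] --> q x}.
    by apply: aeW => x; apply: hlim; exact: dPsi_continuous.
  have [_ + _] := Rdominated_convergence mu_ (rint_measurable iq) iG uG uq.
  have e4 : 0 < e / 4 by rewrite divr_gt0.
  move=> /cvgrPdist_lt/(_ _ e4)[N _ hN].
  have /cvgrPdist_lt/(_ _ e4)[N' _ hN'] : e_ n @[n --> \oo] --> (0 : R) by exact: cvg_harmonic.
  pose n := maxn N N'.
  have := hN n (leq_maxl _ _); rewrite sub0r normrN => /(le_lt_trans (ler_norm _)) h1.
  have := hN' (s n) (leq_trans (leq_maxr _ _) (sn n)).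
  rewrite sub0r normrN => /(le_lt_trans (ler_norm _)) h2.
  have [sv _ _ h3] := hvl (s n).
  exists (fun x => -1 * v (s n) x); first exact: span_zetaZ.
  rewrite Lnorm1.
  have igc := rintB ig (rint_comb mubar (l (s n)) sv).
  have iuq := rintB (rint_slope mubar (l (s n))) iq.
  have id : rint mubar (fun x => z x - (-1 * v (s n) x)).
    by apply: rintB => //; apply: rintZ; exact: rint_span.
  rewrite (_ : (\int[mubar]_x _)%E = (\int[mubar]_x `|z x - (-1 * v (s n) x)|)%:E); last first.
    by rewrite -rintegralE//; exact: rint_abs.
  rewrite lte_fin.
  apply: (@le_lt_trans _ _ (\int[mubar]_x `|g0 x - multiplier_comb (v (s n)) (l (s n)) x|
      + \int[mubar]_x `|u n x - q x|)); last first.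
    move: h3; rewrite -/(v _) -/(l _) mulr2n => h3.
    rewrite [ltRHS](_ : e = e / 4 + e / 4 + e / 4 + e / 4); last by field.
    by lra.
  rewrite -RintD; [|exact: rint_abs|exact: rint_abs].
  apply: le_rint; [exact: rint_abs|by apply: rintD; exact: rint_abs|move=> x].
  rewrite (_ : _ - _ = - (g0 x - multiplier_comb (v (s n)) (l (s n)) x) + (u n x - q x)).
    by apply: (le_trans (ler_normD _ _)); rewrite normrN.
  by rewrite /z /multiplier_comb /u; ring.
- rewrite (rintegralE iz).
  rewrite (_ : \int[mubar]_x z x = \int[mubar]_x (-1 * (g0 x + q x))); last first.
    by apply: eq_Rintegral => x _; rewrite mulN1r.
  by rewrite (RintZ _ (rintD ig iq)) (RintD ig iq) g0b q_int addr0 mulr0.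
- have cslack : continuous (fun t : T => eps - Psi t mubar).
    by move=> t; apply: cvgB; [exact: cvg_cst|exact: cP].
  have islack : rint lam (fun t : Borel T => eps - Psi t mubar).
    exact: (continuous_compact_rint hT lam cslack).
  have slack0 : \int[lam]_t (eps - Psi t mubar) = 0.
    have := hlim _ cslack.
    rewrite (_ : (fun n => _) = (fun=> 0)) => [h|]; first by rewrite -(cvg_lim _ h)//; exact: lim_cst.
    apply/funext => n; rewrite big_seq big1// => p.
    have [_ al _ _] := hvl (s n).
    by move=> /(allP al)/andP[_ /eqP ->]; rewrite subrr mulr0.
  have slack_ge0 t : 0 <= eps - Psi t mubar by rewrite subr_ge0; exact: mmubar.1.2.2.
  apply: filterS (Rintegral_eq0_ae islack slack_ge0 slack0) => t /eqP.
  by rewrite subr_eq0 => /eqP.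
- by move=> x; rewrite /z -/(q x) /g0 /gfun; ring.
Qed.

Lemma gibbs_exists : exists (z : E -> R)
    (lam : {finite_measure set (Borel T) -> \bar R}) (A : set (Borel E)),
  gibbs_form nu zeta Psi dF dPsi eps mubar z lam A.
Proof.
have [z [lam [cz iz ael eq_c0]]] := multipliers_exist.
have df := densP Dmubar; have [mf f0 fE] := df.
pose A : set (Borel E) := [set x | 0 < f x].
have mA : measurable A.
  rewrite (_ : A = f @^-1` `]0, +oo[%classic).
    by rewrite -[X in measurable X]setTI; exact: mf.
  by apply/seteqP; split => x; rewrite /A /= in_itv/= andbT.
have f_eq x : f x = expR c0 * (\1_A x * gibbs_weight dF dPsi mubar z lam x).
  rewrite indicE; have [fx|fx] := ltP 0 (f x).
    rewrite mem_set// mul1r /gibbs_weight -expRD.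
    by rewrite -[LHS]lnK//; congr expR; have := eq_c0 x; lra.
  rewrite memNset ?mul0r ?mulr0; last by rewrite /A/=; apply/negP; rewrite -leNgt.
  by apply/le_anti; rewrite fx f0.
have w_eq x : \1_A x * gibbs_weight dF dPsi mubar z lam x = expR (- c0) * f x.
  by rewrite f_eq mulrA -expRD addNr expR0 mul1r.
exists z, lam, A; split => //.
- split => //; rewrite -[A]setCK; apply: etrans (probability_setC mubar (measurableC mA)) _.
  rewrite (_ : ~` A = [set x | f x = 0]).
    by rewrite (density_neq0 df) sube0.
  apply/seteqP; split => x /=; last by move=> fx; rewrite /A /= fx ltxx.
  by move=> /negP; rewrite -leNgt => fx; apply/le_anti; rewrite fx f0.
- split; first exact: has_density_dominates df.
  (* The multiplier identity reads [f = expR c0 * gibbs_weight] on [A], so the normalising constant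
     is explicit. *)
  exists (expR (- c0)); split; first exact: expR_gt0.
    under eq_integral do rewrite w_eq.
    rewrite rintegralE; last by apply: rintZ; exact: density_integrable df.
    rewrite RintZ ?(Rintegral_density1 df) ?mulr1//; exact: density_integrable df.
  apply: filterS (density_charge_RN df) => x /(_ I) ->.
  by rewrite /= w_eq mulrA mulVf ?mul1r// gt_eqF// expR_gt0.
Qed.

End multiplier.

(** * Sensitivity of the value to the constraint level *)

Lemma gibbs_subgradient z (lam : {finite_measure set (Borel T) -> \bar R})
    (A : set (Borel E)) mu eps' :
  gibbs_form nu zeta Psi dF dPsi eps mubar z lam A -> nu A = 1%E ->
  (forall mu, Azeta zeta mu -> rint mu (z : Borel E -> R) /\ \int[mu]_x z x = 0) ->
  feasible nu F zeta Psi eps' mu ->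
  Ir mubar - fine (lam setT) * (eps' - eps) <= Ir mu.
Proof.
move=> [[mA _] [_ [Z [Z0 _ RN]]] _ _ lam_eps] nuA hz [Dmu [zmu pmu]].
have zm : Azeta zeta mubar := mmubar.1.2.1.
have df := densP Dmubar; have [mf f0 _] := df.
have dmu := densP Dmu; have [md d0 _] := dmu.
pose q (x : Borel E) : R := \int[lam]_t dPsi t mubar x.
pose u (x : Borel E) : R := - ln Z - (dF mubar x + (z x + q x)).
(* Full [nu]-measure of [A] makes [f] positive [nu]-a.e., so [ent] has a finite tangent at [f] and
   [ln f] equals the exponent [u]. *)
have aeA : {ae nu, forall x, A x}.
  exists (~` A); split; [exact: measurableC| |by []].
  by apply: etrans (probability_setC nu mA) _; rewrite nuA subee.
have ln_f : {ae nu, forall x, 0 < f x /\ ln (f x) = u x}.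
  apply: filterS3 aeA (density_charge_RN df) RN => x Ax /(_ I) -> [fx].
  have -> : f x = _ := fx; rewrite indicE mem_set// mul1r; split; first by rewrite mulr_gt0 ?invr_gt0 ?expR_gt0.
  rewrite lnM ?posrE ?invr_gt0 ?expR_gt0// lnV ?posrE// expRK /u -/(q x).
  by ring.
have iF w (Dw : D w) := dF_rint fmubar Dw.
have iq w := (dPsi_kernel w lam fmubar).1.
have iu0 w : D w -> Azeta zeta w -> rint w (fun x => dF mubar x + (z x + q x)).
  by move=> Dw zw; apply: rintD; [exact: iF|apply: rintD; [exact: (hz _ zw).1|exact: iq]].
have iu w : D w -> Azeta zeta w -> rint w u.
  by move=> Dw zw; apply: rintB; [exact: rint_cst|exact: iu0].
have int_u w : D w -> Azeta zeta w -> \int[w]_x u x =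
    - ln Z - (\int[w]_x dF mubar x + \int[lam]_t \int[w]_x dPsi t mubar x).
  move=> Dw zw; have [izw z0] := hz _ zw.
  rewrite (RintB (rint_cst _ _) (iu0 _ Dw zw)) Rintegral_prob_cst.
  rewrite (RintD (iF _ Dw) (rintD izw (iq w))) (RintD izw (iq w)) z0 add0r.
  by rewrite (dPsi_kernel w lam fmubar).2.
have mu_ := rint_measurable (iu _ Dmubar zm).
have iuf := (integrable_density df mu_).1 (iu _ Dmubar zm).
have iud := (integrable_density dmu mu_).1 (iu _ Dmu zmu).
(* [ent_tangent] at [f], integrated with [u] in place of [ln f]; the mean of [u] is computable
   because [z] has mean 0 under both measures. *)
have tangent : Hent mubar + (\int[mu]_x u x - \int[mubar]_x u x) <= Hent mu.
  rewrite (Rintegral_density dmu mu_) (Rintegral_density df mu_) -(RintB iud iuf).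
  have ief := rint_ent_dens Dmubar; have ied := rint_ent_dens Dmu.
  have itan := rintD ief (rintB iud iuf); have igap := rintB ied itan.
  rewrite -(RintD ief (rintB iud iuf)) -subr_ge0 -(RintB ied itan).
  set gap := fun x => _ in igap *.
  rewrite (_ : Rintegral _ _ _ = \int[nu]_x `|gap x|); first exact: Rintegral_ge0.
  apply: ae_eq_Rintegral; [exact: rint_measurable igap|exact: rint_measurable (rint_abs igap)|].
  apply: filterS ln_f => x [fx lnfx]; rewrite ger0_norm// /gap subr_ge0 -lnfx.
  by have := ent_tangent (d0 x) fx; rewrite -/f; lra.
have hF := dF_tangent fmubar Dmu.
(* For [lam]-almost every [t], [Psi t mubar = eps], so the tangent inequality bounds the slope by
   [eps' - eps]. *)
have slope : \int[lam]_t \int[mu]_x dPsi t mubar x <= fine (lam setT) * (eps' - eps).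
  have [cP _ _ _ _] := hPsi_diff fmubar.
  have cslack : continuous (fun t : T => eps' - Psi t mubar).
    by move=> t; apply: cvgB; [exact: cvg_cst|exact: cP].
  have islack : rint lam (fun t : Borel T => eps' - Psi t mubar).
    exact: (continuous_compact_rint hT lam cslack).
  apply: (@le_trans _ _ (\int[lam]_t (eps' - Psi t mubar))).
    apply: le_rint => // [|t].
      exact: (continuous_compact_rint hT lam (@dPsi_int_continuous mubar mu fmubar)).
    by apply: le_trans (dPsi_tangent t mu fmubar) _; rewrite lerD2r.
  rewrite mulrC -Rintegral_cst// le_eqVlt; apply/orP; left; apply/eqP.
  apply: ae_eq_Rintegral => //; first exact: rint_measurable islack.
  apply: (@filterS _ (almost_everywhere (lam : {measure set (Borel T) -> \bar R})) _ _ _ _ lam_eps).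
  by move=> t ->.
have slope0 : \int[lam]_t \int[mubar]_x dPsi t mubar x = 0.
  under eq_Rintegral do rewrite dPsi_int0//.
  by rewrite /Rintegral integral0.
rewrite (int_u _ Dmu zmu) (int_u _ Dmubar zm) slope0 (dF_int0 fmubar) in tangent.
by rewrite /Ir; lra.
Qed.

End at_minimiser.

Lemma minimiser_gibbs (e : R) : 0 <= e <= epsstar ->
  (forall mubar, feasible nu F zeta Psi epsstar mubar ->
    forall P : probability (Borel E) R, bounded_density P mubar ->
    exists2 m : Pphi phi, Pphi_val m = P & D m) ->
  (forall P : probability (Borel E) R, bounded_density P mut ->
    exists2 m : Pphi phi, Pphi_val m = P & D m) ->
  exists mubar : Pphi phi,
    [/\ is_minimiser nu F zeta Psi e mubar,
        (forall mu, is_minimiser nu F zeta Psi e mu ->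
          forall A : set (Borel E), measurable A -> mu A = mubar A),
        (forall mu : Pphi phi, D mu -> Azeta zeta mu -> mu `<< mubar) &
        exists (zbar : E -> R)
               (lambda : {finite_measure set (Borel T) -> \bar R})
               (Sbar : set (Borel E)),
          gibbs_form nu zeta Psi dF dPsi e mubar zbar lambda Sbar].
Proof.
move=> /andP[e0 eb] hbd hbdt.
have [|mubar mmubar] := @exists_minimises e.
  by exists mut; exact: feasible_mut.
exists mubar; split.
- exact/is_minimiserP.
- by move=> mu /is_minimiserP mmu A mA; exact: (minimises_unique mmu mmubar mA).
- move=> mu Dmu zmu; exact: (minimiser_null_dominates e0 mmubar Dmu zmu).
- apply: (gibbs_exists e0 eb mmubar) => //.
  exact: hbd (feasible_mubar eb mmubar).
Qed.

Lemma value_sensitivity (mubar : R -> Pphi phi) (zbar : R -> E -> R)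
    (lambda : R -> {finite_measure set (Borel T) -> \bar R})
    (Sbar : R -> set (Borel E)) :
  (forall e : R, 0 <= e <= epsstar ->
    is_minimiser nu F zeta Psi e (mubar e) /\
    gibbs_form nu zeta Psi dF dPsi e (mubar e) (zbar e) (lambda e) (Sbar e)) ->
  (forall e : R, 0 <= e <= epsstar ->
    nu (Sbar e) = 1%E /\
    forall mu : Pphi phi, Azeta zeta mu ->
      mu.-integrable [set: Borel E] (EFin \o zbar e) /\
      (\int[mu]_x (zbar e x)%:E = 0)%E) ->
  [/\ absolutely_continuous_on 0 epsstar (fun e => fine (value nu F zeta Psi e)),
      {ae (@lebesgue_measure R), forall e, 0 < e < epsstar ->
        is_derive e 1 (fun e : R => fine (value nu F zeta Psi e))
          (- fine (lambda e setT))} &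
      exists2 Cstab : R, 0 <= Cstab &
        forall e : R, 0 <= e <= epsstar ->
          (0 <= value nu F zeta Psi 0 - value nu F zeta Psi e
             <= (Cstab * e)%:E)%E].
Proof.
move=> hmin hS.
pose v (e : R) : R := fine (value nu F zeta Psi e).
pose L (e : R) : R := fine (lambda e setT).
have vE (e : R) : 0 <= e <= epsstar -> value nu F zeta Psi e = (v e)%:E.
  move=> /hmin[/is_minimiserP me _]; by rewrite /v (minimises_value me).
have sub (e e' : R) : 0 <= e <= epsstar -> 0 <= e' <= epsstar ->
    v e - L e * (e' - e) <= v e'.
  move=> ie ie'; have [/is_minimiserP me ge] := hmin _ ie.
  have [/is_minimiserP me' _] := hmin _ ie'.
  rewrite /v (minimises_value me) (minimises_value me')/=.
  have [nuS hz] := hS _ ie; have /andP[_ eb] := ie.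
  apply: (gibbs_subgradient eb me ge nuS) => [mu zmu|]; last exact: me'.1.
  by have [iz z0] := hz _ zmu; split => //; rewrite /Rintegral z0.
have L0 (e : R) : 0 <= e <= epsstar -> 0 <= L e by move=> _; exact: fine_ge0.
have i0 : (0 : R) <= 0 <= epsstar by rewrite lexx ltW.
split.
- exact: subgradient_absolutely_continuous hepsstar L0 sub.
- exact: subgradient_ae_derive sub.
- exists (L 0); first exact: L0.
  move=> e ie; have /andP[e0 eb] := ie.
  rewrite (vE _ i0) (vE _ ie) -EFinB !lee_fin -[X in L 0 * X]subr0.
  exact: subgradient_bound hepsstar L0 sub _ _ (lexx 0) e0 eb.
Qed.

End problem_domain.

Theorem proposition2p19
  (R : realType)
  (E : completeMetricType R) (hE : separable_space E)
  (phi : moment_fun E) (nu : probability (Borel E) R)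
  (F : Pphi phi -> \bar R)
  (S : Type) (zeta : S -> E -> R)
  (T : pointedMetricType R) (hT : compact [set: T])
  (Psi : T -> Pphi phi -> R)
  (dF : Pphi phi -> E -> R) (dPsi : T -> Pphi phi -> E -> R)
  (epsstar : R)
  (hF_gtNy : forall mu, (-oo < F mu)%E)
  (hF_meas : measurable_fun [set: Borel (Pphi phi)] F)
  (hnu : forall alpha : R, 0 < alpha ->
    (\int[nu]_x (expR (alpha * phi x))%:E < +oo)%E)
  (hI_lsc : lower_semicontinuous (rate nu F))
  (hzeta : forall s, continuous (zeta s) /\
    exists2 C : R, 0 <= C & forall x, `|zeta s x| <= C * (1 + phi x))
  (hPsi_lsc : forall t, lower_semicontinuous (fun mu => (Psi t mu)%:E))
  (hF_convex : convex_functional F)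
  (hPsi_convex : forall t, convex_functional (fun mu => (Psi t mu)%:E))
  (hF_bounded : exists m : R, forall mu, (m%:E <= F mu)%E)
  (hPsi_meas : forall mu : Pphi phi, Azeta zeta mu ->
    measurable_fun [set: Borel T] (fun t => Psi t mu))
  (hepsstar : 0 < epsstar)
  (hF_diff : forall mubar, feasible nu F zeta Psi epsstar mubar ->
    convex_subset (rate_dom nu F) /\
    is_lfderiv (rate_dom nu F) (fun mu => fine (F mu)) mubar (dF mubar))
  (hPsi_diff : forall mubar, feasible nu F zeta Psi epsstar mubar ->
    [/\ continuous (fun t : T => Psi t mubar),
        (forall t, is_lfderiv [set: Pphi phi] (Psi t) mubar (dPsi t mubar)),
        (forall mu : Pphi phi,
          ereal_sup (range (fun t : T =>
            (`| e^-1 * (Psi t (pmix e mubar mu) - Psi t mubar)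
                - ((\int[mu]_x dPsi t mubar x)
                   - (\int[mubar]_x dPsi t mubar x)) |)%:E))
          @[e --> 0^'+] --> 0%E),
        (forall x : E, continuous (fun t : T => dPsi t mubar x)) &
        exists2 D : R, 0 <= D &
          forall x : E, (ereal_sup (range (fun t : T => `|dPsi t mubar x|%:E))
                          <= (D * (1 + phi x))%:E)%E])
  (hbounded_density : forall mubar, feasible nu F zeta Psi epsstar mubar ->
    forall mu : probability (Borel E) R, bounded_density mu mubar ->
    exists2 m : Pphi phi, Pphi_val m = mu & rate_dom nu F m)
  (hslater : exists mutilde : Pphi phi,
    [/\ rate_dom nu F mutilde, Azeta zeta mutilde,
        (forall t, Psi t mutilde < 0) &
        forall mu : probability (Borel E) R, bounded_density mu mutilde ->
        exists2 m : Pphi phi, Pphi_val m = mu & rate_dom nu F m]) :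
  (forall eps : R, 0 <= eps <= epsstar ->
    exists mubar : Pphi phi,
    [/\ is_minimiser nu F zeta Psi eps mubar,
        (forall mu, is_minimiser nu F zeta Psi eps mu ->
          forall A : set (Borel E), measurable A -> mu A = mubar A),
        (forall mu : Pphi phi, rate_dom nu F mu -> Azeta zeta mu ->
          mu `<< mubar) &
        exists (zbar : E -> R)
               (lambda : {finite_measure set (Borel T) -> \bar R})
               (Sbar : set (Borel E)),
          gibbs_form nu zeta Psi dF dPsi eps mubar zbar lambda Sbar])
  /\
  (forall (mubar : R -> Pphi phi) (zbar : R -> E -> R)
          (lambda : R -> {finite_measure set (Borel T) -> \bar R})
          (Sbar : R -> set (Borel E)),
    (forall eps : R, 0 <= eps <= epsstar ->
      is_minimiser nu F zeta Psi eps (mubar eps) /\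
      gibbs_form nu zeta Psi dF dPsi eps
        (mubar eps) (zbar eps) (lambda eps) (Sbar eps)) ->
    (forall eps : R, 0 <= eps <= epsstar ->
      nu (Sbar eps) = 1%E /\
      forall mu : Pphi phi, Azeta zeta mu ->
        mu.-integrable [set: Borel E] (EFin \o zbar eps) /\
        (\int[mu]_x (zbar eps x)%:E = 0)%E) ->
    [/\ absolutely_continuous_on 0 epsstar
          (fun eps => fine (value nu F zeta Psi eps)),
        {ae (@lebesgue_measure R), forall eps, 0 < eps < epsstar ->
          is_derive eps 1 (fun e : R => fine (value nu F zeta Psi e))
            (- fine (lambda eps setT))} &
        exists2 Cstab : R, 0 <= Cstab &
          forall eps : R, 0 <= eps <= epsstar ->
            (0 <= value nu F zeta Psi 0 - value nu F zeta Psi eps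
               <= (Cstab * eps)%:E)%E]).

Proof.
have [mut [Dmut zmut pmut hbdt]] := hslater; split.
- move=> eps heps.
  exact: (minimiser_gibbs hF_gtNy hnu hzeta hF_convex hPsi_convex hI_lsc hPsi_lsc
    hF_bounded hepsstar hT hF_diff hPsi_diff Dmut zmut pmut heps hbounded_density hbdt).
- move=> mubar zbar lambda Sbar.
  exact: (value_sensitivity hF_gtNy hF_convex hPsi_convex hepsstar hT hF_diff hPsi_diff).
Qed.
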